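(* Let $N_n$ be chosen uniformly at random among all labeled simplex galled trees with $n$ leaves, and let $S_n^{(\ell,\max)}=S^+(N_n)$, $S_n^{(\ell,\min)}=S^-(N_n)$. Then, as $n\to\infty$, \[ \mathbb{E}\big(S_n^{(\ell,\max)}\big)\sim\sqrt{\tfrac{2+\sqrt2}{2}}\,\sqrt{\pi}\,n^{3/2}\quad\text{and}\quad \mathbb{E}\big(S_n^{(\ell,\min)}\big)\sim\sqrt{\tfrac{2+\sqrt2}{2}}\,\sqrt{\pi}\,n^{3/2}. \]
   Context: A (rooted, binary) phylogenetic network is a finite acyclic directed graph without multiple edges whose nodes are: a unique root (indegree 0, outdegree 2), leaves (indegree 1, outdegree 0), tree nodes (indegree 1, outdegree 2), and reticulation nodes (indegree 2, outdegree 1). A tree-cycle (gall) is a pair of edge-disjoint directed paths from a tree node (or the root) to a reticulation node all of whose intermediate nodes are tree nodes. A galled tree is a phylogenetic network in which every reticulation node lies in a tree-cycle and any two tree-cycles are node-disjoint. A galled tree is simplex if the child of every reticulation node is a leaf. A labeled network with $n$ leaves has its leaves bijectively labeled by $\{1,\dots,n\}$; two such are identified if there is a digraph isomorphism preserving leaf labels. For a leaf $x$, $h^+(x)$ (resp. $h^-(x)$) is the length of a longest (resp. shortest) directed path from the root to $x$; $S^+(N)=\sum_x h^+(x)$ and $S^-(N)=\sum_x h^-(x)$ over all leaves $x$ of $N$. *)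

(* Defs.v *)
From HB Require Import structures.
From mathcomp Require Import all_boot all_order all_algebra fingroup perm.
From mathcomp Require Import all_classical all_reals all_analysis.

Set Implicit Arguments.
Unset Strict Implicit.
Unset Printing Implicit Defensive.

Import Order.TTheory GRing.Theory Num.Theory.

(* A (leaf-labelled) digraph with vertex set V inside 'I_K, edge set E, and
   leaf labelling lab : 'I_n -> 'I_K  (labels {1..n} are encoded as 'I_n). *)
Definition netT (n K : nat) :=
  ({set 'I_K} * {set 'I_K * 'I_K} * {ffun 'I_n -> 'I_K})%type.

Section Networks.
Variables (n K : nat).
Variable N : netT n K.

Definition nverts : {set 'I_K} := N.1.1.
Definition nedges : {set 'I_K * 'I_K} := N.1.2.
Definition nlab : {ffun 'I_n -> 'I_K} := N.2.

Definition erel : rel 'I_K := fun u v => (u, v) \in nedges.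
Definition indeg (v : 'I_K) := #|[set u | erel u v]|.
Definition outdeg (v : 'I_K) := #|[set w | erel v w]|.

Definition is_root v := [&& v \in nverts, indeg v == 0 & outdeg v == 2].
Definition is_leaf v := [&& v \in nverts, indeg v == 1 & outdeg v == 0].
Definition is_tree v := [&& v \in nverts, indeg v == 1 & outdeg v == 2].
Definition is_ret  v := [&& v \in nverts, indeg v == 2 & outdeg v == 1].

Definition is_network : bool :=
  [&& [forall u, forall v, erel u v ==> (u \in nverts) && (v \in nverts)],
      [forall u, forall v, erel u v ==> ~~ connect erel v u],
      #|[set v | is_root v]| == 1,
      [forall v in nverts, [|| is_root v, is_leaf v, is_tree v | is_ret v]],
      injectiveb nlab &
      [set v | is_leaf v] == [set nlab i | i : 'I_n]].

Definition pedges (x : 'I_K) (p : seq 'I_K) : {set 'I_K * 'I_K} :=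
  [set e | e \in zip (x :: p) p].

Definition tree_cycle (s : 'I_K) (p1 p2 : seq 'I_K) : Prop :=
  [/\ is_root s || is_tree s,
      [&& p1 != [::], p2 != [::], path.path erel s p1 & path.path erel s p2],
      (last s p1 = last s p2 /\ is_ret (last s p1)),
      all is_tree (behead (belast s p1)) && all is_tree (behead (belast s p2))
    & [disjoint pedges s p1 & pedges s p2]].

Definition cycle_nodes (s : 'I_K) (p1 p2 : seq 'I_K) : {set 'I_K} :=
  [set v | v \in s :: p1 ++ p2].

Definition galled_tree : Prop :=
  is_network /\
  (forall v, is_ret v ->
     exists s p1 p2, tree_cycle s p1 p2 /\ last s p1 = v) /\
  (forall s p1 p2 s' q1 q2, tree_cycle s p1 p2 -> tree_cycle s' q1 q2 ->
     (s = s' /\ ((p1 = q1 /\ p2 = q2) \/ (p1 = q2 /\ p2 = q1)))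
     \/ [disjoint cycle_nodes s p1 p2 & cycle_nodes s' q1 q2]).

Definition simplex_galled_tree : Prop :=
  galled_tree /\ (forall v w, is_ret v -> erel v w -> is_leaf w).

(* there is a directed walk with exactly k edges from u to v
   (in a DAG walks are paths, and have < K edges) *)
Fixpoint reach (k : nat) (u v : 'I_K) : bool :=
  if k is k'.+1 then [exists w, erel u w && reach k' w v] else u == v.

Definition root_of : option 'I_K := [pick v | is_root v].

Definition hmax (x : 'I_K) : nat :=
  if root_of is Some r then \max_(k < K | reach k r x) k else 0.
Definition hmin (x : 'I_K) : nat :=
  if root_of is Some r then \big[minn/K]_(k < K | reach k r x) (k : nat)
  else 0.

Definition Splus : nat := \sum_(i < n) hmax (nlab i).
Definition Sminus : nat := \sum_(i < n) hmin (nlab i).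

End Networks.

(* isomorphism of labelled networks: a digraph isomorphism preserving leaf
   labels (any bijection V -> V' extends to a permutation of 'I_K) *)
Definition net_iso (n K : nat) : rel (netT n K) := fun N N' =>
  [exists s : {perm 'I_K},
     [&& s @: nverts N == nverts N',
         [forall u, forall v, erel N u v == erel N' (s u) (s v)] &
         [forall i, nlab N' i == s (nlab N i)]]].

(* A simplex galled tree with n leaves has 2n+2r-1 <= 4n-1 nodes (r <= n
   reticulations), so vertex set 'I_(4n+1) suffices. *)
Definition Kn (n : nat) : nat := (4 * n).+1.

Definition SGT (n : nat) : {set netT n (Kn n)} :=
  [set N | `[< simplex_galled_tree N >]].

(* isomorphism classes = the labelled simplex galled trees with n leaves *)
Definition SGT_classes (n : nat) : {set {set netT n (Kn n)}} :=
  equivalence_partition (@net_iso n (Kn n)) (SGT n).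

Definition dflt_net (n : nat) : netT n (Kn n) := (finset.set0, finset.set0, [ffun => ord0]).

Definition rep (n : nat) (B : {set netT n (Kn n)}) : netT n (Kn n) :=
  odflt (dflt_net n) [pick x in B].

Definition E_Smax (R : realType) (n : nat) : R :=
  (\sum_(B in SGT_classes n) (Splus (rep B))%:R) / (#|SGT_classes n|%:R).
Definition E_Smin (R : realType) (n : nat) : R :=
  (\sum_(B in SGT_classes n) (Sminus (rep B))%:R) / (#|SGT_classes n|%:R).

(* Main.v *)
(** A simplex galled tree is described by a plane term built from leaves, binary
    nodes and galls (two sequences of subterms hanging off the two sides, and the
    leaf below the reticulation). Leaf labels rule out symmetries, so a network
    with k binary nodes and galls has exactly 2^k terms; giving a term the weight
    2^-k, sums over isomorphism classes become n! times sums over unlabelled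
    terms. With A the generating function of the weights and B = 1/(1-A),
      2A = z + A^2 + z B^2,
    and the total leaf height P (for longest or for shortest paths) satisfies
      2 P (1 - 6z + z^2) = z ((1-A)^2 + 1)(A + zB^4 + zB^3) + z (1-A) Y G,
    where Y^2 = 1 - 6z + z^2 and G only records the lengths of the sides of the
    galls. At the singularity rho = (sqrt 2 - 1)^2 everything on the right
    converges absolutely and Y vanishes, so P_n rho^n has the limit 1/4 in both
    cases. Finally 1 - A(t^2) is the even part of sqrt (1 - 2t - t^2), and Wallis'
    product gives the asymptotics of its coefficients. *)

Require Import Defs.
From HB Require Import structures.
From mathcomp Require Import all_boot all_order all_algebra fingroup perm.
From mathcomp Require boolp.
From mathcomp Require Import zify ring lra.

Set Implicit Arguments.
Unset Strict Implicit.
Unset Printing Implicit Defensive.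

(** * Tree-cycles in a network *)

Lemma mem_zip_consec (T : eqType) (s u v : T) (p : seq T) :
  (u, v) \in zip (s :: p) p <-> exists p1 p2, p = p1 ++ v :: p2 /\ u = last s p1.
Proof.
elim: p s => [|a p IH] s.
  by split=> // -[[|??] [p2 []]].
rewrite /= inE; split.
  case/orP => [/eqP[-> ->]|/IH [p1 [p2 [-> ->]]]].
    by exists [::], p.
  by exists (a :: p1), p2.
case=> -[|b p1] [p2 [/= [-> Ep Eu]]]; first by rewrite Eu eqxx.
by apply/orP; right; apply/IH; exists p1, p2.
Qed.

Section Network.
Variables (n K : nat) (N : netT n K).
Hypothesis netN : is_network N.
Notation e := (erel N).

Lemma erel_nverts u v : e u v -> (u \in nverts N) && (v \in nverts N).
Proof. by case/and5P: netN => /forallP /(_ u) /forallP /(_ v) /implyP. Qed.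

Lemma erel_acyclic u v : e u v -> ~~ connect e v u.
Proof. by case/and5P: netN => _ /forallP /(_ u) /forallP /(_ v) /implyP. Qed.

Lemma node_kinds v : v \in nverts N ->
  [|| is_root N v, is_leaf N v, is_tree N v | is_ret N v].
Proof. by case/and5P: netN => _ _ _ /forallP /(_ v) /implyP. Qed.

Lemma nlab_inj : injective (nlab N).
Proof. by case/and5P: netN => _ _ _ _ /andP[/injectiveP]. Qed.

Lemma leafP v : reflect (exists i, v = nlab N i) (is_leaf N v).
Proof.
case/and5P: netN => _ _ _ _ /andP[_ /eqP /setP /(_ v)].
rewrite inE => ->; apply: (iffP imsetP) => [[i _ ->]|[i ->]]; by exists i.
Qed.

Lemma network_root : exists2 r, is_root N r & forall v, is_root N v = (v == r).
Proof.
case/and5P: netN => _ _ /cards1P[r Er] _ _; exists r.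
  by move/setP/(_ r): Er; rewrite !inE eqxx.
by move=> v; move/setP/(_ v): Er; rewrite !inE.
Qed.

Lemma cycle_nil s p : path.path e s p -> last s p = s -> p = [::].
Proof.
case: p => [|a p] //= /andP[sa pa] la.
by have := erel_acyclic sa; rewrite -la => /negP[]; apply/connectP; exists p.
Qed.

Lemma dag_path_uniq s p : path.path e s p -> uniq (s :: p).
Proof.
elim: p s => [|a p IH] s //= /andP[sa pa].
rewrite -/(uniq (a :: p)) (IH _ pa) andbT.
apply/negP => sp; have := erel_acyclic sa => /negP[].
apply/connectP; case/splitPl: sp pa => p1 p2 lp1.
by rewrite cat_path => /andP[pa _]; exists p1.
Qed.

Lemma indeg1_parent z u u' : indeg N z = 1 -> e u z -> e u' z -> u = u'.
Proof.
move/eqP/cards1P => [a /setP Ea] uz uz'.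
by move: (Ea u) (Ea u'); rewrite !inE uz uz' => /esym/eqP-> /esym/eqP->.
Qed.

Lemma tree_indeg z : is_tree N z -> indeg N z = 1.
Proof. by case/and3P => _ /eqP. Qed.

Lemma tree_parent z u u' : is_tree N z -> e u z -> e u' z -> u = u'.
Proof. move=> /tree_indeg; exact: indeg1_parent. Qed.

Lemma ret_parents z u u' w : is_ret N z -> u != u' -> e u z -> e u' z -> e w z ->
  w = u \/ w = u'.
Proof.
case/and3P => _ /eqP i2 _ uu uz uz' wz.
have E : [set u; u'] = [set x | e x z].
  apply/eqP; rewrite eqEcard cards2 uu -/(indeg N z) i2 leqnn andbT.
  by apply/subsetP => x; rewrite !inE => /orP[/eqP->|/eqP->].
by move/setP/(_ w): E; rewrite !inE wz => /orP[/eqP->|/eqP->]; [left|right].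
Qed.

(* Tree-cycles are written with their reticulation [z] split off: [a] and [b]
   are the sequences of intermediate nodes of the two paths. *)
Lemma tree_cycle_split s p1 p2 : tree_cycle N s p1 p2 ->
  exists z a b, p1 = rcons a z /\ p2 = rcons b z.
Proof.
case=> _ /and4P[p1n p2n _ _] [ll _] _ _.
case/lastP: p1 p1n ll => // a z _; case/lastP: p2 p2n => // b z' _.
by rewrite !last_rcons => <-; exists z, a, b.
Qed.

Lemma tree_cycleP s a b z : tree_cycle N s (rcons a z) (rcons b z) ->
  [/\ is_root N s || is_tree N s,
      path.path e s a /\ path.path e s b,
      e (last s a) z /\ e (last s b) z,
      is_ret N z /\ (all (is_tree N) a /\ all (is_tree N) b) &
      forall u v, (u, v) \in zip (s :: rcons a z) (rcons a z) ->
                  (u, v) \in zip (s :: rcons b z) (rcons b z) -> False].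
Proof.
case=> hs /and4P[_ _]; rewrite !rcons_path => /andP[pa ea] /andP[pb eb].
rewrite !last_rcons !belast_rcons /= => -[_ rz] /andP[ta tb] /pred0P dis.
split=> // u v h1 h2; have := dis (u, v).
by rewrite /= !inE h1 h2.
Qed.

Lemma tree_cycle_sym s p1 p2 : tree_cycle N s p1 p2 -> tree_cycle N s p2 p1.
Proof.
case=> hs /and4P[h1 h2 h3 h4] [h5 h6] h7 h8; split=> //.
- by rewrite h1 h2 h3 h4.
- by rewrite -h5.
- by rewrite andbC.
- by rewrite disjoint_sym.
Qed.

Lemma tree_cycle_last_neq s a b z : tree_cycle N s (rcons a z) (rcons b z) ->
  last s a != last s b.
Proof.
move/tree_cycleP => [_ _ _ _ dis]; apply/eqP => E.
apply: (dis (last s a) z); apply/mem_zip_consec.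
  by exists a, [::]; rewrite cats1.
by exists b, [::]; rewrite cats1.
Qed.

Lemma tree_cycle_notin s a b z w : tree_cycle N s (rcons a z) (rcons b z) ->
  w \in a -> w \notin s :: b.
Proof.
move/tree_cycleP => [_ [pa pb] [ea eb] [_ [ta tb]] dis] wa.
have := dag_path_uniq pa => /= /andP[sa _].
rewrite inE; apply/norP; split; first by apply: contraNneq sa => <-.
apply/negP => wb.
have tw : is_tree N w by apply: (allP ta).
case/splitPr: wa pa ta dis {ea sa} => a1 a2; rewrite cat_path /= => /and3P[_ e1 _] _.
case/splitPr: wb pb tb {eb} => b1 b2; rewrite cat_path /= => /and3P[_ e2 _] _ dis.
have E := tree_parent tw e1 e2.
apply: (dis (last s a1) w); apply/mem_zip_consec; rewrite !rcons_cat.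
  by exists a1, (rcons a2 z).
by exists b1, (rcons b2 z).
Qed.

Lemma tree_chain s s' p q : path.path e s p -> path.path e s' q ->
  all (is_tree N) p -> all (is_tree N) q -> last s p = last s' q ->
  (exists2 r, p = r ++ q & last s r = s') \/
  (exists2 r, q = r ++ p & last s' r = s).
Proof.
elim/last_ind: p q => [|p x IH] q.
  by move=> _ _ _ _ /= ->; right; exists q; rewrite ?cats0.
case/lastP: q => [|q y].
  by move=> _ _ _ _ E; left; exists (rcons p x); rewrite ?cats0.
rewrite !rcons_path !all_rcons !last_rcons => /andP[pp ep] /andP[pq eq].
move=> /andP[tx tp] /andP[ty tq] exy; rewrite -exy in eq *.
case: (IH q pp pq tp tq (tree_parent tx ep eq)) => -[r -> <-]; [left|right];
  by exists r; rewrite // rcons_cat.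
Qed.

Lemma tree_cycle_eq s a b s' c d z :
  tree_cycle N s (rcons a z) (rcons b z) ->
  tree_cycle N s' (rcons c z) (rcons d z) ->
  s = s' /\ ((a = c /\ b = d) \/ (a = d /\ b = c)).
Proof.
move=> tc tc'.
wlog l1 : c d tc' / last s a = last s' c => [hw|].
  have [_ _ [ea eb] [rz _] _] := tree_cycleP tc.
  have [_ _ [ec ed] _ _] := tree_cycleP tc'.
  have neq := tree_cycle_last_neq tc'.
  case: (ret_parents rz neq ec ed ea) => l1; first exact: hw.
  have [-> [[]|[]] -> ->] := hw _ _ (tree_cycle_sym tc') l1; split=> //; [right|left]; by split.
have [_ [pa pb] [ea eb] [rz [ta tb]] dis] := tree_cycleP tc.
have [_ [pc pd] [ec ed] [_ [tc_ td]] dis'] := tree_cycleP tc'.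
have neq := tree_cycle_last_neq tc.
have neq' := tree_cycle_last_neq tc'.
have l2 : last s b = last s' d.
  case: (ret_parents rz neq ea eb ed) => // l2.
  by move: neq'; rewrite -l1 l2 eqxx.
suff [-> [-> ->]] : s = s' /\ (a = c /\ b = d) by split=> //; left.
have both t r1 r2 x y : path.path e t (r1 ++ x) -> path.path e t (r2 ++ y) ->
    all (is_tree N) (r1 ++ x) -> last t r1 = last t r2 ->
    (forall u v, (u, v) \in zip (t :: rcons (r1 ++ x) z) (rcons (r1 ++ x) z) ->
       (u, v) \in zip (t :: rcons (r2 ++ y) z) (rcons (r2 ++ y) z) -> False) ->
    r1 = [::] /\ r2 = [::].
  rewrite !cat_path => /andP[h1 _] /andP[h2 _].
  case/lastP: r1 h1 => [|r1 v] h1.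
    by move=> _ /= E _; rewrite (cycle_nil h2).
  case/lastP: r2 h2 => [|r2 v'] h2.
    by move=> _ /= E _; have := cycle_nil h1 E; case: (r1).
  rewrite !last_rcons all_cat all_rcons => /andP[/andP[tv _] _] E dis0; rewrite -E in h2 dis0.
  move: h1 h2; rewrite !rcons_path => /andP[_ e1] /andP[_ e2].
  exfalso; apply: (dis0 (last t r1) v); apply/mem_zip_consec.
    by exists r1, (rcons x z); rewrite rcons_cat cat_rcons.
  by exists r2, (rcons y z); rewrite rcons_cat cat_rcons; split=> //; apply: tree_parent e2.
case: (tree_chain pa pc ta tc_ l1) => -[r1 E1 L1];
  case: (tree_chain pb pd tb td l2) => -[r2 E2 L2].
- subst a b; have [R1 R2] := both _ _ _ _ _ pa pb ta (etrans L1 (esym L2)) dis.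
  by subst; split.
- subst a d; have h : path.path e s (r1 ++ r2).
    by move: pa pd; rewrite !cat_path => /andP[-> _] /andP[]; rewrite L1 => ->.
  have := cycle_nil h; rewrite last_cat L1 => /(_ L2).
  case: (r1) L1 => //=; case: (r2) L2 => //= *; subst; by split.
- subst c b; have h : path.path e s' (r1 ++ r2).
    by move: pc pb; rewrite !cat_path => /andP[-> _] /andP[]; rewrite L1 => ->.
  have := cycle_nil h; rewrite last_cat L1 => /(_ L2).
  case: (r1) L1 => //=; case: (r2) L2 => //= *; subst; by split.
- subst c d; have [R1 R2] := both _ _ _ _ _ pc pd tc_ (etrans L1 (esym L2)) dis'.
  by subst; split.
Qed.

End Network.

(** * Terms and decompositions *)

Ltac bool_lia :=
  repeat match goal with
  |- context [nat_of_bool ?b] => move: (nat_of_bool b) => ? end; lia.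

(* [Gl v c y x p q] is a gall with top [v], reticulation [c] and sides [p], [q];
   the child of [c] is the leaf [y] labelled [x].  [Pc v t p] is a side starting
   at the node [v], from which the network [t] hangs. *)
Inductive tm (V L : Type) : Type :=
  | Lf (v : V) (x : L)
  | Nd (v : V) (l r : tm V L)
  | Gl (v c y : V) (x : L) (p q : pt V L)
with pt (V L : Type) : Type :=
  | Pn
  | Pc (v : V) (t : tm V L) (p : pt V L).
Arguments Pn {V L}.

Scheme tm_mind := Induction for tm Sort Prop
with pt_mind := Induction for pt Sort Prop.
Combined Scheme tm_pt_ind from tm_mind, pt_mind.

Section TermFunctions.
Variables V L : Type.

Definition rt (T : tm V L) : V :=
  match T with Lf v _ => v | Nd v _ _ => v | Gl v _ _ _ _ _ => v end.

Definition hd (c : V) (p : pt V L) : V := if p is Pc v _ _ then v else c.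

Definition is_Pn (p : pt V L) : bool := if p is Pn then true else false.

Fixpoint verts (T : tm V L) : seq V :=
  match T with
  | Lf v _ => [:: v]
  | Nd v l r => v :: verts l ++ verts r
  | Gl v c y _ p q => v :: pverts p ++ pverts q ++ [:: c; y]
  end
with pverts (p : pt V L) : seq V :=
  if p is Pc v t p' then v :: verts t ++ pverts p' else [::].

Fixpoint rets (T : tm V L) : seq V :=
  match T with
  | Lf _ _ => [::]
  | Nd _ l r => rets l ++ rets r
  | Gl _ c _ _ p q => c :: prets p ++ prets q
  end
with prets (p : pt V L) : seq V :=
  if p is Pc _ t p' then rets t ++ prets p' else [::].

(* The heads of all edges: every non-root node once, reticulations twice. *)
Fixpoint heads (T : tm V L) : seq V :=
  match T with
  | Lf _ _ => [::]
  | Nd _ l r => rt l :: rt r :: heads l ++ heads r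
  | Gl _ c y _ p q => hd c p :: hd c q :: y :: pheads c p ++ pheads c q
  end
with pheads (c : V) (p : pt V L) : seq V :=
  if p is Pc _ t p' then rt t :: hd c p' :: heads t ++ pheads c p' else [::].

Fixpoint labels (T : tm V L) : seq L :=
  match T with
  | Lf _ x => [:: x]
  | Nd _ l r => labels l ++ labels r
  | Gl _ _ _ x p q => x :: plabels p ++ plabels q
  end
with plabels (p : pt V L) : seq L :=
  if p is Pc _ t p' then labels t ++ plabels p' else [::].

Fixpoint wf (T : tm V L) : bool :=
  match T with
  | Lf _ _ => true
  | Nd _ l r => wf l && wf r
  | Gl _ _ _ _ p q => [&& ~~ (is_Pn p && is_Pn q), pwf p & pwf q]
  end
with pwf (p : pt V L) : bool :=
  if p is Pc _ t p' then wf t && pwf p' else true.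

Lemma count_heads (a : pred V) :
  (forall T, a (rt T) + count a (heads T) = count a (verts T) + count a (rets T)) /\
  (forall p c, a (hd c p) + count a (pheads c p)
               = count a (pverts p) + count a (prets p) + a c).
Proof.
apply: tm_pt_ind => /=.
- by move=> v x; lia.
- by move=> v l IHl r IHr; rewrite !count_cat; lia.
- move=> v c y x p IHp q IHq; rewrite !count_cat /=.
  by have := IHp c; have := IHq c; lia.
- by move=> c; lia.
- by move=> v t IHt p IHp c; rewrite !count_cat; have := IHp c; lia.
Qed.

End TermFunctions.

Section TermMap.
Variables (V V' L L' : Type) (f : V -> V') (g : L -> L').

Fixpoint tmap (T : tm V L) : tm V' L' :=
  match T with
  | Lf v x => Lf (f v) (g x)
  | Nd v l r => Nd (f v) (tmap l) (tmap r)
  | Gl v c y x p q => Gl (f v) (f c) (f y) (g x) (ptmap p) (ptmap q)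
  end
with ptmap (p : pt V L) : pt V' L' :=
  if p is Pc v t p' then Pc (f v) (tmap t) (ptmap p') else Pn.

Lemma rt_tmap T : rt (tmap T) = f (rt T). Proof. by case: T. Qed.
Lemma hd_ptmap c p : hd (f c) (ptmap p) = f (hd c p). Proof. by case: p. Qed.
Lemma is_Pn_ptmap p : is_Pn (ptmap p) = is_Pn p. Proof. by case: p. Qed.

Lemma labels_tmap :
  (forall T, labels (tmap T) = map g (labels T)) /\
  (forall p, plabels (ptmap p) = map g (plabels p)).
Proof.
apply: tm_pt_ind => //= [v l -> r -> | v c y x p -> q -> | v t -> p ->];
  by rewrite map_cat.
Qed.

Lemma verts_tmap :
  (forall T, verts (tmap T) = map f (verts T)) /\
  (forall p, pverts (ptmap p) = map f (pverts p)).
Proof.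
by apply: tm_pt_ind => //= [v l -> r -> | v c y x p -> q -> | v t -> p ->];
  rewrite !map_cat.
Qed.

Lemma wf_tmap :
  (forall T, wf (tmap T) = wf T) /\ (forall p, pwf (ptmap p) = pwf p).
Proof.
by apply: tm_pt_ind => //= [v l -> r -> | v c y x p -> q -> | v t -> p ->];
  rewrite ?is_Pn_ptmap.
Qed.

End TermMap.

Lemma sum_mem_mul (T : finType) (P : pred T) (v : T) :
  \sum_u P u * (v == u) = P v.
Proof.
rewrite (bigD1 v) //= eqxx muln1 big1 ?addn0 // => u; rewrite eq_sym => /negPf->.
by rewrite muln0.
Qed.

Section Decomposition.
Variables (n K : nat) (N : netT n K).
Notation e := (erel N).
Notation V := 'I_K.
Notation tmN := (tm V 'I_n).
Notation ptN := (pt V 'I_n).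

Definition out (v : V) : {set V} := [set w | e v w].

(* [decomp T]: the part of N below [rt T] is the network described by [T]. *)
Fixpoint decomp (T : tmN) : bool :=
  match T with
  | Lf v x => (out v == set0) && (nlab N x == v)
  | Nd v l r => [&& rt l != rt r, out v == [set rt l; rt r], decomp l & decomp r]
  | Gl v c y x p q =>
      [&& hd c p != hd c q, out v == [set hd c p; hd c q], out c == [set y],
          (out y == set0) && (nlab N x == y), pdecomp c p & pdecomp c q]
  end
with pdecomp (c : V) (p : ptN) : bool :=
  if p is Pc v t p' then
    [&& rt t != hd c p', out v == [set rt t; hd c p'], decomp t & pdecomp c p']
  else true.

Definition arcs_into (s : seq V) (z : V) : nat := \sum_u e u z * count_mem u s.

Lemma arcs_into_nil z : arcs_into [::] z = 0.
Proof. by rewrite /arcs_into big1 // => u _; rewrite muln0. Qed.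

Lemma arcs_into_cat s1 s2 z :
  arcs_into (s1 ++ s2) z = arcs_into s1 z + arcs_into s2 z.
Proof. by rewrite -big_split; apply: eq_bigr => u _; rewrite /= count_cat mulnDr. Qed.

Lemma arcs_into_cons v s z : arcs_into (v :: s) z = e v z + arcs_into s z.
Proof.
rewrite -cat1s arcs_into_cat; congr (_ + _).
rewrite -(sum_mem_mul (fun u => e u z) v).
by apply: eq_bigr => u _; rewrite /= addn0.
Qed.

Lemma out0P v z : out v == set0 -> e v z = false.
Proof. by move/eqP/setP/(_ z); rewrite !inE. Qed.

Lemma out1P v a z : out v == [set a] -> e v z = (a == z).
Proof. by move/eqP/setP/(_ z); rewrite !inE eq_sym. Qed.

Lemma out2P v a b z : a != b -> out v == [set a; b] ->
  (e v z : nat) = (a == z) + (b == z).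
Proof.
move=> ab /eqP/setP/(_ z); rewrite !inE => ->; rewrite ![_ == z]eq_sym.
by case: eqVneq => [->|//]; rewrite (negPf ab).
Qed.

Lemma out2_mem v a b z : out v == [set a; b] -> e v z -> z = a \/ z = b.
Proof. by move/eqP/setP/(_ z); rewrite !inE => -> /orP[/eqP|/eqP]; [left|right]. Qed.

Lemma count_heads_arcs z :
  (forall T, decomp T -> count_mem z (heads T) = arcs_into (verts T) z) /\
  (forall p c, pdecomp c p -> count_mem z (pheads c p) = arcs_into (pverts p) z).
Proof.
apply: tm_pt_ind => /=.
- by move=> v x /andP[/(out0P z) vz _]; rewrite arcs_into_cons arcs_into_nil vz.
- move=> v l IHl r IHr /and4P[lr /(out2P z lr) vz /IHl El /IHr Er].
  by rewrite arcs_into_cons arcs_into_cat vz !count_cat El Er addnA.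
- move=> v c y x p IHp q IHq.
  case/and5P => pq /(out2P z pq) vz /(out1P z) cz /andP[/(out0P z) yz _].
  move=> /andP[/IHp Ep /IHq Eq].
  rewrite arcs_into_cons !arcs_into_cat !arcs_into_cons arcs_into_nil vz cz yz.
  by rewrite !count_cat Ep Eq /=; bool_lia.
- by move=> c; rewrite arcs_into_nil.
- move=> v t IHt p IHp c /and4P[tp /(out2P z tp) vz /IHt Et /IHp Ep].
  by rewrite arcs_into_cons arcs_into_cat vz !count_cat Et Ep addnA.
Qed.

Lemma outdeg0 v : out v == set0 -> outdeg N v = 0.
Proof. by move/eqP => E; rewrite /outdeg -/(out v) E cards0. Qed.
Lemma outdeg1 v a : out v == [set a] -> outdeg N v = 1.
Proof. by move/eqP => E; rewrite /outdeg -/(out v) E cards1. Qed.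
Lemma outdeg2 v a b : a != b -> out v == [set a; b] -> outdeg N v = 2.
Proof. by move=> ab /eqP E; rewrite /outdeg -/(out v) E cards2 ab. Qed.

Lemma count_rets z :
  (forall T, decomp T ->
     count_mem z (rets T) = (outdeg N z == 1) * count_mem z (verts T)) /\
  (forall p c, pdecomp c p ->
     count_mem z (prets p) = (outdeg N z == 1) * count_mem z (pverts p)).
Proof.
have H v d : outdeg N v = d -> d != 1 -> (outdeg N z == 1) * (v == z) = 0.
  by move=> <- dv; case: (eqVneq v z) => [<-|]; rewrite ?(negPf dv) ?muln0.
apply: tm_pt_ind => /=.
- by move=> v x /andP[/outdeg0/H Hv _]; rewrite addn0 Hv.
- move=> v l IHl r IHr /and4P[lr /(outdeg2 lr)/H Hv /IHl El /IHr Er].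
  by rewrite !count_cat !mulnDr Hv // El Er.
- move=> v c y x p IHp q IHq.
  case/and5P => pq /(outdeg2 pq)/H Hv /outdeg1 Hc /andP[/outdeg0/H Hy _].
  move=> /andP[/IHp Ep /IHq Eq].
  rewrite !count_cat /= !mulnDr Hv // Hy // Ep Eq.
  have -> : (outdeg N z == 1) * (c == z) = (c == z).
    by case: (eqVneq c z) => [<-|]; rewrite ?Hc ?muln0.
  by bool_lia.
- by move=> c; rewrite muln0.
- move=> v t IHt p IHp c /and4P[tp /(outdeg2 tp)/H Hv /IHt Et /IHp Ep].
  by rewrite !count_cat !mulnDr Hv // Et Ep.
Qed.

Lemma count_verts_balance T z : decomp T ->
  (rt T == z) + arcs_into (verts T) z
  = count_mem z (verts T) + (outdeg N z == 1) * count_mem z (verts T).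
Proof.
move=> dT; rewrite -(proj1 (count_heads_arcs z) _ dT) -(proj1 (count_rets z) _ dT).
by have [/(_ T) /= -> _] := count_heads 'I_n (pred1 z).
Qed.

(* Descending from the root, the balance of in-arcs forces every node to be
   visited exactly once by the decomposition. *)
Lemma count_verts_network T : is_network N -> decomp T -> is_root N (rt T) ->
  forall z, count_mem z (verts T) = (z \in nverts N).
Proof.
move=> netN dT rT z.
have [m] := ubnP #|[set u | connect e u z]|.
elim: m z => // m IH z; rewrite ltnS => le_m.
have IHu u : e u z -> count_mem u (verts T) = 1.
  move=> uz; rewrite IH ?(andP (erel_nverts netN uz)).1 //.
  apply: leq_trans le_m; apply: proper_card; apply/properP; split.
    apply/subsetP => x; rewrite !inE => xu; apply: connect_trans xu _.
    exact: connect1.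
  by exists z; rewrite inE ?connect0 // (erel_acyclic netN uz).
have Ez : arcs_into (verts T) z = indeg N z.
  rewrite /indeg -sum1dep_card big_mkcond /arcs_into; apply: eq_bigr => u _.
  by case: ifP => // uz; rewrite IHu.
have := count_verts_balance z dT; rewrite Ez.
have [r rr Er] := network_root netN.
have -> : (rt T == z) = is_root N z by move: rT; rewrite !Er => /eqP->; rewrite eq_sym.
case: (boolP (z \in nverts N)) => zN; last first.
  have -> : indeg N z = 0.
    apply/eqP; rewrite cards_eq0; apply/eqP/setP => u; rewrite !inE.
    by apply: contraNF zN => /(erel_nverts netN)/andP[].
  have -> : outdeg N z = 0.
    apply/eqP; rewrite cards_eq0; apply/eqP/setP => u; rewrite !inE.
    by apply: contraNF zN => /(erel_nverts netN)/andP[].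
  by rewrite /is_root (negPf zN); lia.
have := node_kinds netN zN; rewrite /is_root /is_leaf /is_tree /is_ret zN /=.
by do 4?case/orP; case/andP => /eqP -> /eqP -> /=; lia.
Qed.

End Decomposition.

(** * Existence of a decomposition *)

Lemma uniq_cat_cons_inj (T : eqType) (w : T) p1 q1 p2 q2 :
  uniq (p1 ++ w :: q1) -> p1 ++ w :: q1 = p2 ++ w :: q2 -> q1 = q2.
Proof.
move=> U E; move: (U); rewrite {1}E.
move: U; rewrite !cat_uniq /= !negb_or => /and3P[_ /andP[w1 _] _] /and3P[_ /andP[w2 _] _].
have := congr1 (fun s => drop (index w s).+1 s) E.
by rewrite !index_cat (negPf w1) (negPf w2) /= eqxx !addn0 -!cat_rcons
  -(size_rcons p1 w) -(size_rcons p2 w) !drop_size_cat.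
Qed.

Lemma consec_mem (T : eqType) (s z u v : T) a :
  (u, v) \in zip (s :: rcons a z) (rcons a z) -> u \in s :: a.
Proof.
case/mem_zip_consec => p1 [p2 [E ->]].
have : last s p1 \in s :: p1 by apply: mem_last.
case/lastP: p2 E => [|p2 y].
  by rewrite cats1 => /rcons_inj[-> _].
rewrite -rcons_cons -rcons_cat => /rcons_inj[-> _]; rewrite !inE mem_cat.
by case/orP => ->; rewrite ?orbT.
Qed.

Section Existence.
Variables (n K : nat) (N : netT n K).
Hypothesis sgtN : simplex_galled_tree N.
Notation e := (erel N).
Notation V := 'I_K.
Let netN : is_network N. Proof. by case: sgtN => -[]. Qed.

Definition interior v := exists s a b z,
  tree_cycle N s (rcons a z) (rcons b z) /\ v \in a.

Lemma gall_arc u v : e u v -> is_ret N v \/ interior v ->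
  exists s a b z, tree_cycle N s (rcons a z) (rcons b z) /\
    (u, v) \in zip (s :: rcons a z) (rcons a z).
Proof.
move=> uv [rv|[s [a [b [z [tc va]]]]]].
  case: sgtN => -[_ [/(_ v rv) [s [p1 [p2 [tc lv]]]] _]] _.
  have [z [a [b [E1 E2]]]] := tree_cycle_split tc; subst p1 p2.
  move: lv; rewrite last_rcons => E; subst z.
  have [_ _ [ea eb] _ _] := tree_cycleP tc.
  have [Eu|Eu] := ret_parents rv (tree_cycle_last_neq tc) ea eb uv.
    exists s, a, b, v; split=> //; apply/mem_zip_consec.
    by exists a, [::]; rewrite cats1.
  exists s, b, a, v; split; first exact: tree_cycle_sym.
  by apply/mem_zip_consec; exists b, [::]; rewrite cats1.
exists s, a, b, z; split=> //; apply/mem_zip_consec.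
have [_ [pa _] _ [_ [ta _]] _] := tree_cycleP tc.
have tv := allP ta _ va.
case/splitPr: va pa {tc ta} => a1 a2; rewrite cat_path /= => /and3P[_ e1 _].
by exists a1, (rcons a2 z); rewrite rcons_cat; split=> //; apply: (tree_parent tv uv e1).
Qed.

Lemma galls_eq s a b z s' a' b' z' x :
  tree_cycle N s (rcons a z) (rcons b z) ->
  tree_cycle N s' (rcons a' z') (rcons b' z') ->
  x \in s :: a -> x \in s' :: a' ->
  s = s' /\ (rcons a z = rcons a' z' \/ rcons b z = rcons a' z').
Proof.
move=> tc tc' xa xa'; case: sgtN => -[_ [_ H]] _.
case: (H _ _ _ _ _ _ tc tc') => [[-> [[]|[]] -> ->]|/pred0P /(_ x)]; [by split=> //; left| by split=> //; right|].
move: xa xa'; rewrite /= !inE !mem_cat !mem_rcons !inE.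
by case/orP => [->|->]; case/orP => [->|->]; rewrite ?orbT.
Qed.

Lemma hanging_child s a1 w a2 b z c :
  tree_cycle N s (rcons (a1 ++ w :: a2) z) (rcons b z) ->
  e w c -> c != head z a2 -> ~ (is_ret N c \/ interior c).
Proof.
move=> tc wc cn H.
have [s' [a' [b' [z' [tc' wc']]]]] := gall_arc wc H.
have wa : w \in s :: a1 ++ w :: a2 by rewrite !inE mem_cat inE eqxx !orbT.
have [Es [Ea|Eb]] := galls_eq tc tc' wa (consec_mem wc').
  subst s'; rewrite -Ea in wc'.
  have [_ [pa _] [ea _] _ _] := tree_cycleP tc.
  have U : uniq (s :: rcons (a1 ++ w :: a2) z).
    by apply: (dag_path_uniq netN); rewrite rcons_path pa.
  case/mem_zip_consec: wc' => p1 [p2 [E Ew]].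
  case/lastP: p1 E Ew => [|p1 w'] E Ew.
    by move: Ew U => /= Ew; rewrite -Ew mem_rcons inE mem_cat inE eqxx !orbT.
  move: Ew; rewrite last_rcons => Ew; subst w'.
  move: U E; rewrite /= => /andP[_]; rewrite rcons_cat cat_rcons rcons_cons => U E.
  have := uniq_cat_cons_inj U E => E2.
  by case: (a2) E2 cn => [|? ?] /= [-> _]; rewrite eqxx.
subst s'; rewrite -Eb in wc'.
have := consec_mem wc'; apply/negP; apply: (tree_cycle_notin netN tc).
by rewrite mem_cat inE eqxx orbT.
Qed.

Lemma out2_split w a : outdeg N w = 2 -> e w a ->
  exists2 c, c != a & out N w = [set c; a].
Proof.
move=> /eqP/cards2P[x [y [xy E]]] wa.
have : a \in [set x; y] by rewrite -E inE.
rewrite !inE => /orP[/eqP->|/eqP->].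
  by exists y; rewrite 1?eq_sym // /out E setUC.
by exists x.
Qed.

Lemma decomp_exists v : v \in nverts N -> ~ (is_ret N v \/ interior v) ->
  exists2 T, decomp N T & rt T = v.
Proof.
have [m] := ubnP #|[set w | connect e v w]|.
elim: m v => // m IH v; rewrite ltnS => le_m vN nv.
have IHw u w : connect e v u -> e u w -> ~ (is_ret N w \/ interior w) ->
    exists2 T, decomp N T & rt T = w.
  move=> vu uw; apply: IH; last exact: (andP (erel_nverts netN uw)).2.
  apply: leq_trans le_m; apply: proper_card; apply/properP; split.
    apply/subsetP => x; rewrite !inE => wx; apply: connect_trans wx.
    by apply: connect_trans vu _; exact: connect1.
  exists u; rewrite inE //.
  by rewrite (erel_acyclic netN uw).
have [/leafP-/(_ netN) [i Ei]|nl] := boolP (is_leaf N v).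
  exists (Lf v i) => //=; rewrite -Ei eqxx andbT -cards_eq0.
  have /(leafP netN) : exists i, v = nlab N i by exists i.
  by case/and3P => _ _; rewrite /outdeg -/(out N v).
have o2 : outdeg N v = 2.
  have := node_kinds netN vN; rewrite (negPf nl) /=.
  by case/or3P => [/and3P[_ _ /eqP]|/and3P[_ _ /eqP]|rv] //; case: nv; left.
have [[p1 [p2 tc]]|ntop] := boolp.pselect (exists p1 p2, tree_cycle N v p1 p2).
  have [z [a [b [E1 E2]]]] := tree_cycle_split tc; subst p1 p2.
  have spine a1 a2 b' : tree_cycle N v (rcons (a1 ++ a2) z) (rcons b' z) ->
      exists2 p, pdecomp N z p & hd z p = head z a2.
    elim: a2 a1 => [|w a2 IHa] a1 tc'; first by exists Pn.
    have [p dp hp] : exists2 p, pdecomp N z p & hd z p = head z a2.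
      by apply: (IHa (rcons a1 w)); rewrite cat_rcons.
    have [_ [pa _] [ea _] [_ [ta _]] _] := tree_cycleP tc'.
    have tw : is_tree N w by apply: (allP ta); rewrite mem_cat inE eqxx orbT.
    have ew : e w (head z a2).
      have : path.path e v (rcons (a1 ++ w :: a2) z) by rewrite rcons_path pa.
      by rewrite rcons_cat cat_path /= => /and3P[_ _]; case: (a2) => /= [|? ?] /andP[].
    have [|c cn Ec] := out2_split _ ew; first by case/and3P: tw => _ _ /eqP.
    have wc : e w c by move/setP/(_ c): Ec; rewrite !inE eqxx.
    have [|T dT rT] := IHw w c _ wc (hanging_child tc' wc cn).
      apply/connectP; exists (rcons a1 w); last by rewrite last_rcons.
      by move: pa; rewrite -cat_rcons cat_path => /andP[].
    by exists (Pc w T p) => //=; rewrite rT hp cn Ec eqxx dT dp.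
  have [p dp hp] := spine [::] a b tc.
  have [q dq hq] := spine [::] b a (tree_cycle_sym tc).
  have [_ [pa pb] [ea eb] [rz [ta tb]] dis] := tree_cycleP tc.
  have hh x y : path.path e v x -> e (last v x) y -> (v, head y x) \in zip (v :: rcons x y) (rcons x y).
    by case: x => [|? ?] /= *; rewrite inE eqxx.
  have ne : head z a != head z b.
    by apply/eqP => E; apply: (dis v (head z a)); [|rewrite E]; apply: hh.
  have ed x y : path.path e v x -> e (last v x) y -> e v (head y x).
    by case: x => [|? ?] /= => [|/andP[]].
  case/and3P: (rz) => zN _ /cards1P[y Ey].
  have zy : e z y by move/setP/(_ y): Ey; rewrite !inE eqxx.
  have /(leafP netN) [i Ei] : is_leaf N y by case: sgtN => _ /(_ _ _ rz zy).
  have /and3P[_ _ oy] : is_leaf N y by apply/(leafP netN); exists i.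
  exists (Gl v z y i p q) => //=; rewrite hp hq ne /out Ey eqxx -Ei eqxx dp dq.
  rewrite -cards_eq0 oy !andbT /=.
  rewrite eq_sym eqEcard cards2 ne -/(out N v).
  move: o2; rewrite /outdeg -/(out N v) => ->; rewrite andbT.
  by apply/subsetP => x; rewrite !inE => /orP[/eqP->|/eqP->]; apply: ed.
move/eqP/cards2P: (o2) => [a [b [ab E]]].
have ok x : e v x -> ~ (is_ret N x \/ interior x).
  move=> vx H; have [s [c [d [z [tc /consec_mem]]]]] := gall_arc vx H.
  rewrite inE => /orP[/eqP Es|vc].
    by apply: ntop; exists (rcons c z), (rcons d z); rewrite Es.
  by apply: nv; right; exists s, c, d, z.
have va : e v a by move/setP/(_ a): E; rewrite !inE eqxx.
have vb : e v b by move/setP/(_ b): E; rewrite !inE eqxx orbT.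
have [Ta da ra] := IHw v a (connect0 _ _) va (ok _ va).
have [Tb db rb] := IHw v b (connect0 _ _) vb (ok _ vb).
by exists (Nd v Ta Tb) => //=; rewrite ra rb ab /out E eqxx da db.
Qed.

Lemma root_decomp_exists : exists2 T, decomp N T & is_root N (rt T).
Proof.
have [r rr Er] := network_root netN.
have /and3P[rN /eqP i0 _] := rr.
have [|T dT rT] := decomp_exists rN; last by exists T; rewrite ?rT.
case=> [/and3P[_]|[s [a [b [z [tc ra]]]]]]; first by rewrite i0.
have [_ _ _ [_ [ta _]] _] := tree_cycleP tc.
by have := tree_indeg (allP ta _ ra); rewrite i0.
Qed.

End Existence.

(** * Uniqueness of the decomposition, heights *)

HB.instance Definition _ (V L : Type) := boolp.gen_eqMixin (tm V L).
HB.instance Definition _ (V L : Type) := boolp.gen_eqMixin (pt V L).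

Section Orbits.
Variables V L : Type.

(* All terms obtained from [T] by exchanging the two sides of some of its
   binary nodes and galls. *)
Fixpoint orb (T : tm V L) : seq (tm V L) :=
  match T with
  | Lf v x => [:: Lf v x]
  | Nd v l r => [seq Nd v a b | a <- orb l, b <- orb r] ++
                [seq Nd v b a | a <- orb l, b <- orb r]
  | Gl v c y x p q => [seq Gl v c y x a b | a <- porb p, b <- porb q] ++
                      [seq Gl v c y x b a | a <- porb p, b <- porb q]
  end
with porb (p : pt V L) : seq (pt V L) :=
  if p is Pc v t p' then [seq Pc v a b | a <- orb t, b <- porb p'] else [:: Pn].

Definition lift_height (h : L * (nat * nat)) := (h.1, (h.2.1.+1, h.2.2.+1)).

Fixpoint plen (p : pt V L) : nat := if p is Pc _ _ p' then (plen p').+1 else 0.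

(* Pairs (greatest, least) distance from the root, by leaf label. *)
Fixpoint heights (T : tm V L) : seq (L * (nat * nat)) :=
  match T with
  | Lf _ x => [:: (x, (0, 0))]
  | Nd _ l r => map lift_height (heights l ++ heights r)
  | Gl _ _ _ x p q =>
      (x, ((maxn (plen p) (plen q)).+2, (minn (plen p) (plen q)).+2))
        :: map lift_height (pheights p ++ pheights q)
  end
with pheights (p : pt V L) : seq (L * (nat * nat)) :=
  if p is Pc _ t p' then map lift_height (heights t ++ pheights p') else [::].

Lemma labels_heights :
  (forall T, map fst (heights T) = labels T) /\
  (forall p, map fst (pheights p) = plabels p).
Proof.
apply: tm_pt_ind => //= [v l IHl r IHr|v c y x p IHp q IHq|v t IHt p IHp].
- by rewrite -map_comp -IHl -IHr -map_cat; apply: eq_map.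
- by rewrite -map_comp -IHp -IHq -map_cat; congr (_ :: _); apply: eq_map.
- by rewrite -map_comp -IHt -IHp -map_cat; apply: eq_map.
Qed.

Lemma plen_size p : plen p <= size (pverts p).
Proof.
case: p => // v t p; elim: p v t => [|v' t' p IHp] v t /=; rewrite ?size_cat //.
by rewrite ltnS (leq_trans (IHp v' t')) //= size_cat; lia.
Qed.

End Orbits.

Lemma heights_size (V : Type) (L : eqType) :
  (forall (T : tm V L) h, h \in heights T -> h.2.1 < size (verts T)) /\
  (forall (p : pt V L) h, h \in pheights p -> h.2.1 < size (pverts p)).
Proof.
apply: tm_pt_ind => //=.
- by move=> v x h; rewrite inE => /eqP ->.
- move=> v l IHl r IHr h /mapP[h']; rewrite mem_cat => H -> /=; rewrite ltnS size_cat.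
  by case/orP: H => [/IHl|/IHr]; lia.
- move=> v c y x p IHp q IHq h; rewrite inE => /orP[/eqP -> /=|].
    by rewrite !size_cat /=; have := plen_size p; have := plen_size q; lia.
  case/mapP => h'; rewrite mem_cat => H -> /=; rewrite ltnS !size_cat.
  by case/orP: H => [/IHp|/IHq]; lia.
- move=> v t IHt p IHp h /mapP[h']; rewrite mem_cat => H -> /=; rewrite ltnS size_cat.
  by case/orP: H => [/IHt|/IHp]; lia.
Qed.

Section DecompTheory.
Variables (n K : nat) (N : netT n K).
Notation e := (erel N).
Notation V := 'I_K.
Notation tmN := (tm V 'I_n).
Notation ptN := (pt V 'I_n).

Lemma rt_verts (T : tmN) : rt T \in verts T.
Proof. by case: T => * /=; rewrite inE eqxx. Qed.

Lemma hd_pverts c (p : ptN) : hd c p \in c :: pverts p.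
Proof. by case: p => * /=; rewrite !inE eqxx ?orbT. Qed.

Definition stable (S : seq V) := forall u w, u \in S -> e u w -> w \in S.

Lemma stable_cons (S : seq V) v a b : stable S -> out N v == [set a; b] ->
  a \in S -> b \in S -> stable (v :: S).
Proof.
move=> st ov aS bS u w; rewrite !inE => /orP[/eqP->|uS uw].
  by case/(out2_mem ov) => ->; rewrite ?aS ?bS orbT.
by rewrite (st _ _ uS uw) orbT.
Qed.

Lemma stable_cat S1 S2 : stable S1 -> stable S2 -> stable (S1 ++ S2).
Proof.
move=> s1 s2 u w; rewrite !mem_cat => /orP[/s1 h /h ->//|/s2 h /h ->].
by rewrite orbT.
Qed.

Lemma eq_stable S1 S2 : S1 =i S2 -> stable S1 -> stable S2.
Proof. by move=> E st u w; rewrite -!E; apply: st. Qed.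

Lemma decomp_stable :
  (forall T, decomp N T -> stable (verts T)) /\
  (forall p c y, out N c == [set y] -> out N y == set0 -> pdecomp N c p ->
     stable (pverts p ++ [:: c; y])).
Proof.
have cy c y : out N c == [set y] -> out N y == set0 -> stable [:: c; y].
  move=> /eqP oc oy u w; rewrite !inE => /orP[/eqP->|/eqP->].
    by move/setP/(_ w): oc; rewrite !inE => -> ->; rewrite orbT.
  by rewrite (out0P _ oy).
apply: tm_pt_ind => /=.
- by move=> v x /andP[ov _] u w; rewrite !inE => /eqP->; rewrite (out0P _ ov).
- move=> v l IHl r IHr /and4P[_ ov /IHl sl /IHr sr].
  apply: (stable_cons _ ov); first exact: stable_cat.
    by rewrite mem_cat rt_verts.
  by rewrite mem_cat rt_verts orbT.
- move=> v c y x p IHp q IHq /and5P[_ ov oc /andP[oy _]] /andP[dp dq].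
  apply: (stable_cons _ ov).
  + apply: eq_stable (stable_cat (IHp _ _ oc oy dp) (IHq _ _ oc oy dq)) => z.
    by rewrite !mem_cat; case: (z \in pverts p) (z \in pverts q) (z \in [:: c; y]) => [] [] [].
  + by have := hd_pverts c p; rewrite !mem_cat !inE => /orP[]->; rewrite ?orbT.
  + by have := hd_pverts c q; rewrite !mem_cat !inE => /orP[]->; rewrite ?orbT.
- by move=> c y oc oy _; apply: cy.
- move=> v t IHt p IHp c y oc oy /and4P[_ ov /IHt st /(IHp _ _ oc oy) sp].
  rewrite -catA; apply: (stable_cons _ ov); first exact: stable_cat.
    by rewrite mem_cat rt_verts.
  by have := hd_pverts c p; rewrite !mem_cat !inE => /orP[]->; rewrite ?orbT.
Qed.

Lemma pdecomp_end S c p : pdecomp N c p -> stable S -> hd c p \in S -> c \in S.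
Proof.
move=> dp st; elim: p dp => [|v t p IHp] //= /and4P[_ /eqP/setP ov _ dp] vS.
by apply: IHp => //; apply: (st v) => //; have := ov (hd c p); rewrite !inE eqxx orbT.
Qed.

Lemma set2_eq (a b c d : V) : [set a; b] = [set c; d] -> a != b ->
  (a = c /\ b = d) \/ (a = d /\ b = c).
Proof.
move=> /setP E ab; have := E a; have := E b.
rewrite !inE !eqxx ?orbT /= => /esym /orP hb /esym /orP ha.
case: ha => /eqP Ea; case: hb => /eqP Eb; subst; auto; by rewrite eqxx in ab.
Qed.

Lemma uniq_catP (S1 S2 : seq V) z : uniq (S1 ++ S2) -> z \in S1 -> z \in S2 -> False.
Proof. by rewrite cat_uniq => /and3P[_ /hasPn h _] z1 /h /negP[]. Qed.

Lemma decomp_unique : injective (nlab N) ->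
  (forall T, decomp N T -> uniq (verts T) ->
   forall T', decomp N T' -> uniq (verts T') -> rt T' = rt T -> T' \in orb T) /\
  (forall p c, pdecomp N c p -> uniq (c :: pverts p) ->
   forall p', pdecomp N c p' -> uniq (c :: pverts p') -> hd c p' = hd c p ->
   p' \in porb p).
Proof.
move=> injN.
have conflict v l r c p q : out N v == [set rt l; rt r] -> rt l != rt r ->
    decomp N l -> decomp N r -> uniq (verts l ++ verts r) ->
    out N v == [set hd c p; hd c q] -> pdecomp N c p -> pdecomp N c q -> False.
  move=> /eqP-> lr dl dr U /eqP/set2_eq-/(_ lr) E dp dq.
  have sl := proj1 decomp_stable _ dl; have sr := proj1 decomp_stable _ dr.
  have [cl cr] : c \in verts l /\ c \in verts r.
    case: E => -[E1 E2]; split.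
    - by apply: (pdecomp_end dp) => //; rewrite -E1 rt_verts.
    - by apply: (pdecomp_end dq) => //; rewrite -E2 rt_verts.
    - by apply: (pdecomp_end dq) => //; rewrite -E1 rt_verts.
    - by apply: (pdecomp_end dp) => //; rewrite -E2 rt_verts.
  exact: uniq_catP U cl cr.
have out2_0 v (a b : V) : out N v == set0 -> out N v == [set a; b] -> False.
  by move=> /eqP-> /eqP/setP/(_ a); rewrite !inE eqxx.
apply: tm_pt_ind => /=.
- move=> v x /andP[ov /eqP nx] _ [v' x'|v' l' r'|v' c' y' x' p' q'] /=.
  + by move=> /andP[_ /eqP nx'] _ E; rewrite inE; apply/eqP; congr Lf => //; apply: injN; rewrite nx nx'.
  + by move=> /and4P[_ ov' _ _] _ E; subst v'; case: (out2_0 _ _ _ ov ov').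
  + by move=> /and5P[_ ov' _ _ _] _ E; subst v'; case: (out2_0 _ _ _ ov ov').
- move=> v l IHl r IHr /and4P[lr ov dl dr] /andP[_ U].
  move=> [v' x'|v' l' r'|v' c' y' x' p' q'] /=.
  + by move=> /andP[ov' _] _ E; subst v'; case: (out2_0 _ _ _ ov' ov).
  + move=> /and4P[lr' ov' dl' dr'] /andP[_ U'] E; subst v'.
    move: U U'; rewrite !cat_uniq => /and3P[ul _ ur] /and3P[ul' _ ur'].
    move: ov'; rewrite (eqP ov) mem_cat => /eqP/set2_eq-/(_ lr) [[E1 E2]|[E1 E2]].
      by apply/orP; left; apply: (allpairs_f (Nd v)); [apply: IHl|apply: IHr].
    apply/orP; right; apply: (allpairs_f (fun a b => Nd v b a)); [exact: IHl|exact: IHr].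
  + move=> /and5P[_ ov' _ _ /andP[dp' dq']] _ E; subst v'.
    by case: (conflict _ _ _ _ _ _ ov lr dl dr U ov' dp' dq').
- move=> v c y x p IHp q IHq /and5P[pq ov oc /andP[oy nx]] /andP[dp dq] /andP[vU U].
  move=> [v' x'|v' l' r'|v' c' y' x' p' q'] /=.
  + by move=> /andP[ov' _] _ E; subst v'; case: (out2_0 _ _ _ ov' ov).
  + move=> /and4P[lr' ov' dl' dr'] /andP[_ U'] E; subst v'.
    by case: (conflict _ _ _ _ _ _ ov' lr' dl' dr' U' ov dp dq).
  move=> /and5P[pq' ov' oc' /andP[oy' nx']] /andP[dp' dq'] /andP[vU' U'] E; subst v'.
  have sp := proj2 decomp_stable _ _ _ oc oy dp.
  have sq := proj2 decomp_stable _ _ _ oc oy dq.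
  have hs S r : r \in c :: S -> r \in S ++ [:: c; y].
    by rewrite mem_cat !inE => /orP[]->; rewrite ?orbT.
  have hp := hs _ _ (hd_pverts c p); have hq := hs _ _ (hd_pverts c q).
  move: (ov'); rewrite (eqP ov) => /eqP/set2_eq-/(_ pq) E.
  have [c'p c'q] : c' \in pverts p ++ [:: c; y] /\ c' \in pverts q ++ [:: c; y].
    case: E => -[E1 E2]; split.
    - by apply: (pdecomp_end dp') => //; rewrite -E1.
    - by apply: (pdecomp_end dq') => //; rewrite -E2.
    - by apply: (pdecomp_end dq') => //; rewrite -E1.
    - by apply: (pdecomp_end dp') => //; rewrite -E2.
  have Ec : c' = c.
    have : c' \in [:: c; y].
      move: c'p c'q; rewrite !mem_cat => /orP[c'p|//] /orP[c'q|//].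
      by case: (uniq_catP U c'p); rewrite mem_cat c'q.
    rewrite !inE => /orP[/eqP//|/eqP Ey]; subst c'.
    by move: oc'; rewrite (eqP oy) => /eqP/setP/(_ y'); rewrite !inE eqxx.
  subst c'.
  have Ey : y' = y by move: oc'; rewrite (eqP oc) => /eqP/set1_inj.
  subst y'.
  have Ex : x' = x by apply: injN; rewrite (eqP nx) (eqP nx').
  subst x'; rewrite mem_cat.
  have uc s t : uniq (s ++ t ++ [:: c; y]) -> uniq (c :: s) && uniq (c :: t).
    move=> Ust; have E0 s0 : uniq (c :: s0) = uniq (s0 ++ [:: c]).
      by rewrite cats1 rcons_uniq.
    rewrite !E0.
    rewrite !(subseq_uniq _ Ust) //.
      apply: subseq_trans (suffix_subseq _ _); apply: cat_subseq => //.
      by rewrite /= eqxx.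
    apply: cat_subseq => //; apply: subseq_trans (suffix_subseq _ _).
    by rewrite /= eqxx.
  have /andP[up uq] := uc _ _ U; have /andP[up' uq'] := uc _ _ U'.
  case: E => -[E1 E2].
    by apply/orP; left; apply: (allpairs_f (Gl v c y x)); [apply: (IHp c)|apply: (IHq c)].
  by apply/orP; right; apply: (allpairs_f (fun a b => Gl v c y x b a)); [apply: (IHp c)|apply: (IHq c)].
- move=> c _ _ [|v t p] /=; first by rewrite inE eqxx.
  move=> _ /andP[cv _] E; subst v.
  by move: cv; rewrite inE eqxx.
- move=> v t IHt p IHp c /and4P[tp ov dt dp] /andP[cU /andP[_ U]].
  move=> [|v' t' p'] /=.
    by move=> _ _ E; subst v; move: cU; rewrite inE eqxx.
  move=> /and4P[tp' ov' dt' dp'] /andP[cU' /andP[_ U']] E; subst v'.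
  move: (ov'); rewrite (eqP ov) => /eqP/set2_eq-/(_ tp) [[E1 E2]|[E1 E2]].
    have sub s q : c \notin v :: s ++ q -> uniq (s ++ q) -> uniq s && uniq (c :: q).
      rewrite inE mem_cat cat_uniq !negb_or /= => /and3P[_ _ ->].
      by case/and3P => -> _ ->.
    have /andP[ut up] := sub _ _ cU U; have /andP[ut' up'] := sub _ _ cU' U'.
    by apply: (allpairs_f (Pc v)); [apply: IHt|apply: (IHp c)].
  have : c \in verts t.
    by apply: (pdecomp_end dp' (proj1 decomp_stable _ dt)); rewrite -E1 rt_verts.
  by move=> ct; move: cU; rewrite inE mem_cat ct orbT.
Qed.

Lemma orb_decomp :
  (forall T T', T' \in orb T -> decomp N T -> decomp N T' /\ rt T' = rt T) /\
  (forall p p' c, p' \in porb p -> pdecomp N c p -> pdecomp N c p' /\ hd c p' = hd c p).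
Proof.
apply: tm_pt_ind => /=.
- by move=> v x T'; rewrite inE => /eqP->.
- move=> v l IHl r IHr T'; rewrite mem_cat => /orP[] /allpairsP[[a b] /= [ha hb ->]] /=
    /and4P[lr ov dl dr]; have [-> ->] := IHl _ ha dl; have [-> ->] := IHr _ hb dr.
    by rewrite lr ov.
  by rewrite eq_sym lr setUC ov.
- move=> v c y x p IHp q IHq T'.
  rewrite mem_cat => /orP[] /allpairsP[[a b] /= [ha hb ->]] /= /and5P[pq ov oc ox];
    case/andP => dp dq; have [-> ->] := IHp _ c ha dp; have [-> ->] := IHq _ c hb dq.
    by rewrite pq ov oc ox.
  by rewrite eq_sym pq setUC ov oc ox.
- by move=> p' c; rewrite inE => /eqP->.
- move=> v t IHt p IHp p' c /allpairsP[[a b] /= [ha hb ->]] /= /and4P[tp ov dt dp].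
  by have [-> ->] := IHt _ ha dt; have [-> ->] := IHp _ c hb dp; rewrite tp ov.
Qed.

Lemma decomp_wf :
  (forall T, decomp N T -> wf T) /\ (forall p c, pdecomp N c p -> pwf p).
Proof.
apply: tm_pt_ind => //= [v l IHl r IHr|v c y x p IHp q IHq|v t IHt p IHp c].
- by case/and4P => _ _ /IHl-> /IHr->.
- case/and5P => pq _ _ _ /andP[/IHp-> /IHq->]; rewrite andbT.
  by case: (p) (q) pq => [|? ? ?] [|? ? ?] //=; rewrite eqxx.
- by case/and4P => _ _ /IHt-> /IHp->.
Qed.

Lemma label_verts :
  (forall T x, decomp N T -> x \in labels T -> nlab N x \in verts T) /\
  (forall p c x, pdecomp N c p -> x \in plabels p -> nlab N x \in pverts p).
Proof.
apply: tm_pt_ind => //=.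
- by move=> v x x' /andP[_ /eqP <-]; rewrite !inE => /eqP->.
- move=> v l IHl r IHr x /and4P[_ _ dl dr]; rewrite inE !mem_cat.
  by case/orP => [/(IHl _ dl)|/(IHr _ dr)] ->; rewrite ?orbT.
- move=> v c y x p IHp q IHq x' /and5P[_ _ _ /andP[_ /eqP <-]] /andP[dp dq].
  rewrite !inE !mem_cat !inE.
  by case/or3P => [/eqP->|/(IHp _ _ dp)->|/(IHq _ _ dq)->]; rewrite ?eqxx ?orbT.
- move=> v t IHt p IHp c x /and4P[_ _ dt dp]; rewrite inE !mem_cat.
  by case/orP => [/(IHt _ dt)|/(IHp _ _ dp)] ->; rewrite ?orbT.
Qed.

Lemma reach_stable S k u z : stable S -> u \in S -> reach N k u z -> z \in S.
Proof.
move=> st; elim: k u => [|k IH] u uS /=; first by move/eqP <-.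
by case/existsP => w /andP[uw]; apply: IH; apply: st uw.
Qed.

Lemma reachS_out2 v a b k z : out N v == [set a; b] ->
  reach N k.+1 v z = reach N k a z || reach N k b z.
Proof.
move=> ov /=; apply/existsP/orP.
  by case=> w /andP[/(out2_mem ov)[] ->]; [left|right].
case=> h; [exists a|exists b]; rewrite h andbT; move/eqP/setP: ov => ov;
  [have := ov a|have := ov b]; by rewrite !inE eqxx ?orbT.
Qed.

Definition height_bounds u z (h : nat * nat) :=
  [/\ reach N h.1 u z, reach N h.2 u z & forall k, reach N k u z -> h.2 <= k <= h.1].

Lemma height_bounds_step v a b z h : out N v == [set a; b] -> z != v ->
  height_bounds a z h -> (forall k, ~~ reach N k b z) ->
  height_bounds v z (h.1.+1, h.2.+1).
Proof.
move=> ov zv [h1 h2 h3] nb; split=> [||[|k]].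
- by rewrite (reachS_out2 _ _ ov) h1.
- by rewrite (reachS_out2 _ _ ov) h2.
- by rewrite /= eq_sym (negPf zv).
- by rewrite (reachS_out2 _ _ ov) (negPf (nb k)) orbF => /h3.
Qed.

Lemma decomp_heights :
  (forall T, decomp N T -> uniq (verts T) ->
     forall h, h \in heights T -> height_bounds (rt T) (nlab N h.1) h.2) /\
  (forall p c y, pdecomp N c p -> uniq (pverts p ++ [:: c; y]) ->
     out N c == [set y] -> out N y == set0 ->
     (forall h, h \in pheights p -> height_bounds (hd c p) (nlab N h.1) h.2) /\
     (forall k, reach N k (hd c p) y = (k == (plen p).+1))).
Proof.
have nostep S k u z : stable S -> u \in S -> z \notin S -> ~~ reach N k u z.
  by move=> st uS; apply: contra; apply: reach_stable uS.
have inlab T h : decomp N T -> h \in heights T -> nlab N h.1 \in verts T.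
  by move=> dT hT; apply: (proj1 label_verts) => //; rewrite -(proj1 (labels_heights _ _)) map_f.
have inplab c p h : pdecomp N c p -> h \in pheights p -> nlab N h.1 \in pverts p.
  by move=> dp hp; apply: (proj2 label_verts) dp _; rewrite -(proj2 (labels_heights _ _)) map_f.
have neq z v (S : seq V) : z \in S -> v \notin S -> z != v.
  by move=> zS; apply: contraNneq => <-.
have notin z (S1 S2 : seq V) : uniq (S1 ++ S2) -> z \in S1 -> z \notin S2.
  by move=> U z1; apply/negP => z2; apply: uniq_catP U z1 z2.
have notin' z (S1 S2 : seq V) : uniq (S1 ++ S2) -> z \in S2 -> z \notin S1.
  by rewrite uniq_catC; apply: notin.
apply: tm_pt_ind => /=.
- move=> v x /andP[ov /eqP nx] _ h; rewrite inE => /eqP->; split=> /=; rewrite ?nx //.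
  by case=> [|k] //= /existsP[w]; rewrite (out0P w ov).
- move=> v l IHl r IHr /and4P[_ ov dl dr] /andP[vU U] h0 /mapP[h].
  have := U; rewrite cat_uniq => /and3P[ul _ ur].
  have sl := proj1 decomp_stable _ dl; have sr := proj1 decomp_stable _ dr.
  rewrite mem_cat => /orP[hl|hr] -> /=.
    have zl := inlab _ _ dl hl.
    apply: (height_bounds_step ov).
    + by apply: neq (_ : _ \in verts l ++ verts r) vU; rewrite mem_cat zl.
    + exact: IHl.
    + by move=> k; apply: (nostep _ _ _ _ sr); rewrite ?rt_verts // (notin _ _ _ U).
  have zr := inlab _ _ dr hr.
  rewrite setUC in ov; apply: (height_bounds_step ov).
  + by apply: neq (_ : _ \in verts l ++ verts r) vU; rewrite mem_cat zr orbT.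
  + exact: IHr.
  + by move=> k; apply: (nostep _ _ _ _ sl); rewrite ?rt_verts // (notin' _ _ _ U).
- move=> v c y x p IHp q IHq /and5P[_ ov oc /andP[oy /eqP nx]] /andP[dp dq] /andP[vU U].
  have [Up Uq] : uniq (pverts p ++ [:: c; y]) /\ uniq (pverts q ++ [:: c; y]).
    split; apply: subseq_uniq U; last exact: suffix_subseq.
    by apply: cat_subseq => //; apply: suffix_subseq.
  have sp := proj2 decomp_stable _ _ _ oc oy dp.
  have sq := proj2 decomp_stable _ _ _ oc oy dq.
  have [Hp Rp] := IHp _ _ dp Up oc oy; have [Hq Rq] := IHq _ _ dq Uq oc oy.
  have hs (S : seq V) r : r \in c :: S -> r \in S ++ [:: c; y].
    by rewrite mem_cat !inE => /orP[]->; rewrite ?orbT.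
  have hp := hs _ _ (hd_pverts c p); have hq := hs _ _ (hd_pverts c q).
  have Rv k : reach N k v y = (k == (plen p).+2) || (k == (plen q).+2).
    case: k => [|k]; last by rewrite (reachS_out2 _ _ ov) Rp Rq !eqSS.
    by rewrite /=; apply/negbTE; apply: contraNneq vU => ->; rewrite !mem_cat !inE eqxx !orbT.
  move=> h0; rewrite inE => /orP[/eqP-> /=|].
    rewrite nx; split=> [||k]; rewrite Rv /= ?eqSS.
    + by rewrite /maxn; case: ltnP; rewrite eqxx ?orbT.
    + by rewrite /minn; case: ltnP; rewrite eqxx ?orbT.
    + by case/orP => /eqP->; rewrite !ltnS geq_min leq_max !leqnn ?orbT.
  case/mapP => h; rewrite mem_cat => /orP[hp0|hq0] -> /=.
    have zp := inplab _ _ _ dp hp0.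
    apply: (height_bounds_step ov).
    + by apply: neq vU; rewrite mem_cat zp.
    + exact: Hp.
    + by move=> k; apply: (nostep _ _ _ _ sq); rewrite // (notin _ _ _ U).
  have zq := inplab _ _ _ dq hq0.
  rewrite setUC in ov; apply: (height_bounds_step ov).
  + by apply: neq vU; rewrite !mem_cat zq !orbT.
  + exact: Hq.
  + move=> k; apply: (nostep _ _ _ _ sp); rewrite // mem_cat negb_or.
    rewrite (notin' _ _ _ U) ?mem_cat ?zq //=; exact: notin Uq zq.
- move=> c y _ /= U oc oy; split=> // -[|[|k]] /=.
  + by move: U; rewrite inE andbT => /negPf->.
  + by apply/existsP; exists y; rewrite (out1P _ oc) eqxx /=.
  + apply/negbTE/existsPn => w; rewrite (out1P _ oc); case: eqVneq => // <- /=.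
    by apply/existsPn => w'; rewrite (out0P).
- move=> v t IHt p IHp c y /and4P[tp ov dt dp] /andP[vU U] oc oy.
  move: vU U; rewrite -!catA => vU U.
  have := U; rewrite cat_uniq => /and3P[ut _ up].
  have st := proj1 decomp_stable _ dt.
  have sp := proj2 decomp_stable _ _ _ oc oy dp.
  have [Hp Rp] := IHp _ _ dp up oc oy.
  have hp : hd c p \in pverts p ++ [:: c; y].
    by have := hd_pverts c p; rewrite mem_cat !inE => /orP[]->; rewrite ?orbT.
  split=> [h0 /mapP[h]|[|k]].
  + rewrite mem_cat => /orP[ht|hp0] -> /=.
      have zt := inlab _ _ dt ht.
      apply: (height_bounds_step ov).
      * by apply: neq vU; rewrite mem_cat zt.
      * exact: IHt.
      * by move=> k; apply: (nostep _ _ _ _ sp); rewrite // (notin _ _ _ U).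
    have zp := inplab _ _ _ dp hp0.
    rewrite setUC in ov; apply: (height_bounds_step ov).
    * by apply: neq vU; rewrite !mem_cat zp !orbT.
    * exact: Hp.
    * by move=> k; apply: (nostep _ _ _ _ st); rewrite ?rt_verts // (notin' _ _ _ U) // mem_cat zp.
  + by rewrite /=; apply/negbTE; apply: contraNneq vU => ->; rewrite !mem_cat !inE eqxx !orbT.
  + rewrite (reachS_out2 _ _ ov) Rp eqSS (negPf (nostep _ _ _ _ st _ _)) ?rt_verts //.
    by rewrite (notin' _ _ _ U) // mem_cat !inE eqxx !orbT.
Qed.

End DecompTheory.

(** * Networks described by a term *)

Section Galls.
Variables V L : Type.

Fixpoint spine (p : pt V L) : seq V :=
  if p is Pc v _ p' then v :: spine p' else [::].

Fixpoint galls (T : tm V L) : seq (V * seq V * seq V * V) :=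
  match T with
  | Lf _ _ => [::]
  | Nd _ l r => galls l ++ galls r
  | Gl v c _ _ p q => (v, spine p, spine q, c) :: pgalls p ++ pgalls q
  end
with pgalls (p : pt V L) : seq (V * seq V * seq V * V) :=
  if p is Pc _ t p' then galls t ++ pgalls p' else [::].

Definition gall_nodes (g : V * seq V * seq V * V) : seq V :=
  g.1.1.1 :: g.1.1.2 ++ g.1.2 ++ [:: g.2].

Lemma galls_rets :
  (forall T, map snd (galls T) = rets T) /\ (forall p, map snd (pgalls p) = prets p).
Proof.
by apply: tm_pt_ind => //= [v l IHl r IHr|v c y x p IHp q IHq|v t IHt p IHp];
  rewrite map_cat ?IHl ?IHr ?IHp ?IHq ?IHt.
Qed.

Lemma count_gall_nodes a :
  (forall T, count a (flatten (map gall_nodes (galls T))) <= count a (verts T)) /\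
  (forall p, count a (spine p) + count a (flatten (map gall_nodes (pgalls p)))
             <= count a (pverts p)).
Proof.
apply: tm_pt_ind => //= [v l IHl r IHr|v c y x p IHp q IHq|v t IHt p IHp];
  rewrite ?map_cat ?flatten_cat !count_cat /=; try lia.
Qed.

End Galls.

Lemma uniq_flatten_eq (X : eqType) (ss : seq (seq X)) s s' x :
  uniq (flatten ss) -> s \in ss -> s' \in ss -> x \in s -> x \in s' -> s = s'.
Proof.
elim: ss => //= t ss IH; rewrite cat_uniq => /and3P[_ /hasPn ht us].
have nt r y : r \in ss -> y \in r -> y \notin t.
  by move=> rs yr; apply: ht; apply/flattenP; exists r.
rewrite !inE => /orP[/eqP->|ss_s] /orP[/eqP->|ss_s'] xs xs' //.
- by move: (nt _ _ ss_s' xs'); rewrite xs.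
- by move: (nt _ _ ss_s xs); rewrite xs'.
- exact: IH.
Qed.

Lemma uniq_flatten_mem (X : eqType) (ss : seq (seq X)) s :
  uniq (flatten ss) -> s \in ss -> uniq s.
Proof.
elim: ss => //= t ss IH; rewrite cat_uniq inE => /and3P[ut _ us] /orP[/eqP->//|].
exact: IH.
Qed.

Lemma subseq2_index (X : eqType) (u w : X) s :
  uniq s -> subseq [:: u; w] s -> index u s < index w s.
Proof.
elim: s => //= a s IH /andP[as_ us].
have [E|ua] := eqVneq u a.
  subst a; rewrite sub1seq => ws.
  by have [E|//] := eqVneq u w; move: as_; rewrite E ws.
move=> sub; have ws : w \in s by apply: (mem_subseq sub); rewrite !inE eqxx orbT.
have [E|_] := eqVneq a w; first by move: as_; rewrite E ws.
exact: IH.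
Qed.

Section DecompSGT.
Variables (n K : nat) (N : netT n K).
Notation e := (erel N).
Notation V := 'I_K.
Notation tmN := (tm V 'I_n).
Notation ptN := (pt V 'I_n).

Lemma decomp_arc_subseq :
  (forall T, decomp N T -> forall u w, u \in verts T -> e u w ->
     subseq [:: u; w] (verts T)) /\
  (forall p c y, out N c == [set y] -> out N y == set0 -> pdecomp N c p ->
     forall u w, u \in pverts p ++ [:: c; y] -> e u w ->
     subseq [:: u; w] (pverts p ++ [:: c; y])).
Proof.
have hs c (p : ptN) y : hd c p \in pverts p ++ [:: c; y].
  by have := hd_pverts c p; rewrite mem_cat !inE => /orP[]->; rewrite ?orbT.
apply: tm_pt_ind => /=.
- by move=> v x /andP[ov _] u w; rewrite inE => /eqP->; rewrite (out0P _ ov).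
- move=> v l IHl r IHr /and4P[_ ov dl dr] u w; rewrite inE mem_cat.
  case/or3P => [/eqP-> vw|ul uw|ur uw].
  + rewrite eqxx sub1seq mem_cat.
    by case: (out2_mem ov vw) => ->; rewrite rt_verts ?orbT.
  + change (is_true (subseq [:: u; w] (v :: verts l ++ verts r))).
    apply: (subseq_trans (IHl dl _ _ ul uw)).
    by apply: subseq_trans (subseq_cons _ _); apply: prefix_subseq.
  + change (is_true (subseq [:: u; w] (v :: verts l ++ verts r))).
    apply: (subseq_trans (IHr dr _ _ ur uw)).
    by apply: subseq_trans (subseq_cons _ _); apply: suffix_subseq.
- move=> v c y x p IHp q IHq /and5P[_ ov oc /andP[oy _]] /andP[dp dq] u w.
  rewrite inE mem_cat => /or3P[/eqP-> vw|up uw|uq uw].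
  + rewrite eqxx sub1seq mem_cat.
    case: (out2_mem ov vw) => ->; last by rewrite hs orbT.
    by have := hs c p y; rewrite !mem_cat => /orP[]->; rewrite ?orbT.
  + change (is_true (subseq [:: u; w] (v :: pverts p ++ pverts q ++ [:: c; y]))).
    have upc : u \in pverts p ++ [:: c; y] by rewrite mem_cat up.
    apply: (subseq_trans (IHp _ _ oc oy dp _ _ upc uw)).
    apply: subseq_trans (subseq_cons _ _); apply: cat_subseq => //.
    exact: suffix_subseq.
  + change (is_true (subseq [:: u; w] (v :: pverts p ++ pverts q ++ [:: c; y]))).
    apply: (subseq_trans (IHq _ _ oc oy dq _ _ uq uw)).
    by apply: subseq_trans (subseq_cons _ _); apply: suffix_subseq.
- move=> c y oc oy _ u w; rewrite !inE => /orP[/eqP->|/eqP->].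
    by rewrite (out1P _ oc) => /eqP->; rewrite /= !eqxx.
  by rewrite (out0P _ oy).
- move=> v t IHt p IHp c y oc oy /and4P[_ ov dt dp] u w; rewrite -catA inE mem_cat.
  case/or3P => [/eqP-> vw|ut uw|up uw].
  + rewrite eqxx sub1seq mem_cat.
    by case: (out2_mem ov vw) => ->; rewrite ?rt_verts ?hs ?orbT.
  + change (is_true (subseq [:: u; w] (v :: verts t ++ pverts p ++ [:: c; y]))).
    apply: (subseq_trans (IHt dt _ _ ut uw)).
    by apply: subseq_trans (subseq_cons _ _); apply: prefix_subseq.
  + change (is_true (subseq [:: u; w] (v :: verts t ++ pverts p ++ [:: c; y]))).
    apply: (subseq_trans (IHp _ _ oc oy dp _ _ up uw)).
    by apply: subseq_trans (subseq_cons _ _); apply: suffix_subseq.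
Qed.

Lemma decomp_outdeg :
  (forall T, decomp N T -> forall v, v \in verts T ->
     [\/ outdeg N v = 2, outdeg N v = 1 |
         outdeg N v = 0 /\ exists2 x, x \in labels T & v = nlab N x]) /\
  (forall p c, pdecomp N c p -> forall v, v \in pverts p ->
     [\/ outdeg N v = 2, outdeg N v = 1 |
         outdeg N v = 0 /\ exists2 x, x \in plabels p & v = nlab N x]).
Proof.
apply: tm_pt_ind => //=.
- move=> v x /andP[ov /eqP nx] v'; rewrite inE => /eqP->.
  by apply: Or33; rewrite (outdeg0 ov); split=> //; exists x; rewrite ?inE.
- move=> v l IHl r IHr /and4P[lr ov dl dr] v'; rewrite inE mem_cat.
  case/or3P => [/eqP->|/(IHl dl)|/(IHr dr)].
  + by apply: Or31; apply: outdeg2 ov.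
  + case=> [->|->|[-> [x h ->]]]; [exact: Or31|exact: Or32|apply: Or33].
    by split=> //; exists x; rewrite // mem_cat h.
  + case=> [->|->|[-> [x h ->]]]; [exact: Or31|exact: Or32|apply: Or33].
    by split=> //; exists x; rewrite // mem_cat h orbT.
- move=> v c y x p IHp q IHq /and5P[pq ov oc /andP[oy /eqP nx]] /andP[dp dq] v'.
  rewrite inE !mem_cat !inE => /or4P[/eqP->|/(IHp _ dp)|/(IHq _ dq)|].
  + by apply: Or31; apply: outdeg2 ov.
  + case=> [->|->|[-> [x' h ->]]]; [exact: Or31|exact: Or32|apply: Or33].
    by split=> //; exists x'; rewrite // !inE mem_cat h orbT.
  + case=> [->|->|[-> [x' h ->]]]; [exact: Or31|exact: Or32|apply: Or33].
    by split=> //; exists x'; rewrite // !inE mem_cat h !orbT.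
  + case/orP => /eqP->; first by apply: Or32; apply: outdeg1 oc.
    by apply: Or33; rewrite (outdeg0 oy); split=> //; exists x; rewrite ?inE ?eqxx.
- move=> v t IHt p IHp c /and4P[tp ov dt dp] v'; rewrite inE mem_cat.
  case/or3P => [/eqP->|/(IHt dt)|/(IHp _ dp)].
  + by apply: Or31; apply: outdeg2 ov.
  + case=> [->|->|[-> [x h ->]]]; [exact: Or31|exact: Or32|apply: Or33].
    by split=> //; exists x; rewrite // mem_cat h.
  + case=> [->|->|[-> [x h ->]]]; [exact: Or31|exact: Or32|apply: Or33].
    by split=> //; exists x; rewrite // mem_cat h orbT.
Qed.

Lemma label_outdeg :
  (forall T, decomp N T -> forall x, x \in labels T -> outdeg N (nlab N x) = 0) /\
  (forall p c, pdecomp N c p -> forall x, x \in plabels p -> outdeg N (nlab N x) = 0).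
Proof.
apply: tm_pt_ind => //=.
- by move=> v x /andP[ov /eqP nx] x'; rewrite inE => /eqP->; rewrite nx outdeg0.
- move=> v l IHl r IHr /and4P[_ _ dl dr] x; rewrite mem_cat.
  by case/orP => [/(IHl dl)|/(IHr dr)].
- move=> v c y x p IHp q IHq /and5P[_ _ _ /andP[oy /eqP nx]] /andP[dp dq] x'.
  rewrite inE mem_cat => /or3P[/eqP->|/(IHp _ dp)|/(IHq _ dq)] //.
  by rewrite nx outdeg0.
- move=> v t IHt p IHp c /and4P[_ _ dt dp] x; rewrite mem_cat.
  by case/orP => [/(IHt dt)|/(IHp _ dp)].
Qed.

Lemma ret_child :
  (forall T, decomp N T -> forall c w, c \in rets T -> e c w -> outdeg N w = 0) /\
  (forall p c, pdecomp N c p -> forall c' w, c' \in prets p -> e c' w -> outdeg N w = 0).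
Proof.
apply: tm_pt_ind => //=.
- move=> v l IHl r IHr /and4P[_ _ dl dr] c w; rewrite mem_cat.
  by case/orP => [/(IHl dl)|/(IHr dr)]; apply.
- move=> v c y x p IHp q IHq /and5P[_ _ oc /andP[oy _]] /andP[dp dq] c' w.
  rewrite inE mem_cat => /or3P[/eqP->|/(IHp _ dp)|/(IHq _ dq)]; try exact.
  by rewrite (out1P _ oc) => /eqP<-; rewrite outdeg0.
- move=> v t IHt p IHp c /and4P[_ _ dt dp] c' w; rewrite mem_cat.
  by case/orP => [/(IHt dt)|/(IHp _ dp)]; apply.
Qed.

Lemma spine_path v c p : pdecomp N c p -> e v (hd c p) ->
  path.path e v (rcons (spine p) c).
Proof.
elim: p v => [|v' t p IHp] v //=; first by move=> _ ->.
case/and4P => _ ov _ dp -> /=; apply: IHp => //.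
by move/eqP/setP/(_ (hd c p)): ov; rewrite !inE eqxx orbT.
Qed.

Lemma spine_outdeg c p : pdecomp N c p -> all (fun v => outdeg N v == 2) (spine p).
Proof.
elim: p => [|v' t p IHp] //= /and4P[tp ov _ dp].
by rewrite (outdeg2 tp ov) eqxx IHp.
Qed.

Lemma hd_spine c (p : ptN) : hd c p = head c (spine p).
Proof. by case: p. Qed.

Lemma gall_facts :
  (forall T, decomp N T -> forall g, g \in galls T ->
     [/\ outdeg N g.1.1.1 = 2,
         path.path e g.1.1.1 (rcons g.1.1.2 g.2) /\
         path.path e g.1.1.1 (rcons g.1.2 g.2),
         outdeg N g.2 = 1,
         all (fun v => outdeg N v == 2) (g.1.1.2 ++ g.1.2) &
         head g.2 g.1.1.2 != head g.2 g.1.2]) /\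
  (forall p c, pdecomp N c p -> forall g, g \in pgalls p ->
     [/\ outdeg N g.1.1.1 = 2,
         path.path e g.1.1.1 (rcons g.1.1.2 g.2) /\
         path.path e g.1.1.1 (rcons g.1.2 g.2),
         outdeg N g.2 = 1,
         all (fun v => outdeg N v == 2) (g.1.1.2 ++ g.1.2) &
         head g.2 g.1.1.2 != head g.2 g.1.2]).
Proof.
apply: tm_pt_ind => //=.
- move=> v l IHl r IHr /and4P[_ _ dl dr] g; rewrite mem_cat.
  by case/orP => [/(IHl dl)|/(IHr dr)].
- move=> v c y x p IHp q IHq /and5P[pq ov oc _] /andP[dp dq] g.
  rewrite inE mem_cat => /or3P[/eqP->|/(IHp _ dp)|/(IHq _ dq)] //=.
  rewrite -!hd_spine (outdeg2 pq ov) (outdeg1 oc) all_cat !(spine_outdeg (c := c)) //.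
  have [ep eq] : e v (hd c p) /\ e v (hd c q).
    move/eqP/setP: ov => ov.
    by split; [have := ov (hd c p)|have := ov (hd c q)]; rewrite !inE eqxx ?orbT.
  by split=> //; split; apply: spine_path.
- move=> v t IHt p IHp c /and4P[_ _ dt dp] g; rewrite mem_cat.
  by case/orP => [/(IHt dt)|/(IHp _ dp)].
Qed.

Lemma path_mem_indeg v p z : path.path e v p -> z \in p -> 0 < indeg N z.
Proof.
move=> + zp; case/splitPr: zp => p1 p2; rewrite cat_path /= => /and3P[_ h _].
by apply/card_gt0P; exists (last v p1); rewrite inE.
Qed.

Variable T : tmN.
Hypotheses (dT : decomp N T) (uT : uniq (verts T)) (vT : nverts N =i verts T).
Hypothesis eT : forall u w, e u w -> u \in nverts N.
Hypothesis iT : injective (nlab N).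
Hypothesis lT : forall x, x \in labels T.
Hypothesis rT : outdeg N (rt T) = 2.

Lemma indeg_decomp z : z \in verts T ->
  indeg N z + (rt T == z) = 1 + (outdeg N z == 1).
Proof.
move=> zT; have := count_verts_balance z dT.
rewrite (count_uniq_mem _ uT) zT muln1 addnC => <-; congr (_ + _).
rewrite /indeg -sum1dep_card big_mkcond /arcs_into; apply: eq_bigr => u _.
by case: ifP => // uz; rewrite (count_uniq_mem _ uT) -vT (eT uz).
Qed.

Let arc_verts u w : e u w -> (u \in verts T) && (w \in verts T).
Proof.
move=> uw; have uT' : u \in verts T by rewrite -vT (eT uw).
by rewrite uT' (proj1 (decomp_stable N) _ dT _ _ uT' uw).
Qed.

Let root_iff v : is_root N v = (v == rt T).
Proof.
apply/idP/eqP => [/and3P[vN /eqP i0 /eqP o2]|->].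
  rewrite vT in vN; have := indeg_decomp vN.
  by rewrite i0 o2 /= addn0; case: eqP.
by have := indeg_decomp (rt_verts T); rewrite /is_root vT rt_verts rT eqxx /=; lia.
Qed.

Let tree_iff v : v \in verts T -> v != rt T -> outdeg N v = 2 -> is_tree N v.
Proof.
move=> vv vr o2; have := indeg_decomp vv.
by rewrite /is_tree vT vv o2 eq_sym (negPf vr) /=; lia.
Qed.

Let leaf_iff v : v \in verts T -> outdeg N v = 0 -> is_leaf N v.
Proof.
move=> vv o0; have := indeg_decomp vv; rewrite /is_leaf vT vv o0 /=.
case: eqP => [E|_]; last by lia.
by move: rT; rewrite E o0.
Qed.

Let ret_iff v : v \in verts T -> outdeg N v = 1 -> is_ret N v.
Proof.
move=> vv o1; have := indeg_decomp vv; rewrite /is_ret vT vv o1 /=.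
case: eqP => [E|_]; last by lia.
by move: rT; rewrite E o1.
Qed.

Lemma decomp_network : is_network N.
Proof.
apply/and5P; split; [| | | |apply/andP; split].
- apply/forallP => u; apply/forallP => v; apply/implyP => uv.
  by rewrite !vT; apply: arc_verts.
- apply/forallP => u; apply/forallP => v; apply/implyP => uv.
  have lt x y : e x y -> index x (verts T) < index y (verts T).
    move=> xy; apply: subseq2_index => //.
    by apply: (proj1 decomp_arc_subseq) => //; case/andP: (arc_verts xy).
  apply/negP => /connectP[p pp Eu].
  have : index v (verts T) <= index (last v p) (verts T).
    elim: p v pp {uv Eu} => [|x p IHp] v //= /andP[/lt vx /IHp]; exact: leq_trans (ltnW vx).
  by rewrite -Eu leqNgt lt.
- by apply/cards1P; exists (rt T); apply/setP => v; rewrite !inE root_iff.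
- apply/forallP => v; apply/implyP; rewrite vT => vv.
  case: (proj1 decomp_outdeg _ dT _ vv) => [o2|o1|[o0 _]].
  + case: (eqVneq v (rt T)) => [/eqP|nr]; first by rewrite -root_iff => ->.
    by rewrite (tree_iff vv nr o2) !orbT.
  + by rewrite (ret_iff vv o1) !orbT.
  + by rewrite (leaf_iff vv o0) orbT.
- exact/injectiveP.
- apply/eqP/setP => v; rewrite inE; apply/idP/imsetP => [/and3P[vN _ /eqP o0]|[x _ ->]].
    rewrite vT in vN.
    case: (proj1 decomp_outdeg _ dT _ vN) => [| |[_ [x _ ->]]]; rewrite ?o0 //.
    by exists x.
  apply: leaf_iff; first exact: (proj1 (label_verts N)).
  exact: (proj1 label_outdeg _ dT).
Qed.

Let uniq_galls : uniq (flatten (map (@gall_nodes _) (galls T))).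
Proof.
apply: count_mem_uniq => x; set F := flatten _.
have le1 : count_mem x F <= 1.
  apply: leq_trans (proj1 (count_gall_nodes 'I_n (pred1 x)) T) _.
  by rewrite (count_uniq_mem _ uT) leq_b1.
case: (boolP (x \in F)) => [|/count_memPn ->//].
by rewrite -has_pred1 has_count => h; apply/eqP; rewrite eqn_leq le1 h.
Qed.

Let gall_uniq g : g \in galls T -> uniq (gall_nodes g).
Proof.
by move=> gT; apply: (uniq_flatten_mem uniq_galls); apply: map_f.
Qed.

Lemma gall_tree_cycle v a b c : (v, a, b, c) \in galls T ->
  tree_cycle N v (rcons a c) (rcons b c).
Proof.
move=> gT; have [/= o2 [pa pb] o1 oab hab] := proj1 gall_facts _ dT _ gT.
have := gall_uniq gT; rewrite /gall_nodes /= => /andP[vn un].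
have pv x p : path.path e v p -> x \in p -> x \in verts T.
  move=> + xp; case/splitPr: xp => p1 p2; rewrite cat_path /= => /and3P[_ h _].
  by case/andP: (arc_verts h).
have pt_ x p : path.path e v p -> x \in p -> outdeg N x = 2 -> is_tree N x.
  move=> pp xp ox; apply: tree_iff => //; first exact: pv xp.
  have := path_mem_indeg pp xp; case: eqP => // ->.
  by have := root_iff (rt T); rewrite eqxx => /and3P[_ /eqP->].
have vv : v \in verts T.
  by case: (a) pa => [|? ?] /= /andP[/arc_verts/andP[]].
split.
- case: (eqVneq v (rt T)) => [/eqP|nr]; first by rewrite -root_iff => ->.
  by rewrite (tree_iff vv nr o2) orbT.
- by rewrite pa pb; case: (a) (b) => [|? ?] [|? ?].
- rewrite !last_rcons; split=> //; apply: ret_iff => //.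
  by apply: (pv _ _ pa); rewrite mem_rcons inE eqxx.
- rewrite !belast_rcons /=; move: oab; rewrite all_cat => /andP[oa ob].
  apply/andP; split; apply/allP => x xa.
    by apply: (pt_ _ _ pa); [rewrite mem_rcons inE xa orbT|exact/eqP/(allP oa)].
  by apply: (pt_ _ _ pb); [rewrite mem_rcons inE xa orbT|exact/eqP/(allP ob)].
- apply/pred0P => -[u w] /=; apply/negP; rewrite !inE => /andP[h1 h2].
  have Eu : u \in v :: b -> u \in v :: a -> u = v.
    rewrite !inE => /orP[/eqP//|ub] /orP[/eqP//|ua].
    move: un; rewrite cat_uniq => /and3P[_ /hasPn/(_ u)]; rewrite mem_cat ub => /(_ isT).
    by rewrite /= ua.
  have := consec_mem h1; have := consec_mem h2 => ub ua.
  have E := Eu ub ua; subst u.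
  have hd_eq d : (v, w) \in zip (v :: rcons d c) (rcons d c) -> v \notin rcons d c ->
      w = head c d.
    case/mem_zip_consec => p1 [p2 [E1 E2]].
    case/lastP: p1 E1 E2 => [|p1 v'] E1 E2; first by case: (d) E1 => [|? ?] [].
    by rewrite E1 E2 last_rcons mem_cat mem_rcons inE eqxx.
  move: vn; rewrite !mem_cat !negb_or => /and4P[va vb vc _].
  have nr d : v \notin d -> v \notin rcons d c by rewrite mem_rcons inE negb_or vc.
  by move: hab; rewrite -(hd_eq a h1 (nr _ va)) -(hd_eq b h2 (nr _ vb)) eqxx.
Qed.

Lemma ret_gall z : is_ret N z -> exists v a b, (v, a, b, z) \in galls T.
Proof.
case/and3P => zN _ /eqP o1.
have : 0 < count_mem z (rets T).
  by rewrite (proj1 (count_rets N z) _ dT) o1 (count_uniq_mem _ uT) -vT zN.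
rewrite -has_count has_pred1 -(proj1 (galls_rets _ _)) => /mapP[[[[v a] b] c] gT ->].
by exists v, a, b.
Qed.

Lemma decomp_SGT : simplex_galled_tree N.
Proof.
have netN := decomp_network.
have nodes s p1 p2 : tree_cycle N s p1 p2 ->
    exists2 g, g \in galls T & last s p1 = g.2 /\ cycle_nodes s p1 p2 =i gall_nodes g.
  move=> tc; have [z [a [b [E1 E2]]]] := tree_cycle_split tc; subst p1 p2.
  have [_ _ _ [rz _] _] := tree_cycleP tc.
  have [v [a' [b' gT]]] := ret_gall rz.
  exists (v, a', b', z) => //; rewrite last_rcons; split=> //.
  have [-> E] := tree_cycle_eq netN tc (gall_tree_cycle gT).
  move=> x; rewrite /cycle_nodes /gall_nodes !inE !mem_cat !mem_rcons !inE /=.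
  by case: E => -[-> ->]; case: (x == v); case: (x == z);
    case: (x \in a'); case: (x \in b').
split; first split=> //; first split.
- move=> v /ret_gall[s [a [b gT]]]; exists s, (rcons a v), (rcons b v).
  by rewrite last_rcons; split=> //; apply: gall_tree_cycle.
- move=> s p1 p2 s' q1 q2 tc tc'.
  have [z [a [b [E1 E2]]]] := tree_cycle_split tc.
  have [z' [a' [b' [E1' E2']]]] := tree_cycle_split tc'.
  case: (eqVneq z z') => [Ez|zz].
    subst; have [-> E] := tree_cycle_eq netN tc tc'; left; split=> //.
    by case: E => -[-> ->]; [left|right].
  right; apply/pred0P => x /=; apply/negP => /andP[x1 x2].
  have [g gT [lg ng]] := nodes _ _ _ tc; have [g' gT' [lg' ng']] := nodes _ _ _ tc'.
  rewrite ng in x1; rewrite ng' in x2.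
  have := uniq_flatten_eq uniq_galls (map_f _ gT) (map_f _ gT') x1 x2.
  move/(congr1 (last s)); rewrite /gall_nodes /= !last_cat /= -lg -lg' E1 E1' !last_rcons.
  by move/eqP; rewrite (negPf zz).
- move=> v w rv vw; have [s [a [b gT]]] := ret_gall rv.
  apply: leaf_iff; first by case/andP: (arc_verts vw).
  apply: (proj1 ret_child _ dT v) => //.
  by rewrite -(proj1 (galls_rets _ _)); apply/mapP; exists (s, a, b, v).
Qed.

End DecompSGT.

Section NetOfTerm.
Variables V L : Type.

Fixpoint edges (T : tm V L) : seq (V * V) :=
  match T with
  | Lf _ _ => [::]
  | Nd v l r => (v, rt l) :: (v, rt r) :: edges l ++ edges r
  | Gl v c y _ p q =>
      (v, hd c p) :: (v, hd c q) :: (c, y) :: pedgs c p ++ pedgs c q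
  end
with pedgs (c : V) (p : pt V L) : seq (V * V) :=
  if p is Pc v t p' then (v, rt t) :: (v, hd c p') :: edges t ++ pedgs c p' else [::].

Fixpoint leaf_verts (T : tm V L) : seq (L * V) :=
  match T with
  | Lf v x => [:: (x, v)]
  | Nd _ l r => leaf_verts l ++ leaf_verts r
  | Gl _ _ y x p q => (x, y) :: pleaf_verts p ++ pleaf_verts q
  end
with pleaf_verts (p : pt V L) : seq (L * V) :=
  if p is Pc _ t p' then leaf_verts t ++ pleaf_verts p' else [::].

Lemma leaf_verts_labels :
  (forall T, map fst (leaf_verts T) = labels T) /\
  (forall p, map fst (pleaf_verts p) = plabels p).
Proof.
by apply: tm_pt_ind => //= [v l IHl r IHr|v c y x p IHp q IHq|v t IHt p IHp];
  rewrite map_cat ?IHl ?IHr ?IHp ?IHq ?IHt.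
Qed.

Lemma count_leaf_verts a :
  (forall T, count a (map snd (leaf_verts T)) <= count a (verts T)) /\
  (forall p, count a (map snd (pleaf_verts p)) <= count a (pverts p)).
Proof.
by apply: tm_pt_ind => //= [v l IHl r IHr|v c y x p IHp q IHq|v t IHt p IHp];
  rewrite ?map_cat !count_cat /=; lia.
Qed.

Lemma size_verts_labels :
  (forall T : tm V L, size (verts T) < 4 * size (labels T)) /\
  (forall p : pt V L, size (pverts p) <= 4 * size (plabels p)).
Proof.
by apply: tm_pt_ind => //= [v l IHl r IHr|v c y x p IHp q IHq|v t IHt p IHp];
  rewrite !size_cat /=; lia.
Qed.

Lemma labels_gt0 (T : tm V L) : 0 < size (labels T).
Proof. by have := proj1 size_verts_labels T; lia. Qed.

End NetOfTerm.

Lemma size_verts_tmap V V' L L' (f : V -> V') (g : L -> L') (T : tm V L) :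
  size (verts (tmap f g T)) = size (verts T).
Proof. by rewrite (proj1 (verts_tmap _ _)) size_map. Qed.

Lemma size_pverts_ptmap V V' L L' (f : V -> V') (g : L -> L') (p : pt V L) :
  size (pverts (ptmap f g p)) = size (pverts p).
Proof. by rewrite (proj2 (verts_tmap _ _)) size_map. Qed.

Notation strip := (tmap (fun=> tt) id).
Notation pstrip := (ptmap (fun=> tt) id).

Lemma decorate_exists (V L : Type) :
  (forall (t : tm unit L) (s : seq V), size s = size (verts t) ->
     exists2 T : tm V L, strip T = t & verts T = s) /\
  (forall (p : pt unit L) (s : seq V), size s = size (pverts p) ->
     exists2 P : pt V L, pstrip P = p & pverts P = s).
Proof.
have split_size (A : Type) (s : seq A) m k : size s = m + k ->
    exists s1 s2, [/\ s = s1 ++ s2, size s1 = m & size s2 = k].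
  move=> E; exists (take m s), (drop m s); rewrite cat_take_drop size_take size_drop.
  by rewrite E; split=> //; [case: ltnP; lia|lia].
apply: tm_pt_ind => /=.
- by move=> [] x [|v [|]] // _; exists (Lf v x).
- move=> [] l IHl r IHr [|v s] //= [].
  rewrite size_cat => /split_size[s1 [s2 [-> /IHl[l' <- <-] /IHr[r' <- <-]]]].
  by exists (Nd v l' r').
- move=> [] [] [] x p IHp q IHq [|v s] //= [].
  rewrite size_cat => /split_size[s1 [s' [-> /IHp[p' <- <-]]]].
  rewrite size_cat => /split_size[s2 [s3 [-> /IHq[q' <- <-]]]].
  by case: s3 => [|c [|y []]] //= _; exists (Gl v c y x p' q').
- by move=> [|] // _; exists Pn.
- move=> [] t IHt p IHp [|v s] //= [].
  rewrite size_cat => /split_size[s1 [s2 [-> /IHt[t' <- <-] /IHp[p' <- <-]]]].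
  by exists (Pc v t' p').
Qed.

Lemma strip_verts_inj (V L : Type) :
  (forall (T T' : tm V L), strip T = strip T' -> verts T = verts T' -> T = T') /\
  (forall (p p' : pt V L), pstrip p = pstrip p' -> pverts p = pverts p' -> p = p').
Proof.
have cat_inj (A : Type) (a b c d : seq A) : size a = size c -> a ++ b = c ++ d -> a = c /\ b = d.
  elim: a c => [|x a IH] [|y c] //= [/IH H] [-> /H[-> ->]] //.
have sz (T T' : tm V L) : strip T = strip T' -> size (verts T) = size (verts T').
  by move=> E; rewrite -(size_verts_tmap (fun=> tt) id T) E size_verts_tmap.
have psz (T T' : pt V L) : pstrip T = pstrip T' -> size (pverts T) = size (pverts T').
  by move=> E; rewrite -(size_pverts_ptmap (fun=> tt) id T) E size_pverts_ptmap.
apply: tm_pt_ind => /=.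
- by move=> v x [v' x'|//|//] /= [<-] [<-].
- move=> v l IHl r IHr [//|v' l' r'|//] /= [El Er] [<-].
  by case/(cat_inj _ _ _ _ _ (sz _ _ El)) => /(IHl _ El) <- /(IHr _ Er) <-.
- move=> v c y x p IHp q IHq [//|//|v' c' y' x' p' q'] /= [<- Ep Eq] [<-].
  case/(cat_inj _ _ _ _ _ (psz _ _ Ep)) => /(IHp _ Ep) <-.
  by case/(cat_inj _ _ _ _ _ (psz _ _ Eq)) => /(IHq _ Eq) <- [<- <-].
- by case.
- move=> v t IHt p IHp [//|v' t' p'] /= [Et Ep] [<-].
  by case/(cat_inj _ _ _ _ _ (sz _ _ Et)) => /(IHt _ Et) <- /(IHp _ Ep) <-.
Qed.

Lemma tmap_comp V V' V'' L (f : V -> V') (g : V' -> V'') :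
  (forall T : tm V L, tmap g id (tmap f id T) = tmap (g \o f) id T) /\
  (forall p : pt V L, ptmap g id (ptmap f id p) = ptmap (g \o f) id p).
Proof.
by apply: tm_pt_ind => //= [v l -> r ->|v c y x p -> q ->|v t -> p ->].
Qed.

Lemma uniq_seqs_perm (X : finType) (s1 s2 : seq X) : uniq s1 -> uniq s2 ->
  size s1 = size s2 -> exists s : {perm X}, map s s1 = s2.
Proof.
elim: s1 s2 => [|a s1 IH] [|b s2] //=; first by exists 1%g.
move=> /andP[as1 u1] /andP[bs2 u2] [/IH-/(_ u1 u2)[s Es]].
exists (s * tperm (s a) b)%g; rewrite permM tpermL; congr (_ :: _).
rewrite -Es; apply/eq_in_map => x xs; rewrite permM tpermD //.
  by rewrite (inj_eq perm_inj); apply: contraNneq as1 => ->.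
by apply: contraNneq bs2 => ->; rewrite -Es map_f.
Qed.

Lemma uniq_snd_inj (X Y : eqType) (s : seq (X * Y)) x x' y :
  uniq (map snd s) -> (x, y) \in s -> (x', y) \in s -> x = x'.
Proof.
elim: s => //= -[a b] s IH /= /andP[bs us].
rewrite !inE => /orP[/eqP[-> Eb]|h1] /orP[/eqP[-> Eb']|h2] //.
- by move: bs; rewrite -Eb => /mapP[]; exists (x', y).
- by move: bs; rewrite -Eb' => /mapP[]; exists (x, y).
- exact: IH.
Qed.

Lemma uniq_count_le (X : eqType) (s1 s2 : seq X) :
  (forall x, count_mem x s1 <= count_mem x s2) -> uniq s2 -> uniq s1.
Proof.
move=> le u2; apply: count_mem_uniq => x.
have le1 : count_mem x s1 <= 1 by apply: leq_trans (le x) _; rewrite (count_uniq_mem _ u2) leq_b1.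
case: (boolP (x \in s1)) => [|/count_memPn ->//].
by rewrite -has_pred1 has_count => h; apply/eqP; rewrite eqn_leq le1 h.
Qed.

Section BuildNet.
Variables (n K : nat) (T : tm 'I_K 'I_n).
Hypotheses (uT : uniq (verts T)) (wT : wf T) (lT : perm_eq (labels T) (enum 'I_n)).
Notation V := 'I_K.

Definition net_of : netT n K :=
  ([set v in verts T], [set a in edges T],
   [ffun i => odflt (rt T) (ohead [seq lv.2 | lv <- leaf_verts T & lv.1 == i])]).

Lemma edges_source :
  (forall (T : tm V 'I_n) u w, (u, w) \in edges T -> u \in verts T) /\
  (forall (p : pt V 'I_n) c u w, (u, w) \in pedgs c p -> u \in pverts p).
Proof.
apply: tm_pt_ind => //= [v l IHl r IHr u w|v c y x p IHp q IHq u w|v t IHt p IHp c u w].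
- rewrite !inE !mem_cat => /or4P[/eqP[-> _]|/eqP[-> _]|/IHl->|/IHr->];
    by rewrite ?eqxx ?orbT.
- rewrite !inE !mem_cat !inE.
  by case/or4P => [/eqP[-> _]|/eqP[-> _]|/eqP[-> _]|/orP[/IHp->|/IHq->]]; rewrite ?eqxx ?orbT.
- rewrite !inE !mem_cat => /or4P[/eqP[-> _]|/eqP[-> _]|/IHt->|/IHp->];
    by rewrite ?eqxx ?orbT.
Qed.

Lemma decomp_local (N : netT n K) :
  (forall T : tm V 'I_n, uniq (verts T) -> wf T ->
     (forall u w, u \in verts T -> erel N u w = ((u, w) \in edges T)) ->
     (forall x v, (x, v) \in leaf_verts T -> nlab N x = v) -> decomp N T) /\
  (forall (p : pt V 'I_n) c, uniq (c :: pverts p) -> pwf p ->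
     (forall u w, u \in pverts p -> erel N u w = ((u, w) \in pedgs c p)) ->
     (forall x v, (x, v) \in pleaf_verts p -> nlab N x = v) -> pdecomp N c p).
Proof.
have ne (p : pt V 'I_n) c u w : u \notin pverts p -> ((u, w) \in pedgs c p) = false.
  by move=> h; apply: contraNF h => /(proj2 edges_source).
have net (t : tm V 'I_n) u w : u \notin verts t -> ((u, w) \in edges t) = false.
  by move=> h; apply: contraNF h => /(proj1 edges_source).
have pair_eq (a b c d : V) : ((a, b) == (c, d)) = (a == c) && (b == d) by [].
have notin (x : V) (s1 s2 : seq V) : uniq (s1 ++ s2) -> x \in s1 -> x \notin s2.
  by move=> U z1; apply/negP => z2; apply: uniq_catP U z1 z2.
have notin' (x : V) (s1 s2 : seq V) : uniq (s1 ++ s2) -> x \in s2 -> x \notin s1.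
  by rewrite uniq_catC; apply: notin.
apply: tm_pt_ind => /=.
- move=> v x _ _ he hl; rewrite (hl x v) ?inE ?eqxx // andbT.
  by apply/eqP/setP => w; rewrite !inE he ?inE.
- move=> v l IHl r IHr /andP[vn U] /andP[wl wr] he hl.
  have := U; rewrite cat_uniq => /and3P[ul _ ur].
  have := vn; rewrite mem_cat negb_or => /andP[vl vr].
  apply/and4P; split.
  + apply: contraTneq U => E; apply/negP => U.
    by apply: (uniq_catP U (rt_verts l)); rewrite E rt_verts.
  + apply/eqP/setP => w; rewrite !inE he ?inE ?eqxx //.
    by rewrite mem_cat !net // !orbF !pair_eq !eqxx /= .
  + apply: IHl => // [u w ul'|x z h]; last by apply: hl; rewrite mem_cat h.
    have uv : u != v by apply: contraNneq vl => <-.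
    rewrite he ?inE ?mem_cat ?ul' ?orbT // !pair_eq (negPf uv) /=.
    by rewrite (net r) ?orbF //; apply: notin U ul'.
  + apply: IHr => // [u w ur'|x z h]; last by apply: hl; rewrite mem_cat h orbT.
    have uv : u != v by apply: contraNneq vr => <-.
    rewrite he ?inE ?mem_cat ?ur' ?orbT // !pair_eq (negPf uv) /=.
    by rewrite (net l) //; apply: notin' U ur'.
- move=> v c y x p IHp q IHq /andP[vn U] /and3P[pq wp wq] he hl.
  have Upq : uniq (pverts p ++ pverts q).
    by move: U; rewrite catA cat_uniq => /and3P[].
  have [Up Uq] : uniq (pverts p ++ [:: c; y]) /\ uniq (pverts q ++ [:: c; y]).
    split; apply: subseq_uniq U; last exact: suffix_subseq.
    by apply: cat_subseq => //; apply: suffix_subseq.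
  have uc (s : seq V) : uniq (s ++ [:: c; y]) -> [/\ uniq (c :: s), c \notin s & y \notin s].
    move=> Us; have cs : c \notin s by apply: notin' Us _; rewrite !inE eqxx.
    have ys : y \notin s by apply: notin' Us _; rewrite !inE eqxx orbT.
    by rewrite /= cs; split=> //; move: Us; rewrite cat_uniq => /and3P[].
  have [ucp cp yp] := uc _ Up; have [ucq cq yq] := uc _ Uq.
  have cy : c != y.
    by move: U; rewrite !cat_uniq /= inE andbT => /and3P[_ _ /and3P[]].
  have := vn; rewrite !mem_cat !inE !negb_or => /and4P[vp vq vc vy].
  apply/and5P; split; [| | | |apply/andP; split].
  + have hp := hd_pverts c p; have hq := hd_pverts c q.
    case: p q pq Upq hp hq cp cq {IHp IHq U he hl Up Uq ucp ucq yp yq vp vq wp wq vn}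
        => [|v1 t1 p1] [|v2 t2 p2] //= _ Upq _ _.
    * by rewrite inE negb_or => _ /andP[].
    * by rewrite inE negb_or eq_sym => /andP[].
    * move=> _ _; apply: contraTneq Upq => ->.
      by rewrite mem_cat inE eqxx orbT.
  + apply/eqP/setP => w; rewrite !inE he ?inE ?eqxx //.
    by rewrite mem_cat !ne // !orbF !pair_eq !eqxx (negPf vc) /= orbF.
  + apply/eqP/setP => w; rewrite !inE he ?inE ?mem_cat ?inE ?eqxx ?orbT //.
    by rewrite !ne // !orbF !pair_eq !eqxx eq_sym (negPf vc).
  + rewrite (hl x y) ?inE ?eqxx // andbT.
    apply/eqP/setP => w; rewrite !inE he ?inE ?mem_cat ?inE ?eqxx ?orbT //.
    by rewrite !ne // !orbF !pair_eq !(eq_sym y) (negPf vy) (negPf cy).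
  + apply: IHp => // [u w up|x' z h]; last by apply: hl; rewrite inE mem_cat h orbT.
    have uv : u != v by apply: contraNneq vp => <-.
    have u_c : u != c by apply: contraNneq cp => <-.
    rewrite he ?inE ?mem_cat ?up ?orbT // !pair_eq (negPf uv) (negPf u_c) /=.
    by rewrite (ne q) ?orbF //; apply: notin Upq up.
  + apply: IHq => // [u w uq|x' z h]; last by apply: hl; rewrite inE mem_cat h !orbT.
    have uv : u != v by apply: contraNneq vq => <-.
    have u_c : u != c by apply: contraNneq cq => <-.
    rewrite he ?inE ?mem_cat ?uq ?orbT // !pair_eq (negPf uv) (negPf u_c) /=.
    by rewrite (ne p) //; apply: notin' Upq uq.
- by [].
- move=> v t IHt p IHp c; rewrite inE negb_or => /and3P[/andP[cv cn] vn U].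
  move=> /andP[wt wp] he hl.
  have := U; rewrite cat_uniq => /and3P[ut _ up].
  have := vn; rewrite mem_cat negb_or => /andP[vt vp].
  have := cn; rewrite mem_cat negb_or => /andP[ct cp].
  apply/and4P; split.
  + apply/eqP => E; have := hd_pverts c p; rewrite -E inE => /orP[/eqP E'|h].
      by move: ct; rewrite -E' rt_verts.
    exact: uniq_catP U (rt_verts t) h.
  + apply/eqP/setP => w; rewrite !inE he ?inE ?eqxx //.
    by rewrite mem_cat net // ne // !orbF !pair_eq !eqxx.
  + apply: IHt => // [u w ut'|x z h]; last by apply: hl; rewrite mem_cat h.
    have uv : u != v by apply: contraNneq vt => <-.
    rewrite he ?inE ?mem_cat ?ut' ?orbT // !pair_eq (negPf uv) /=.
    by rewrite (ne p) ?orbF //; apply: notin U ut'.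
  + apply: IHp => //= [|u w up'|x z h]; [by rewrite cp| |by apply: hl; rewrite mem_cat h orbT].
    have uv : u != v by apply: contraNneq vp => <-.
    rewrite he ?inE ?mem_cat ?up' ?orbT // !pair_eq (negPf uv) /=.
    by rewrite (net t) //; apply: notin' U up'.
Qed.

Let uL : uniq (labels T). Proof. by rewrite (perm_uniq lT) enum_uniq. Qed.

Lemma net_of_label x v : (x, v) \in leaf_verts T -> nlab net_of x = v.
Proof.
move=> xv; rewrite /nlab /= ffunE.
move: uL; rewrite -(proj1 (leaf_verts_labels _ _)).
elim: (leaf_verts T) xv => //= -[x' v'] s IH /=; rewrite inE => /orP[/eqP[-> ->]|h].
  by rewrite eqxx.
case/andP => x's us; case: eqP => [E|_]; last exact: IH.
by case/negP: x's; rewrite E; apply/mapP; exists (x, v).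
Qed.

Lemma net_of_decomp : decomp net_of T.
Proof.
apply: (proj1 (decomp_local net_of)) => // [u w _|x v]; first by rewrite /erel inE.
exact: net_of_label.
Qed.

Lemma net_of_SGT : 1 < n -> simplex_galled_tree net_of.
Proof.
move=> n1; have inL x : x \in labels T by rewrite (perm_mem lT) mem_enum.
have uv : uniq (map snd (leaf_verts T)).
  by apply: uniq_count_le uT => x; apply: (proj1 (count_leaf_verts _ _)).
have dT := net_of_decomp.
apply: (decomp_SGT dT uT) => //.
- by move=> v; rewrite inE.
- by move=> u w; rewrite /erel /= !inE => /(proj1 edges_source).
- have ex x : exists2 v, (x, v) \in leaf_verts T & nlab net_of x = v.
    have := inL x; rewrite -(proj1 (leaf_verts_labels _ _)) => /mapP[[x' v] h /= ->].
    by exists v => //; apply: net_of_label.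
  move=> x x'; have [v h ->] := ex x; have [v' h' ->] := ex x' => E; subst v'.
  exact: uniq_snd_inj uv h h'.
- have : size (labels T) = n by rewrite (perm_size lT) size_enum_ord.
  case: (T) dT => [v x _ E|v l r /and4P[h1 h2 _ _] _|v c y x p q /and3P[h1 h2 _] _] /=.
  + by rewrite /= in E; rewrite -E in n1.
  + exact: outdeg2 h2.
  + exact: outdeg2 h2.
Qed.

Lemma net_of_root : 1 < n -> is_root net_of (rt T).
Proof.
move=> n1; have sgt := net_of_SGT n1.
have netN : is_network net_of by case: sgt => -[].
have := node_kinds netN (_ : rt T \in nverts net_of); rewrite inE rt_verts => /(_ isT).
have := count_verts_balance (rt T) net_of_decomp.
have -> : arcs_into net_of (verts T) (rt T) = indeg net_of (rt T).
  rewrite /indeg -sum1dep_card big_mkcond; apply: eq_bigr => u _.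
  case: ifP => // uz; rewrite (count_uniq_mem _ uT).
  by move: uz; rewrite /erel inE => /(proj1 edges_source) ->.
rewrite eqxx (count_uniq_mem _ uT) rt_verts => E.
rewrite /is_leaf /is_tree /is_ret; case/or4P => // /and3P[_ /eqP i /eqP o];
  by move: E; rewrite i o.
Qed.

End BuildNet.

(** * Isomorphism classes *)

Section Isomorphism.
Variables n K : nat.
Implicit Types N : netT n K.
Notation V := 'I_K.

Lemma net_isoP N N' : reflect (exists s : {perm V},
    [/\ s @: nverts N = nverts N', forall u v, erel N u v = erel N' (s u) (s v) &
        forall i, nlab N' i = s (nlab N i)]) (net_iso N N').
Proof.
apply: (iffP existsP) => -[s].
  case/and3P => /eqP h1 /forallP h2 /forallP h3; exists s; split=> // [u v|i].
    exact/eqP/(forallP (h2 u)).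
  exact/eqP.
case=> h1 h2 h3; exists s; apply/and3P; split; first by rewrite h1.
  by apply/forallP => u; apply/forallP => v; rewrite h2.
by apply/forallP => i; rewrite h3.
Qed.

Lemma net_iso_refl N : net_iso N N.
Proof.
apply/net_isoP; exists 1%g; split=> [|u v|i]; rewrite ?perm1 //.
by rewrite (eq_imset _ (@perm1 _)) imset_id.
Qed.

Lemma net_iso_sym N N' : net_iso N N' -> net_iso N' N.
Proof.
case/net_isoP => s [h1 h2 h3]; apply/net_isoP; exists s^-1%g; split=> [|u v|i].
- by rewrite -h1 -imset_comp (eq_imset _ (permK s)) imset_id.
- by rewrite h2 !permKV.
- by rewrite h3 permK.
Qed.

Lemma net_iso_trans N N' N'' : net_iso N N' -> net_iso N' N'' -> net_iso N N''.
Proof.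
case/net_isoP => s [h1 h2 h3] /net_isoP[t [g1 g2 g3]].
apply/net_isoP; exists (s * t)%g; split=> [|u v|i]; rewrite ?permM ?h2 ?g2 ?g3 ?h3 //.
by rewrite (eq_imset _ (permM s t)) -g1 -h1 imset_comp.
Qed.

Lemma imset_set2 (s : {perm V}) a b : s @: [set a; b] = [set s a; s b].
Proof. by rewrite imsetU !imset_set1. Qed.

Lemma iso_decomp N N' (s : {perm V}) :
  (forall u, out N' (s u) = s @: out N u) -> (forall i, nlab N' i = s (nlab N i)) ->
  (forall T, decomp N T -> decomp N' (tmap s id T)) /\
  (forall p c, pdecomp N c p -> pdecomp N' (s c) (ptmap s id p)).
Proof.
move=> ho hl; apply: tm_pt_ind => //=.
- by move=> v x /andP[/eqP ov /eqP lv]; rewrite ho ov imset0 hl lv !eqxx.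
- move=> v l IHl r IHr /and4P[lr /eqP ov /IHl-> /IHr->].
  by rewrite !rt_tmap ho ov imset_set2 (inj_eq perm_inj) lr eqxx.
- move=> v c y x p IHp q IHq /and5P[pq /eqP ov /eqP oc /andP[/eqP oy /eqP ly]].
  case/andP => /IHp-> /IHq->.
  by rewrite !hd_ptmap !ho ov oc oy imset_set2 imset_set1 imset0 (inj_eq perm_inj) pq hl ly !eqxx.
- move=> v t IHt p IHp c /and4P[tp /eqP ov /IHt-> /IHp->].
  by rewrite rt_tmap hd_ptmap ho ov imset_set2 (inj_eq perm_inj) tp eqxx.
Qed.

Lemma decomp_tmap_out N N' (s : {perm V}) :
  (forall T, decomp N T -> decomp N' (tmap s id T) ->
     (forall u, u \in verts T -> out N' (s u) = s @: out N u) /\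
     (forall x, x \in labels T -> nlab N' x = s (nlab N x))) /\
  (forall p c, pdecomp N c p -> pdecomp N' (s c) (ptmap s id p) ->
     (forall u, u \in pverts p -> out N' (s u) = s @: out N u) /\
     (forall x, x \in plabels p -> nlab N' x = s (nlab N x))).
Proof.
apply: tm_pt_ind => //=.
- move=> v x /andP[/eqP ov /eqP lv] /andP[/eqP ov' /eqP lv'].
  by split=> z; rewrite inE => /eqP->; rewrite ?ov ?ov' ?lv ?lv' ?imset0.
- move=> v l IHl r IHr /and4P[_ /eqP ov dl dr] /and4P[_ /eqP ov' dl' dr'].
  have [ol ll] := IHl dl dl'; have [or lr] := IHr dr dr'; split=> z.
    rewrite inE mem_cat => /or3P[/eqP->|/ol//|/or//].
    by rewrite ov ov' !rt_tmap imset_set2.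
  by rewrite mem_cat => /orP[/ll|/lr].
- move=> v c y x p IHp q IHq.
  move=> /and5P[_ /eqP ov /eqP oc /andP[/eqP oy /eqP ly] /andP[dp dq]].
  move=> /and5P[_ /eqP ov' /eqP oc' /andP[/eqP oy' /eqP ly'] /andP[dp' dq']].
  have [op lp] := IHp _ dp dp'; have [oq lq] := IHq _ dq dq'; split=> z.
    rewrite inE !mem_cat !inE => /or4P[/eqP->|/op//|/oq//|/orP[]/eqP->].
    + by rewrite ov ov' !hd_ptmap imset_set2.
    + by rewrite oc oc' imset_set1.
    + by rewrite oy oy' imset0.
  by rewrite inE mem_cat => /or3P[/eqP->|/lp|/lq] //; rewrite ly ly'.
- move=> v t IHt p IHp c /and4P[_ /eqP ov dt dp] /and4P[_ /eqP ov' dt' dp'].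
  have [ot lt] := IHt dt dt'; have [op lp] := IHp _ dp dp'; split=> z.
    rewrite inE mem_cat => /or3P[/eqP->|/ot//|/op//].
    by rewrite ov ov' rt_tmap hd_ptmap imset_set2.
  by rewrite mem_cat => /orP[/lt|/lp].
Qed.

Lemma root_decomp_verts N T : is_network N -> decomp N T -> is_root N (rt T) ->
  uniq (verts T) /\ nverts N =i verts T.
Proof.
move=> netN dT rT; have cnt := count_verts_network netN dT rT.
have E : nverts N =i verts T.
  by move=> z; rewrite -[RHS]has_pred1 has_count cnt; case: (z \in _).
by split=> //; apply: count_mem_uniq => z; rewrite cnt E.
Qed.

Definition has_term N (t : tm unit 'I_n) :=
  exists T, [/\ decomp N T, is_root N (rt T) & strip T = t].

Lemma has_term_iso N N' t : is_network N -> is_network N' ->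
  has_term N t -> has_term N' t -> net_iso N N'.
Proof.
move=> netN netN' [T [dT rT <-]] [T' [dT' rT' E]].
have [uT vT] := root_decomp_verts netN dT rT.
have [uT' vT'] := root_decomp_verts netN' dT' rT'.
have sz : size (verts T) = size (verts T').
  by rewrite -(size_verts_tmap (fun=> tt) id T) -E size_verts_tmap.
have [s Es] := uniq_seqs_perm uT uT' sz.
have ET : T' = tmap s id T.
  apply: (proj1 (strip_verts_inj _ _)); last by rewrite (proj1 (verts_tmap _ _)).
  by rewrite E (proj1 (tmap_comp _ _ _)).
rewrite ET in dT'; have [ho hl] := proj1 (decomp_tmap_out N N' s) _ dT dT'.
have sv u : (s u \in nverts N') = (u \in nverts N).
  by rewrite vT vT' -Es mem_map //; apply: perm_inj.
apply/net_isoP; exists s; split.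
- apply/setP => v; rewrite -(permKV s v) sv; apply/imsetP/idP => [[u uN /perm_inj ->]//|h].
  by exists (s^-1%g v).
- move=> u v; case: (boolP (u \in nverts N)) => uN.
    move: (uN); rewrite vT => /ho/setP/(_ (s v)); rewrite inE mem_imset ?inE //.
    exact: perm_inj.
  apply/idP/idP => /erel_nverts; first by move/(_ netN); rewrite (negPf uN).
  by move/(_ netN'); rewrite sv (negPf uN).
- move=> i; apply: hl.
  have /and3P[iN _ /eqP o0] : is_leaf N (nlab N i) by apply/(leafP netN); exists i.
  rewrite vT in iN; case: (proj1 (decomp_outdeg N) _ dT _ iN) => [||[_ [x xT]]]; rewrite ?o0 //.
  by move/(nlab_inj netN) ->.
Qed.

Lemma iso_has_term N N' t : net_iso N N' -> has_term N t -> has_term N' t.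
Proof.
case/net_isoP => s [h1 h2 h3] [T [dT rT <-]].
have ho u : out N' (s u) = s @: out N u.
  apply/setP => w; rewrite -(permKV s w) mem_imset; last exact: perm_inj.
  by rewrite !inE h2.
exists (tmap s id T); rewrite (proj1 (tmap_comp _ _ _)) rt_tmap.
split=> //; first exact: (proj1 (iso_decomp ho h3)).
case/and3P: rT => rN /eqP i0 /eqP o2; apply/and3P; split.
- by rewrite -h1 imset_f.
- rewrite /indeg; have -> : [set u | erel N' u (s (rt T))] = s @: [set u | erel N u (rt T)].
    apply/setP => w; rewrite -(permKV s w) mem_imset; last exact: perm_inj.
    by rewrite !inE h2.
  by rewrite card_imset; [apply/eqP|apply: perm_inj].
- rewrite /outdeg -/(out N' _) ho card_imset; last exact: perm_inj.
  by apply/eqP.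
Qed.

End Isomorphism.

Lemma allpairs_map2 (A B C A' B' : Type) (h : A' -> B' -> C) (f : A -> A') (g : B -> B') s t :
  [seq h a b | a <- map f s, b <- map g t] = [seq h (f a) (g b) | a <- s, b <- t].
Proof. by rewrite allpairs_mapl allpairs_mapr. Qed.

Lemma orb_tmap V V' L L' (f : V -> V') (g : L -> L') :
  (forall T, orb (tmap f g T) = map (tmap f g) (orb T)) /\
  (forall p, porb (ptmap f g p) = map (ptmap f g) (porb p)).
Proof.
apply: tm_pt_ind => //= [v l -> r ->|v c y x p -> q ->|v t -> p ->];
  by rewrite ?map_cat !map_allpairs !allpairs_map2.
Qed.

Lemma heights_tmap V V' L L' (f : V -> V') (g : L -> L') :
  (forall T, heights (tmap f g T) = [seq (g h.1, h.2) | h <- heights T]) /\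
  (forall p, pheights (ptmap f g p) = [seq (g h.1, h.2) | h <- pheights p]
             /\ plen (ptmap f g p) = plen p).
Proof.
apply: tm_pt_ind => //= [v l -> r ->|v c y x p [-> ->] q [-> ->]|v t -> p [-> ->]].
- by rewrite -!map_cat -!map_comp.
- by rewrite -!map_cat -!map_comp.
- by rewrite -!map_cat -!map_comp.
Qed.

Section OrbitLabels.
Variables (V : Type) (L : eqType).

Lemma orb_labels :
  (forall T T' : tm V L, T' \in orb T -> perm_eq (labels T') (labels T)) /\
  (forall p p' : pt V L, p' \in porb p -> perm_eq (plabels p') (plabels p)).
Proof.
apply: tm_pt_ind => /=.
- by move=> v x T'; rewrite inE => /eqP->.
- move=> v l IHl r IHr T'; rewrite mem_cat => /orP[] /allpairsP[[a b] /= [ha hb ->]] /=.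
    by apply: perm_cat; [apply: IHl|apply: IHr].
  by rewrite perm_catC; apply: perm_cat; [apply: IHl|apply: IHr].
- move=> v c y x p IHp q IHq T'.
  rewrite mem_cat => /orP[] /allpairsP[[a b] /= [ha hb ->]] /=; rewrite perm_cons.
    by apply: perm_cat; [apply: IHp|apply: IHq].
  by rewrite perm_catC; apply: perm_cat; [apply: IHp|apply: IHq].
- by move=> p'; rewrite inE => /eqP->.
- move=> v t IHt p IHp p' /allpairsP[[a b] /= [ha hb ->]] /=.
  by apply: perm_cat; [apply: IHt|apply: IHp].
Qed.

Lemma orb_wf :
  (forall T T' : tm V L, T' \in orb T -> wf T' = wf T) /\
  (forall p p' : pt V L, p' \in porb p -> pwf p' = pwf p /\ is_Pn p' = is_Pn p).
Proof.
apply: tm_pt_ind => /=.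
- by move=> v x T'; rewrite inE => /eqP->.
- move=> v l IHl r IHr T'; rewrite mem_cat => /orP[] /allpairsP[[a b] /= [ha hb ->]] /=;
    by rewrite (IHl _ ha) (IHr _ hb) // andbC.
- move=> v c y x p IHp q IHq T'; rewrite mem_cat => /orP[] /allpairsP[[a b] /= [ha hb ->]] /=;
    have [-> ->] := IHp _ ha; have [-> ->] := IHq _ hb => //.
  by rewrite (andbC (is_Pn q)) (andbC (pwf q)).
- by move=> p'; rewrite inE => /eqP->.
- move=> v t IHt p IHp p' /allpairsP[[a b] /= [ha hb ->]] /=.
  by rewrite (IHt _ ha) (IHp _ hb).1.
Qed.

Lemma orb_uniq :
  (forall T : tm V L, uniq (labels T) -> wf T -> uniq (orb T)) /\
  (forall p : pt V L, uniq (plabels p) -> pwf p -> uniq (porb p)).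
Proof.
have disj (s1 s2 : seq L) : uniq (s1 ++ s2) -> perm_eq s1 s2 -> s1 = [::].
  case: s1 => // x s1; rewrite cat_uniq => /and3P[_ /hasPn h _] /perm_mem E.
  by have := h x; rewrite -E inE eqxx /= => /(_ isT).
apply: tm_pt_ind => //=.
- move=> v l IHl r IHr U /andP[wl wr]; have := U; rewrite cat_uniq => /and3P[ul _ ur].
  rewrite cat_uniq !allpairs_uniq ?IHl ?IHr //=.
  + rewrite andbT; apply/hasPn => _ /allpairsP[[a b] /= [ha hb ->]].
    apply/negP => /allpairsP[[a' b'] /= [ha' hb' [E1 E2]]]; subst.
    have h : perm_eq (labels l) (labels r).
      apply: perm_trans (proj1 orb_labels _ _ hb).
      by rewrite perm_sym; apply: (proj1 orb_labels).
    by have := labels_gt0 l; rewrite (disj _ _ U h).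
  + by move=> [a b] [a' b'] _ _ /= [-> ->].
  + by move=> [a b] [a' b'] _ _ /= [-> ->].
- move=> v c y x p IHp q IHq /andP[_ U] /and3P[pq wp wq].
  have := U; rewrite cat_uniq => /and3P[up _ uq].
  rewrite cat_uniq !allpairs_uniq ?IHp ?IHq //=.
  + rewrite andbT; apply/hasPn => _ /allpairsP[[a b] /= [ha hb ->]].
    apply/negP => /allpairsP[[a' b'] /= [ha' hb' [E1 E2]]]; subst.
    have h : perm_eq (plabels p) (plabels q).
      apply: perm_trans (proj2 orb_labels _ _ hb).
      by rewrite perm_sym; apply: (proj2 orb_labels).
    have nil (r : pt V L) : plabels r = [::] -> is_Pn r.
      by case: r => //= v' t p' E; have := labels_gt0 t; case: (labels t) E.
    have p0 := disj _ _ U h.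
    by move: pq; rewrite !nil //; apply/perm_nilP; rewrite perm_sym -p0.
  + by move=> [a b] [a' b'] _ _ /= [-> ->].
  + by move=> [a b] [a' b'] _ _ /= [-> ->].
- move=> v t IHt p IHp; rewrite cat_uniq => /and3P[ut _ up] /andP[wt wp].
  rewrite allpairs_uniq ?IHt ?IHp //.
  by move=> [a b] [a' b'] _ _ /= [-> ->].
Qed.

End OrbitLabels.

Section Weight.
Import GRing.Theory Num.Theory.
Local Open Scope ring_scope.
Variables (R : numFieldType) (V L : Type).

Fixpoint weight (T : tm V L) : R :=
  match T with
  | Lf _ _ => 1
  | Nd _ l r => 2^-1 * (weight l * weight r)
  | Gl _ _ _ _ p q => 2^-1 * (pweight p * pweight q)
  end
with pweight (p : pt V L) : R :=
  if p is Pc _ t p' then weight t * pweight p' else 1.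

Lemma weight_orb :
  (forall T, \sum_(t <- orb T) weight t = 1) /\
  (forall p, \sum_(t <- porb p) pweight t = 1).
Proof.
have half : 2^-1 + 2^-1 = 1 :> R by field.
have prod (A B : Type) (s1 : seq A) (s2 : seq B) (f : A -> R) (g : B -> R) :
    \sum_(i <- s1) f i = 1 -> \sum_(i <- s2) g i = 1 ->
    \sum_(i <- s1) \sum_(j <- s2) f i * g j = 1.
  move=> h1 h2; under eq_bigr do rewrite -mulr_sumr h2 mulr1; exact: h1.
have scal (A B : Type) (s1 : seq A) (s2 : seq B) (f : A -> R) (g : B -> R) :
    \sum_(i <- s1) f i = 1 -> \sum_(i <- s2) g i = 1 ->
    \sum_(i <- s1) \sum_(j <- s2) 2^-1 * (f i * g j) = 2^-1.
  move=> h1 h2; under eq_bigr do rewrite -mulr_sumr.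
  by rewrite -mulr_sumr prod // mulr1.
have scalC (A B : Type) (s1 : seq A) (s2 : seq B) (f : A -> R) (g : B -> R) :
    \sum_(i <- s1) f i = 1 -> \sum_(i <- s2) g i = 1 ->
    \sum_(i <- s1) \sum_(j <- s2) 2^-1 * (g j * f i) = 2^-1.
  by move=> h1 h2; rewrite exchange_big scal.
apply: tm_pt_ind => /=.
- by move=> v x; rewrite big_seq1.
- by move=> v l IHl r IHr; rewrite big_cat !big_allpairs_dep /= scal // scalC.
- by move=> v c y x p IHp q IHq; rewrite big_cat !big_allpairs_dep /= scal // scalC.
- by rewrite big_seq1.
- by move=> v t IHt p IHp; rewrite big_allpairs_dep /= prod.
Qed.

End Weight.

Lemma bigminn_le (I : eqType) (r : seq I) (P : pred I) (F : I -> nat) x0 j :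
  j \in r -> P j -> \big[minn/x0]_(i <- r | P i) F i <= F j.
Proof.
elim: r => // a r IH; rewrite inE big_cons => /orP[/eqP<- ->|jr Pj].
  by rewrite geq_minl.
by case: ifP => _; last exact: IH; rewrite geq_min IH ?orbT.
Qed.

Section HeightSums.
Variables (n K : nat) (N : netT n K).
Hypothesis netN : is_network N.

Lemma label_perm T : decomp N T -> is_root N (rt T) -> perm_eq (labels T) (enum 'I_n).
Proof.
move=> dT rT; have [uT vT] := root_decomp_verts netN dT rT.
apply: uniq_perm; rewrite ?enum_uniq //.
  apply: (@map_uniq _ _ (nlab N)).
  apply: uniq_count_le uT => z; move: z T dT {rT vT}.
  suff H z : (forall T, decomp N T -> count_mem z (map (nlab N) (labels T)) <= count_mem z (verts T))
    /\ (forall p c, pdecomp N c p -> count_mem z (map (nlab N) (plabels p)) <= count_mem z (pverts p)).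
    by move=> z; exact: (proj1 (H z)).
  apply: tm_pt_ind => //=.
  - by move=> v x /andP[_ /eqP->].
  - move=> v l IHl r IHr /and4P[_ _ /IHl hl /IHr hr]; rewrite map_cat !count_cat; bool_lia.
  - move=> v c y x p IHp q IHq /and5P[_ _ _ /andP[_ /eqP->]] /andP[/IHp hp /IHq hq].
    rewrite map_cat !count_cat /=; bool_lia.
  - move=> v t IHt p IHp c /and4P[_ _ /IHt ht /IHp hp]; rewrite map_cat !count_cat; bool_lia.
move=> i; rewrite mem_enum.
have /and3P[iN _ /eqP o0] : is_leaf N (nlab N i) by apply/(leafP netN); exists i.
rewrite vT in iN; case: (proj1 (decomp_outdeg N) _ dT _ iN) => [||[_ [x xT]]]; rewrite ?o0 //.
by move/(nlab_inj netN) ->.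
Qed.

Lemma Splus_Sminus_term t : has_term N t ->
  Splus N = \sum_(h <- heights t) h.2.1 /\ Sminus N = \sum_(h <- heights t) h.2.2.
Proof.
case=> T [dT rT <-]; have [uT vT] := root_decomp_verts netN dT rT.
rewrite (proj1 (heights_tmap _ _)) !big_map /=.
have rootN : root_of N = Some (rt T).
  have [r _ Er] := network_root netN; rewrite /root_of; case: pickP => [v|/(_ (rt T))].
    by move: rT; rewrite !Er => /eqP-> /eqP->.
  by rewrite rT.
have sumE (F : 'I_n -> nat) : \sum_(i < n) F i = \sum_(h <- heights T) F h.1.
  have lp := label_perm dT rT; rewrite -(big_map fst xpredT F) (proj1 (labels_heights _ _)).
  apply: perm_big; apply: uniq_perm; rewrite ?index_enum_uniq ?(perm_uniq lp) ?enum_uniq //.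
  by move=> i; rewrite mem_index_enum (perm_mem lp) mem_enum.
have szT : size (verts T) <= K by rewrite -(card_uniqP uT) (leq_trans (max_card _)) ?card_ord.
rewrite /Splus /Sminus !sumE; split; apply: eq_big_seq => h hT;
  have [r1 r2 rb] := proj1 (decomp_heights N) _ dT uT _ hT;
  have ltM := leq_trans (proj1 (heights_size _ _) _ _ hT) szT;
  have ltm : h.2.2 < K by [apply: leq_ltn_trans ltM; case/andP: (rb _ r1)].
  rewrite /hmax rootN; apply/eqP; rewrite eqn_leq; apply/andP; split.
    by apply/bigmax_leqP => k /rb/andP[].
  exact: (@bigmax_sup _ (Ordinal ltM)).
rewrite /hmin rootN; apply/eqP; rewrite eqn_leq; apply/andP; split.
  by apply: (@bigminn_le _ _ _ (fun k : 'I_K => k : nat) K (Ordinal ltm)); rewrite ?mem_index_enum.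
apply: (big_ind (fun x => h.2.2 <= x)) => [|x y h1 h2|k /rb/andP[]//]; first exact: ltnW.
by rewrite leq_min h1 h2.
Qed.

End HeightSums.

Lemma term_exists n (t : tm unit 'I_n) : 1 < n -> wf t ->
  perm_eq (labels t) (enum 'I_n) ->
  exists2 N : netT n (Kn n), simplex_galled_tree N & has_term N t.
Proof.
move=> n1 wt lt.
have sz : size (labels t) = n by rewrite (perm_size lt) size_enum_ord.
have le : size (verts t) <= Kn n.
  by have := proj1 (size_verts_labels _ _) t; rewrite sz /Kn; lia.
have [|T ET Ev] := proj1 (decorate_exists 'I_(Kn n) 'I_n) t (take (size (verts t)) (enum 'I_(Kn n))).
  by rewrite size_takel // size_enum_ord.
have uT : uniq (verts T) by rewrite Ev take_uniq // enum_uniq.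
have wT : wf T by rewrite -(proj1 (wf_tmap (fun=> tt) id)) ET.
have lT : perm_eq (labels T) (enum 'I_n).
  by move: lt; rewrite -ET (proj1 (labels_tmap _ _)) map_id.
exists (net_of T); first exact: net_of_SGT.
by exists T; split=> //; [apply: net_of_decomp|apply: net_of_root].
Qed.

Lemma has_term_orb n K (N : netT n K) : simplex_galled_tree N ->
  exists t0, [/\ wf t0, perm_eq (labels t0) (enum 'I_n) &
                 forall t, has_term N t <-> t \in orb t0].
Proof.
move=> sgt; have netN : is_network N by case: sgt => -[].
have [T dT rT] := root_decomp_exists sgt; exists (strip T); split.
- by rewrite (proj1 (wf_tmap _ _)) (proj1 (decomp_wf N) _ dT).
- by rewrite (proj1 (labels_tmap _ _)) map_id (label_perm netN).
move=> t; rewrite (proj1 (orb_tmap _ _)); split.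
  case=> T' [dT' rT' <-]; apply: map_f.
  have [uT _] := root_decomp_verts netN dT rT; have [uT' _] := root_decomp_verts netN dT' rT'.
  apply: (proj1 (decomp_unique (nlab_inj netN))) => //.
  by have [r _ Er] := network_root netN; move: rT rT'; rewrite !Er => /eqP-> /eqP->.
case/mapP => T' T'T ->; exists T'.
by have [dT' ->] := proj1 (orb_decomp N) _ _ T'T dT.
Qed.

Section ClassSum.
Import GRing.Theory Num.Theory.
Local Open Scope ring_scope.

(* Every class is hit by the terms of one orbit, whose weights add up to 1. *)
Lemma class_sum (R : numFieldType) (n : nat) (G : netT n (Kn n) -> R)
    (F : tm unit 'I_n -> R) (terms : seq (tm unit 'I_n)) :
  (1 < n)%N -> uniq terms ->
  (forall t, (t \in terms) = wf t && perm_eq (labels t) (enum 'I_n)) ->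
  (forall N t, is_network N -> has_term N t -> G N = F t) ->
  \sum_(B in SGT_classes n) G (rep B) = \sum_(t <- terms) weight R t * F t.
Proof.
move=> n1 ut mt GF.
have SGTE N : (N \in SGT n) = boolp.asbool (simplex_galled_tree N) by rewrite inE.
have repB B : B \in SGT_classes n -> rep B \in B /\
    exists2 N, simplex_galled_tree N & B = [set N' in SGT n | net_iso N N'].
  case/imsetP => N NS ->; split; last by exists N => //; apply/boolp.asboolP; rewrite -SGTE.
  rewrite /rep; case: pickP => [//|/(_ N)].
  by rewrite inE NS net_iso_refl.
have repS B : B \in SGT_classes n -> simplex_galled_tree (rep B).
  by case/repB => + [N _ E]; rewrite {2}E inE SGTE => /andP[/boolp.asboolP].
have classE B N : B \in SGT_classes n -> simplex_galled_tree N ->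
    net_iso (rep B) N -> B = [set N' in SGT n | net_iso N N'].
  move=> BC sgt iso; have [rB [N0 _ E]] := repB _ BC; rewrite E; apply/setP => N'.
  have : net_iso N0 (rep B) by move: rB; rewrite {2}E inE => /andP[].
  move=> i0; rewrite !inE; congr (_ && _); apply/idP/idP => h.
    apply: net_iso_trans h; apply: net_iso_sym.
    exact: net_iso_trans iso.
  by apply: net_iso_trans h; apply: net_iso_trans iso.
pose ht (B : {set netT n (Kn n)}) t := boolp.asbool (has_term (rep B) t).
transitivity (\sum_(B in SGT_classes n) \sum_(t <- terms | ht B t) weight R t * F t).
  apply: eq_bigr => B BC; have sgt := repS _ BC.
  have netB : is_network (rep B) by case: sgt => -[].
  have [t0 [w0 l0 ho]] := has_term_orb sgt.
  have uo : uniq (orb t0).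
    by apply: (proj1 (orb_uniq _ _)) => //; rewrite (perm_uniq l0) enum_uniq.
  have E : perm_eq [seq t <- terms | ht B t] (orb t0).
    apply: uniq_perm => //; first exact: filter_uniq.
    move=> t; rewrite mem_filter; apply/andP/idP => [[/boolp.asboolP/ho //]|tO].
    split; first exact/boolp.asboolP/ho.
    rewrite mt (proj1 (orb_wf _ _) _ _ tO) w0 /=.
    exact: perm_trans (proj1 (orb_labels _ _) _ _ tO) l0.
  rewrite -big_filter (perm_big _ E) /=.
  under eq_big_seq => t tO do rewrite -(GF (rep B) t netB (proj2 (ho t) tO)).
  by rewrite -mulr_suml (proj1 (weight_orb R _ _)) mul1r.
rewrite (exchange_big_dep xpredT) //=; apply: eq_big_seq => t.
rewrite mt => /andP[wt lt].
have [N sgt hN] := term_exists n1 wt lt.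
have netN : is_network N by case: sgt => -[].
pose B0 := [set N' in SGT n | net_iso N N'].
have B0C : B0 \in SGT_classes n.
  by apply: imset_f; rewrite SGTE; apply/boolp.asboolP.
rewrite (big_pred1 B0) // => B; apply/andP/eqP => [[BC /boolp.asboolP hB]|->].
  apply: classE => //; apply: has_term_iso hB hN => //.
  by case: (repS _ BC) => -[].
split=> //; apply/boolp.asboolP; apply: iso_has_term hN.
by have [+ _] := repB _ B0C; rewrite inE => /andP[].
Qed.

End ClassSum.

Import Order.TTheory GRing.Theory Num.Theory.
Local Open Scope ring_scope.

(** * Formal power series *)

Definition fps (R : Type) : Type := nat -> R.

HB.instance Definition _ (R : Type) := boolp.gen_eqMixin (fps R).
HB.instance Definition _ (R : Type) := boolp.gen_choiceMixin (fps R).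

Section FormalSeries.
Variable R : comNzRingType.
Implicit Types f g h : fps R.

Definition fps_mul f g : fps R := fun n => \sum_(i < n.+1) f i * g (n - i)%N.
Definition fps_one : fps R := fun n => (n == 0%N)%:R.

Let fps_addA : associative (fun f g : fps R => (fun n => f n + g n) : fps R).
Proof. by move=> f g h; apply/boolp.funext => n; rewrite addrA. Qed.
Let fps_addC : commutative (fun f g : fps R => (fun n => f n + g n) : fps R).
Proof. by move=> f g; apply/boolp.funext => n; rewrite addrC. Qed.
Let fps_add0 : left_id (fun=> 0) (fun f g : fps R => (fun n => f n + g n) : fps R).
Proof. by move=> f; apply/boolp.funext => n; rewrite add0r. Qed.
Let fps_addN : left_inverse (fun=> 0) (fun f : fps R => (fun n => - f n) : fps R)
  (fun f g : fps R => (fun n => f n + g n) : fps R).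
Proof. by move=> f; apply/boolp.funext => n; rewrite addNr. Qed.

HB.instance Definition _ := GRing.isZmodule.Build (fps R) fps_addA fps_addC fps_add0 fps_addN.

Lemma fps_mul_poly f g n m : (n < m)%N ->
  fps_mul f g n = (\poly_(i < m) f i * \poly_(i < m) g i)`_n.
Proof.
move=> nm; rewrite coefM; apply: eq_bigr => i _; rewrite !coef_poly.
by rewrite (leq_ltn_trans (leq_ord i) nm) (leq_ltn_trans (leq_subr _ _) nm).
Qed.

Let fps_mulC : commutative fps_mul.
Proof. by move=> f g; apply/boolp.funext => n; rewrite !(fps_mul_poly _ _ (ltnSn n)) mulrC. Qed.

Let fps_mulA : associative fps_mul.
Proof.
have H f g h n : fps_mul f (fps_mul g h) n =
    (\poly_(i < n.+1) f i * (\poly_(i < n.+1) g i * \poly_(i < n.+1) h i))`_n.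
  rewrite coefM; apply: eq_bigr => i _.
  by rewrite coef_poly ltn_ord (@fps_mul_poly _ _ _ n.+1) // ltnS leq_subr.
move=> f g h; apply/boolp.funext => n.
by rewrite H [RHS]/= (fps_mulC (fps_mul f g)) H mulrA mulrC.
Qed.

Let fps_mul1 : left_id fps_one fps_mul.
Proof.
move=> f; apply/boolp.funext => n; rewrite /fps_mul big_ord_recl /= mul1r subn0 big1 ?addr0 //.
by move=> i _; rewrite mul0r.
Qed.

Let fps_mulDl : left_distributive fps_mul +%R.
Proof.
move=> f g h; apply/boolp.funext => n; transitivity (fps_mul f h n + fps_mul g h n) => //.
rewrite /fps_mul -big_split /=.
by apply: eq_bigr => i _; rewrite mulrDl.
Qed.

Let fps_1neq0 : fps_one != 0.
Proof. by apply/eqP => /(congr1 (fun f => f 0%N)) /eqP; rewrite oner_eq0. Qed.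

HB.instance Definition _ := GRing.Zmodule_isComNzRing.Build (fps R)
  fps_mulA fps_mulC fps_mul1 fps_mulDl fps_1neq0.

Lemma coefpsD f g n : (f + g) n = f n + g n. Proof. by []. Qed.
Lemma coefpsN f n : (- f) n = - f n. Proof. by []. Qed.
Lemma coefpsB f g n : (f - g) n = f n - g n. Proof. by []. Qed.
Lemma coefps1 n : (1 : fps R) n = (n == 0%N)%:R. Proof. by []. Qed.
Lemma coefpsM f g n : (f * g) n = \sum_(i < n.+1) f i * g (n - i)%N. Proof. by []. Qed.
Lemma coefpsMn f k n : (f *+ k) n = f n *+ k.
Proof. by elim: k => // k IH; rewrite !mulrS coefpsD IH. Qed.

Definition fpsX : fps R := fun n => (n == 1%N)%:R.

Lemma coefpsXM f n : (fpsX * f) n = if n is n'.+1 then f n' else 0.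
Proof.
rewrite coefpsM; case: n => [|n]; first by rewrite big_ord1 mul0r.
rewrite big_ord_recl /= mul0r add0r big_ord_recl /= mul1r subSS subn0.
by rewrite big1 ?addr0 // => i _; rewrite mul0r.
Qed.

Definition fpsC (c : R) : fps R := fun n => if n is _.+1 then 0 else c.

Lemma coefpsCM c f n : (fpsC c * f) n = c * f n.
Proof.
by rewrite coefpsM big_ord_recl /= subn0 big1 ?addr0 // => i _; rewrite mul0r.
Qed.

Lemma fpsCM c d : fpsC c * fpsC d = fpsC (c * d).
Proof. by apply/boolp.funext => -[|n]; rewrite coefpsCM //= mulr0. Qed.

Lemma fpsCD c d : fpsC c + fpsC d = fpsC (c + d).
Proof. by apply/boolp.funext => -[|n]; rewrite coefpsD //= addr0. Qed.

Lemma fpsC1 : fpsC 1 = 1. Proof. by apply/boolp.funext => -[|n]. Qed.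

(* z d/dz, not d/dz *)
Definition fpsD f : fps R := fun n => f n *+ n.

Lemma fpsDM f g : fpsD (f * g) = fpsD f * g + f * fpsD g.
Proof.
apply/boolp.funext => n; rewrite coefpsD /fpsD !coefpsM -big_split /= -sumrMnl.
apply: eq_bigr => i _; rewrite mulrnAl mulrnAr -mulrnDr subnKC // -ltnS.
exact: ltn_ord.
Qed.

Lemma fpsDD f g : fpsD (f + g) = fpsD f + fpsD g.
Proof. by apply/boolp.funext => n; rewrite !coefpsD /fpsD mulrnDl. Qed.

Lemma fpsDX : fpsD fpsX = fpsX.
Proof. by apply/boolp.funext => -[|[|n]] //; rewrite /fpsD /fpsX /= mul0rn. Qed.

Lemma fpsD1 : fpsD 1 = 0.
Proof. by apply/boolp.funext => -[|n]; rewrite /fpsD coefps1 ?mul0rn. Qed.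

Definition fpsS (c : R) f : fps R := fun n => f n * c ^+ n.

Lemma fpsSM c f g : fpsS c (f * g) = fpsS c f * fpsS c g.
Proof.
apply/boolp.funext => n; rewrite /fpsS !coefpsM mulr_suml; apply: eq_bigr => i _.
by rewrite mulrACA -exprD subnKC // -ltnS ltn_ord.
Qed.

Lemma fpsSD c f g : fpsS c (f + g) = fpsS c f + fpsS c g.
Proof. by apply/boolp.funext => n; rewrite /fpsS !coefpsD mulrDl. Qed.

Lemma fpsSB c f g : fpsS c (f - g) = fpsS c f - fpsS c g.
Proof. by apply/boolp.funext => n; rewrite /fpsS !coefpsB mulrBl. Qed.

Lemma fpsS1 c : fpsS c 1 = 1.
Proof. by apply/boolp.funext => -[|n]; rewrite /fpsS coefps1 ?mulr1 ?mul0r. Qed.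

Lemma fpsSX c : fpsS c fpsX = fpsC c * fpsX.
Proof.
apply/boolp.funext => n; rewrite coefpsCM /fpsS /fpsX.
by case: n => [|[|n]]; rewrite ?expr1 ?mul1r ?mulr1 ?mul0r ?mulr0.
Qed.

End FormalSeries.

Arguments fpsX {R}.

Lemma fps_mul_eq0 (R : idomainType) (f g : fps R) : g 0%N != 0 -> f * g = 0 -> f = 0.
Proof.
move=> g0 E; apply/boolp.funext => n; elim/ltn_ind: n => n IH.
have := congr1 (fun h : fps R => h n) E; rewrite coefpsM big_ord_recr /= big1.
  by rewrite add0r subnn => /eqP; rewrite mulf_eq0 (negPf g0) orbF => /eqP.
by move=> i _; rewrite IH ?mul0r.
Qed.

Lemma eq_by_cofactor (R : pzRingType) (k a b l r : R) :
  a = b -> l - r = k * (a - b) -> l = r.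
Proof. by move=> ->; rewrite subrr mulr0; apply: subr0_eq. Qed.

(** * Algebra of the generating functions *)

Section GeneratingFunctions.
Variable R : realFieldType.
Variables A B P PB G : fps R.
Local Notation z := (fpsX : fps R).
Local Notation M := (fpsD A).
Hypothesis hA : A *+ 2 = z + A * A + z * (B * B).
Hypothesis hB : B = 1 + A * B.
Local Notation w := (1 - A).
Local Notation u := (w * w).
Local Notation Y := (u *+ 2 - 1 + z).

Let wB : w * B = 1.
Proof. by rewrite mulrBl mul1r {1}hB addrK. Qed.

Lemma u_equation : u * u + (z - 1) * u + z = 0.
Proof.
have E : 1 - u = z * (1 + B * B) by apply: (eq_by_cofactor (k := 1) hA); ring.
have uB : u * (B * B) = 1 by rewrite mulrACA wB mulr1.
have E2 : u * (1 - u) = z * (u + 1) by rewrite E; apply: (eq_by_cofactor (k := z) uB); ring.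
by apply: (eq_by_cofactor (k := - 1) E2); ring.
Qed.

Lemma Y_sq : Y * Y = 1 - z *+ 6 + z * z.
Proof. by apply: (eq_by_cofactor (k := 4%:R) u_equation); ring. Qed.

Let zBB : z * (B * B) = 1 - u - z.
Proof. by apply: (eq_by_cofactor (k := - 1) hA); ring. Qed.

Let fac : w * (w - z * (B * B * B)) = Y.
Proof.
have -> : w * (w - z * (B * B * B)) = u - z * (B * B) * (w * B) by ring.
by rewrite wB mulr1 zBB; ring.
Qed.

Let DB : fpsD B = M * (B * B).
Proof.
have : fpsD B = M * B + A * fpsD B by rewrite {1}hB fpsDD fpsD1 add0r fpsDM.
move=> h; have : w * fpsD B = M * B by apply: (eq_by_cofactor (k := 1) h); ring.
move=> h2; have -> : fpsD B = B * (w * fpsD B) by rewrite mulrA (mulrC B) wB mul1r.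
by rewrite h2; ring.
Qed.

Lemma M_Y : (M * Y) *+ 2 = z * (w + B).
Proof.
have h : M *+ 2 = z + A * M *+ 2 + z * (B * B) + z * (B * fpsD B) *+ 2.
  have := congr1 (@fpsD R) hA; rewrite !mulr2n !fpsDD !fpsDM fpsDX => ->; ring.
rewrite DB in h; rewrite -fac.
have -> : M * (w * (w - z * (B * B * B))) *+ 2
  = w * (M *+ 2 - A * M *+ 2 - z * (B * (M * (B * B))) *+ 2) by ring.
by rewrite {1}h; apply: (eq_by_cofactor (k := z * B) wB); ring.
Qed.

Hypothesis hPB : PB = (P + M) * B + A * (PB + fpsD B).
Hypothesis hP : P *+ 2 = A * (P + M) *+ 2 + z * ((PB + fpsD B) * B *+ 2 + G).

Lemma P_Delta : (P * (1 - z *+ 6 + z * z)) *+ 2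
  = z * (u + 1) * (A + z * (B * B * B * B) + z * (B * B * B)) + z * (w * (Y * G)).
Proof.
have AB : A * B = B - 1 by rewrite {2}hB; ring.
have E1 : PB + fpsD B = P * (B * B) + M * (B * B * B + B * B).
  have h : w * PB = (P + M) * B + A * fpsD B by apply: (eq_by_cofactor (k := 1) hPB); ring.
  have -> : PB = B * (w * PB) by rewrite mulrA (mulrC B) wB mul1r.
  by rewrite h DB; apply: (eq_by_cofactor (k := M * (B * B)) AB); ring.
have E2 : (P * Y) *+ 2
    = (w * M * (A + z * (B * B * B * B) + z * (B * B * B))) *+ 2 + w * (z * G).
  rewrite -fac.
  have -> : P * (w * (w - z * (B * B * B))) *+ 2
    = w * (P *+ 2 - A * P *+ 2 - z * (B * B * B) * P *+ 2) by ring.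
  by rewrite {1}hP E1; ring.
have -> : (P * (1 - z *+ 6 + z * z)) *+ 2 = Y * (P * Y *+ 2) by rewrite -Y_sq; ring.
rewrite E2.
have -> : Y * (w * M * (A + z * (B * B * B * B) + z * (B * B * B)) *+ 2 + w * (z * G))
  = w * (M * Y *+ 2) * (A + z * (B * B * B * B) + z * (B * B * B)) + z * (w * (Y * G)) by ring.
rewrite M_Y; apply: (eq_by_cofactor (k := z * (A + z * (B * B * B * B) + z * (B * B * B))) wB).
ring.
Qed.

End GeneratingFunctions.

Local Close Scope ring_scope.

(** * Enumeration of the terms *)

Notation shape := (tmap (fun=> tt) (fun=> tt)).
Notation pshape := (ptmap (fun=> tt) (fun=> tt)).

Fixpoint enum_tm (f n : nat) : seq (tm unit unit) :=
  if f is f'.+1 then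
    (if n == 1 then [:: Lf tt tt] else [::]) ++
    flatten [seq [seq Nd tt l r | l <- enum_tm f' i, r <- enum_tm f' (n - i)]
            | i <- iota 0 n.+1] ++
    (if n is n'.+1 then
       [seq T <- flatten [seq [seq Gl tt tt tt tt p q | p <- enum_pt f' i,
                                                        q <- enum_pt f' (n' - i)]
                         | i <- iota 0 n] | wf T] else [::])
  else [::]
with enum_pt (f n : nat) : seq (pt unit unit) :=
  if f is f'.+1 then
    (if n == 0 then [:: Pn] else [::]) ++
    flatten [seq [seq Pc tt t p | t <- enum_tm f' i, p <- enum_pt f' (n - i)]
            | i <- iota 0 n.+1]
  else [::].

Lemma enum_tmS f n : enum_tm f.+1 n =
  (if n == 1 then [:: Lf tt tt] else [::]) ++
  flatten [seq [seq Nd tt l r | l <- enum_tm f i, r <- enum_tm f (n - i)]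
          | i <- iota 0 n.+1] ++
  (if n is n'.+1 then
     [seq T <- flatten [seq [seq Gl tt tt tt tt p q | p <- enum_pt f i,
                                                      q <- enum_pt f (n' - i)]
                       | i <- iota 0 n] | wf T] else [::]).
Proof. by []. Qed.

Lemma enum_ptS f n : enum_pt f.+1 n =
  (if n == 0 then [:: Pn] else [::]) ++
  flatten [seq [seq Pc tt t p | t <- enum_tm f i, p <- enum_pt f (n - i)]
          | i <- iota 0 n.+1].
Proof. by []. Qed.

Fixpoint depth (T : tm unit unit) : nat :=
  match T with
  | Lf _ _ => 1
  | Nd _ l r => (maxn (depth l) (depth r)).+1
  | Gl _ _ _ _ p q => (maxn (pdepth p) (pdepth q)).+1
  end
with pdepth (p : pt unit unit) : nat :=
  if p is Pc _ t p' then (maxn (depth t) (pdepth p')).+1 else 1.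

Lemma mem_flatten_pairs (A B C : eqType) (h : A -> B -> C) (s1 : nat -> seq A)
    (s2 : nat -> seq B) m x :
  (x \in flatten [seq [seq h a b | a <- s1 i, b <- s2 (m - i)] | i <- iota 0 m.+1]) <->
  exists a b i, [/\ i <= m, a \in s1 i, b \in s2 (m - i) & x = h a b].
Proof.
split.
  case/flattenP => s /mapP[i]; rewrite mem_iota ltnS /= => im ->.
  by case/allpairsP => -[a b] /= [ha hb ->]; exists a, b, i.
case=> a [b [i [im ha hb ->]]]; apply/flattenP.
exists [seq h a b | a <- s1 i, b <- s2 (m - i)]; last exact: allpairs_f.
by apply/mapP; exists i; rewrite ?mem_iota.
Qed.

Lemma mem_enum_tm f :
  (forall n t, (t \in enum_tm f n) = [&& wf t, size (labels t) == n & depth t <= f]) /\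
  (forall n p, (p \in enum_pt f n) = [&& pwf p, size (plabels p) == n & pdepth p <= f]).
Proof.
elim: f => [|f [IHt IHp]].
  by split=> n; case=> * /=; rewrite ?ltn0 ?andbF.
split=> n t; apply/idP/idP.
- rewrite enum_tmS 2!mem_cat => /or3P[|/mem_flatten_pairs|].
  + by case: eqP => // ->; rewrite inE => /eqP->.
  + case=> l [r [i [im hl hr ->]]] /=; move: hl hr; rewrite !IHt size_cat ltnS geq_max.
    by case/and3P => -> /eqP-> -> /and3P[-> /eqP-> ->]; rewrite subnKC ?eqxx.
  + case: n => [//|n]; rewrite mem_filter => /andP[wt /mem_flatten_pairs].
    case=> p [q [i [im hp hq E]]]; rewrite wt; subst t; move: hp hq => /=.
    rewrite !IHp size_cat ltnS geq_max.
    by case/and3P => _ /eqP-> -> /and3P[_ /eqP-> ->]; rewrite subnKC ?eqxx.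
- rewrite enum_tmS 2!mem_cat; case: t => [[] []|[] l r|[] [] [] [] p q] /=.
  + by case/andP => /eqP<- _; rewrite inE eqxx.
  + rewrite size_cat ltnS geq_max => /and3P[/andP[wl wr] /eqP<- /andP[dl dr]].
    apply/or3P/Or32/mem_flatten_pairs; exists l, r, (size (labels l)).
    by rewrite !IHt wl wr dl dr leq_addr addKn !eqxx.
  + rewrite size_cat ltnS geq_max => /and3P[w /eqP<- /andP[dp dq]].
    apply/or3P/Or33; rewrite mem_filter [wf _]/= w; apply/mem_flatten_pairs.
    exists p, q, (size (plabels p)); case/and3P: w => _ wp wq.
    by rewrite !IHp wp wq dp dq leq_addr addKn !eqxx.
- rewrite enum_ptS mem_cat => /orP[|/mem_flatten_pairs].
  + by case: eqP => // ->; rewrite inE => /eqP->.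
  + case=> a [b [i [im hl hr ->]]] /=; move: hl hr; rewrite IHt IHp size_cat ltnS geq_max.
    by case/and3P => -> /eqP-> -> /and3P[-> /eqP-> ->]; rewrite subnKC ?eqxx.
- rewrite enum_ptS mem_cat; case: t => [|[] t p] /=.
  + by case/andP => /eqP<- _; rewrite inE eqxx.
  + rewrite size_cat ltnS geq_max => /and3P[/andP[wl wr] /eqP<- /andP[dl dr]].
    apply/orP; right; apply/mem_flatten_pairs; exists t, p, (size (labels t)).
    by rewrite IHt IHp wl wr dl dr leq_addr addKn !eqxx.
Qed.

Lemma uniq_flatten_pairs (A B C : eqType) (h : A -> B -> C) (s1 : nat -> seq A)
    (s2 : nat -> seq B) (sz : A -> nat) m :
  (forall a b a' b', h a b = h a' b' -> a = a' /\ b = b') ->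
  (forall i, uniq (s1 i)) -> (forall i, uniq (s2 i)) ->
  (forall i a, a \in s1 i -> sz a = i) ->
  uniq (flatten [seq [seq h a b | a <- s1 i, b <- s2 (m - i)] | i <- iota 0 m.+1]).
Proof.
move=> inj u1 u2 hsz; move: (iota_uniq 0 m.+1); elim: (iota 0 m.+1) => //= j s IH.
case/andP => js us; rewrite cat_uniq IH // andbT allpairs_uniq //=; last first.
  by move=> [a b] [a' b'] _ _ /= /inj[-> ->].
apply/hasPn => x /flattenP[t /mapP[i is_ ->]] /allpairsP[[a b] /= [ha _ ->]].
apply/negP => /allpairsP[[a' b'] /= [ha' _ /inj[E _]]].
by move: js; rewrite -(hsz _ _ ha') -E (hsz _ _ ha) is_.
Qed.

Lemma enum_tm_uniq f : (forall n, uniq (enum_tm f n)) /\ (forall n, uniq (enum_pt f n)).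
Proof.
elim: f => [|f [IHt IHp]]; first by [].
have szt i t : t \in enum_tm f i -> size (labels t) = i.
  by rewrite (proj1 (mem_enum_tm f)) => /and3P[_ /eqP].
have szp i p : p \in enum_pt f i -> size (plabels p) = i.
  by rewrite (proj2 (mem_enum_tm f)) => /and3P[_ /eqP].
split=> n.
- rewrite enum_tmS cat_uniq; apply/and3P; split; first by case: eqP.
    apply/hasPn => x; rewrite mem_cat => /orP[/mem_flatten_pairs[a [b [i [_ _ _ ->]]]]|].
      by case: eqP => // _; rewrite inE; apply/eqP.
    case: n => // n; rewrite mem_filter => /andP[_ /mem_flatten_pairs[a [b [i [_ _ _ ->]]]]].
    by case: eqP => // _; rewrite inE; apply/eqP.
  rewrite cat_uniq; apply/and3P; split.
  + by apply: (@uniq_flatten_pairs _ _ _ (Nd tt) (enum_tm f) (enum_tm f) (fun t => size (labels t)) n) => // a b a' b' [].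
  + apply/hasPn => x; case: n => // n.
    rewrite mem_filter => /andP[_ /mem_flatten_pairs[a [b [i [_ _ _ ->]]]]].
    by apply/negP => /mem_flatten_pairs[a' [b' [i' [_ _ _]]]].
  + case: n => // n; apply: filter_uniq.
    by apply: (@uniq_flatten_pairs _ _ _ (Gl tt tt tt tt) (enum_pt f) (enum_pt f) (fun t => size (plabels t)) n) => // a b a' b' [].
- rewrite enum_ptS cat_uniq; apply/and3P; split; first by case: eqP.
    apply/hasPn => x /mem_flatten_pairs[a [b [i [_ _ _ ->]]]].
    by case: eqP => // _; rewrite inE; apply/eqP.
  by apply: (@uniq_flatten_pairs _ _ _ (Pc tt) (enum_tm f) (enum_pt f) (fun t => size (labels t)) n) => // a b a' b' [].
Qed.

Lemma depth_labels :
  (forall t, depth t <= (size (labels t)).*2) /\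
  (forall p, pdepth p <= (size (plabels p)).*2.+1).
Proof.
apply: tm_pt_ind => //= [v l IHl r IHr|v c y x p IHp q IHq|v t IHt p IHp];
  rewrite !size_cat ?gtn_max; try lia.
by have := labels_gt0 l; have := labels_gt0 r; lia.
by have := labels_gt0 t; lia.
Qed.

Definition shapes n := enum_tm n.*2.+2 n.
Definition pshapes n := enum_pt n.*2.+2 n.

Lemma mem_shapes n t : (t \in shapes n) = wf t && (size (labels t) == n).
Proof.
rewrite (proj1 (mem_enum_tm _)); case: eqP => [<-|]; rewrite ?andbF //.
by case: (wf t) => //=; have := proj1 depth_labels t; lia.
Qed.

Lemma mem_pshapes n p : (p \in pshapes n) = pwf p && (size (plabels p) == n).
Proof.
rewrite (proj2 (mem_enum_tm _)); case: eqP => [<-|]; rewrite ?andbF //.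
by case: (pwf p) => //=; have := proj2 depth_labels p; lia.
Qed.

Lemma shapes_uniq n : uniq (shapes n). Proof. exact: (proj1 (enum_tm_uniq _)). Qed.

Lemma enum_tm_shapes f n : n.*2 < f -> perm_eq (enum_tm f n) (shapes n).
Proof.
move=> nf; apply: uniq_perm; rewrite ?shapes_uniq ?(proj1 (enum_tm_uniq _)) // => t.
rewrite mem_shapes (proj1 (mem_enum_tm _)); case: eqP => [E|]; rewrite ?andbF //.
by case: (wf t) => //=; have := proj1 depth_labels t; lia.
Qed.

Lemma enum_pt_pshapes f n : n.*2 < f -> perm_eq (enum_pt f n) (pshapes n).
Proof.
move=> nf; apply: uniq_perm; rewrite ?(proj2 (enum_tm_uniq _)) // => t.
rewrite mem_pshapes (proj2 (mem_enum_tm _)); case: eqP => [E|]; rewrite ?andbF //.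
by case: (pwf t) => //=; have := proj2 depth_labels t; lia.
Qed.

Section ShapeSums.
Local Open Scope ring_scope.
Variable R : numFieldType.
Implicit Types (phi : tm unit unit -> R) (psi : pt unit unit -> R).

Definition tsum phi : fps R := fun n => \sum_(t <- shapes n) phi t.
Definition psum psi : fps R := fun n => \sum_(p <- pshapes n) psi p.

Lemma big_flatten_pairs (A B C : Type) (h : A -> B -> C) (s1 : nat -> seq A)
    (s2 : nat -> seq B) m (F : C -> R) :
  \sum_(x <- flatten [seq [seq h a b | a <- s1 i, b <- s2 (m - i)%N] | i <- iota 0 m.+1]) F x
  = \sum_(i < m.+1) \sum_(a <- s1 i) \sum_(b <- s2 (m - i)%N) F (h a b).
Proof.
rewrite big_flatten big_map -[iota 0 m.+1]/(index_iota 0 m.+1) big_mkord.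
by apply: eq_bigr => i _; rewrite big_allpairs_dep.
Qed.

Lemma tsum_rec phi n : tsum phi n = (n == 1%N)%:R * phi (Lf tt tt)
  + \sum_(i < n.+1) \sum_(l <- shapes i) \sum_(r <- shapes (n - i)) phi (Nd tt l r)
  + (if n is n'.+1 then \sum_(i < n) \sum_(p <- pshapes i) \sum_(q <- pshapes (n' - i))
       (if is_Pn p && is_Pn q then 0 else phi (Gl tt tt tt tt p q)) else 0).
Proof.
rewrite /tsum {1}/shapes enum_tmS 2!big_cat -!addrA; congr (_ + _).
  by case: eqP => _; rewrite ?big_seq1 ?big_nil ?mul1r ?mul0r.
congr (_ + _).
  rewrite big_flatten_pairs; apply: eq_bigr => i _.
  have i1 := ltn_ord i.
  rewrite (perm_big _ (@enum_tm_shapes _ i _)); last by lia.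
  by apply: eq_bigr => t _; rewrite (perm_big _ (@enum_tm_shapes _ (n - i) _)) //; lia.
case: n => [|n]; rewrite ?big_nil // big_filter big_mkcond big_flatten_pairs.
apply: eq_bigr => i _; have i1 := ltn_ord i.
rewrite (perm_big _ (@enum_pt_pshapes _ i _)); last by lia.
apply: eq_big_seq => p; rewrite mem_pshapes => /andP[wp _].
rewrite (perm_big _ (@enum_pt_pshapes _ (n - i) _)); last by lia.
apply: eq_big_seq => q; rewrite mem_pshapes => /andP[wq _].
by rewrite /= wp wq; case: (is_Pn p && is_Pn q).
Qed.

Lemma psum_rec psi n : psum psi n = (n == 0%N)%:R * psi Pn
  + \sum_(i < n.+1) \sum_(t <- shapes i) \sum_(p <- pshapes (n - i)) psi (Pc tt t p).
Proof.
rewrite /psum {1}/pshapes enum_ptS big_cat; congr (_ + _).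
  by case: eqP => _; rewrite ?big_seq1 ?big_nil ?mul1r ?mul0r.
rewrite big_flatten_pairs; apply: eq_bigr => i _.
have i1 := ltn_ord i.
rewrite (perm_big _ (@enum_tm_shapes _ i _)); last by lia.
by apply: eq_bigr => t _; rewrite (perm_big _ (@enum_pt_pshapes _ (n - i) _)) //; lia.
Qed.

Lemma conv_sum (A B : Type) (s1 : nat -> seq A) (s2 : nat -> seq B) (f : A -> R) (g : B -> R) n :
  \sum_(i < n.+1) \sum_(a <- s1 i) \sum_(b <- s2 (n - i)%N) f a * g b
  = (((fun k => \sum_(a <- s1 k) f a) : fps R) * ((fun k => \sum_(b <- s2 k) g b) : fps R)) n.
Proof.
rewrite coefpsM; apply: eq_bigr => i _; rewrite mulr_suml; apply: eq_bigr => a _.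
by rewrite mulr_sumr.
Qed.

Local Notation W := (weight R (V := unit) (L := unit)).
Local Notation PW := (pweight R (V := unit) (L := unit)).
Local Notation half := (2^-1 : R).
Local Notation z := (fpsX : fps R).

Definition gfA : fps R := tsum W.
Definition gfB : fps R := psum PW.

Lemma gfB_rec : gfB = 1 + gfA * gfB.
Proof.
apply/boolp.funext => n; rewrite coefpsD coefps1 /gfB psum_rec /= mulr1; congr (_ + _).
exact: conv_sum.
Qed.

Lemma half2 : half *+ 2 = 1.
Proof. by rewrite -[LHS]mulr_natr mulVf // pnatr_eq0. Qed.

Lemma psum_is_Pn : psum (fun p => (is_Pn p)%:R) = 1.
Proof.
apply/boolp.funext => n; rewrite coefps1 psum_rec /= mulr1 big1 ?addr0 // => i _.
by rewrite big1 // => t _; rewrite big1.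
Qed.

Lemma gfA_rec : gfA *+ 2 = z + gfA * gfA + z * (gfB * gfB).
Proof.
have E : gfA *+ 2 = z *+ 2 + gfA * gfA + z * (gfB * gfB - 1); last first.
  by rewrite E; ring.
apply/boolp.funext => n; rewrite !coefpsD !coefpsMn coefpsXM {1}/gfA tsum_rec /= mulr1.
rewrite !mulrnDl; congr (_ + _ + _).
  rewrite -sumrMnl -conv_sum; apply: eq_bigr => i _; rewrite -sumrMnl; apply: eq_bigr => l _.
  by rewrite -sumrMnl; apply: eq_bigr => r _; rewrite -mulrnAl half2 mul1r.
case: n => [|n]; first by rewrite mul0rn.
have -> : (gfB * gfB - 1) n = (gfB * gfB) n
    - (psum (fun p => (is_Pn p)%:R) * psum (fun p => (is_Pn p)%:R)) n.
  by rewrite psum_is_Pn mulr1.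
rewrite -!conv_sum.
rewrite -sumrMnl -sumrB; apply: eq_bigr => i _.
rewrite -sumrMnl -sumrB; apply: eq_bigr => p _.
rewrite -sumrMnl -sumrB; apply: eq_bigr => q _.
case: p => [|? ? ?]; case: q => [|? ? ?]; rewrite /is_Pn [_ && _]/=.
- by rewrite mul0rn !mulr1 subrr.
- by rewrite -mulrnAl half2 mul1r ?mulr0n mulr0 subr0.
- by rewrite -mulrnAl half2 mul1r ?mulr0n mul0r subr0.
- by rewrite -mulrnAl half2 mul1r ?mulr0n mul0r subr0.
Qed.

Lemma tsum_size phi : tsum (fun t => phi t *+ size (labels t)) = fpsD (tsum phi).
Proof.
apply/boolp.funext => n; rewrite /fpsD /tsum -sumrMnl; apply: eq_big_seq => t.
by rewrite mem_shapes => /andP[_ /eqP->].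
Qed.

Lemma psum_size psi : psum (fun t => psi t *+ size (plabels t)) = fpsD (psum psi).
Proof.
apply/boolp.funext => n; rewrite /fpsD /psum -sumrMnl; apply: eq_big_seq => t.
by rewrite mem_pshapes => /andP[_ /eqP->].
Qed.

Lemma tsumD phi phi' : tsum (fun t => phi t + phi' t) = tsum phi + tsum phi'.
Proof. by apply/boolp.funext => n; rewrite coefpsD /tsum big_split. Qed.

Lemma psumD psi psi' : psum (fun t => psi t + psi' t) = psum psi + psum psi'.
Proof. by apply/boolp.funext => n; rewrite coefpsD /psum big_split. Qed.

(* [b] selects greatest ([true]) or least ([false]) distances. *)
Definition sel (b : bool) (h : nat * nat) : nat := if b then h.1 else h.2.

Definition hsum b V L (T : tm V L) : nat := (\sum_(h <- heights T) sel b h.2)%N.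
Definition phsum b V L (p : pt V L) : nat := (\sum_(h <- pheights p) sel b h.2)%N.

Lemma sum_lift_height b L (s : seq (L * (nat * nat))) :
  (\sum_(h <- map (@lift_height L) s) sel b h.2 = \sum_(h <- s) sel b h.2 + size s)%N.
Proof.
by rewrite big_map -sum1_size -big_split; apply: eq_bigr => h _; case: b; rewrite /= addn1.
Qed.

Lemma size_heights V L (T : tm V L) : size (heights T) = size (labels T).
Proof. by rewrite -(proj1 (labels_heights _ _)) size_map. Qed.
Lemma size_pheights V L (p : pt V L) : size (pheights p) = size (plabels p).
Proof. by rewrite -(proj2 (labels_heights _ _)) size_map. Qed.

Definition gfP b : fps R := tsum (fun t => W t *+ hsum b t).
Definition gfPB b : fps R := psum (fun p => PW p *+ phsum b p).

Definition gall_len b (p q : pt unit unit) : nat :=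
  sel b ((maxn (plen p) (plen q)).+2, (minn (plen p) (plen q)).+2).

Definition gfG b : fps R := fun n =>
  \sum_(i < n.+1) \sum_(p <- pshapes i) \sum_(q <- pshapes (n - i))
    (if is_Pn p && is_Pn q then 0 else (PW p * PW q) *+ gall_len b p q).

Lemma hsum_Lf b V L (v : V) (x : L) : hsum b (Lf v x) = 0%N.
Proof. by rewrite /hsum big_seq1; case: b. Qed.

Lemma hsum_Nd b V L (v : V) (l r : tm V L) :
  hsum b (Nd v l r) = (hsum b l + size (labels l) + (hsum b r + size (labels r)))%N.
Proof.
by rewrite /hsum [heights _]/= sum_lift_height big_cat size_cat !size_heights /=; lia.
Qed.

Lemma hsum_Gl b (p q : pt unit unit) : hsum b (Gl tt tt tt tt p q) =
  (phsum b p + size (plabels p) + (phsum b q + size (plabels q)) + gall_len b p q)%N.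
Proof.
rewrite /hsum [heights _]/= big_cons sum_lift_height big_cat size_cat !size_pheights /=.
by rewrite -/(gall_len b p q) /phsum; lia.
Qed.

Lemma phsum_Pn b V L : phsum b (@Pn V L) = 0%N.
Proof. by rewrite /phsum big_nil. Qed.

Lemma phsum_Pc b V L (v : V) (t : tm V L) (p : pt V L) :
  phsum b (Pc v t p) = (hsum b t + size (labels t) + (phsum b p + size (plabels p)))%N.
Proof.
rewrite /phsum [pheights _]/= sum_lift_height big_cat size_cat size_heights size_pheights /=.
by rewrite /hsum; lia.
Qed.

Lemma gfPB_rec b :
  gfPB b = (gfP b + fpsD gfA) * gfB + gfA * (gfPB b + fpsD gfB).
Proof.
rewrite -tsum_size -psum_size -tsumD -psumD.
apply/boolp.funext => n; rewrite coefpsD {1}/gfPB psum_rec phsum_Pn mulr0n mulr0 add0r.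
rewrite -!conv_sum -big_split; apply: eq_bigr => i _.
rewrite -big_split; apply: eq_bigr => t _; rewrite -big_split; apply: eq_bigr => p _.
by rewrite /= phsum_Pc -!mulrnDr mulrnAl mulrnAr -mulrnDr.
Qed.

Lemma coefpsM_sym (f g : fps R) n : (f * g) n *+ 2 = (f * g) n + (g * f) n.
Proof. by rewrite (mulrC g) mulr2n. Qed.

Lemma gfP_rec b : gfP b *+ 2 = gfA * (gfP b + fpsD gfA) *+ 2
  + z * ((gfPB b + fpsD gfB) * gfB *+ 2 + gfG b).
Proof.
rewrite -[fpsD gfA]tsum_size -[fpsD gfB]psum_size -tsumD -psumD.
apply/boolp.funext => n; rewrite !coefpsMn coefpsD coefpsMn coefpsXM {1}/gfP tsum_rec.
rewrite hsum_Lf mulr0n mulr0 add0r mulrnDl; congr (_ + _).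
  rewrite coefpsM_sym -!conv_sum -big_split -sumrMnl; apply: eq_bigr => i _.
  rewrite -big_split -sumrMnl; apply: eq_bigr => l _.
  rewrite -big_split -sumrMnl; apply: eq_bigr => r _.
  rewrite /= hsum_Nd -!mulrnDr !mulrnAl !mulrnAr -mulrnDr -mulrnA mulnC mulrnA -mulrnAl half2 mul1r.
  by congr (_ *+ _); lia.
case: n => [|n]; first by rewrite mul0rn.
rewrite coefpsD coefpsMn coefpsM_sym -!conv_sum /gfG -!big_split -sumrMnl.
apply: eq_bigr => i _.
rewrite -!big_split -sumrMnl; apply: eq_bigr => p _.
rewrite -!big_split -sumrMnl; apply: eq_bigr => q _.
rewrite hsum_Gl /=; case: ifP => [/andP[]|_].
  by case: p => // _; case: q => // _; rewrite !phsum_Pn !mulr0n !addr0 mulr0 mul0r mul0rn addr0.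
rewrite -!mulrnDr !mulrnAl !mulrnAr -!mulrnDr -mulrnA mulnC mulrnA -mulrnAl half2 mul1r.
by congr (_ *+ _); lia.
Qed.

Lemma weight_ge0 V L :
  (forall T : tm V L, 0 <= weight R T) /\ (forall p : pt V L, 0 <= pweight R p).
Proof. by apply: tm_pt_ind => //= *; rewrite ?mulr_ge0 // invr_ge0. Qed.

Lemma gfA_ge0 n : 0 <= gfA n.
Proof. by apply: sumr_ge0 => t _; apply: (proj1 (weight_ge0 _ _)). Qed.
Lemma gfB_ge0 n : 0 <= gfB n.
Proof. by apply: sumr_ge0 => t _; apply: (proj2 (weight_ge0 _ _)). Qed.

Lemma gfA0 : gfA 0%N = 0.
Proof.
by rewrite /gfA /tsum big_nil.
Qed.

Lemma psum_plen : psum (fun p => PW p *+ plen p) = gfA * gfB * gfB.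
Proof.
set LB := psum _; have E : LB = gfA * (gfB + LB).
  rewrite -psumD; apply/boolp.funext => n; rewrite {1}/LB psum_rec /= mulr0n mulr0 add0r -conv_sum.
  apply: eq_bigr => i _; apply: eq_bigr => t _; apply: eq_bigr => p _.
  by rewrite mulrS mulrDr mulrnAr.
have wB : (1 - gfA) * gfB = 1 by rewrite mulrBl mul1r {1}gfB_rec addrK.
have -> : LB = gfB * ((1 - gfA) * LB) by rewrite mulrA (mulrC gfB) wB mul1r.
have -> : (1 - gfA) * LB = gfA * gfB by apply: (eq_by_cofactor (k := 1) E); ring.
by rewrite mulrC.
Qed.

Lemma gfG_bounds b n : 0 <= gfG b n <=
  ((gfA * gfB * gfB * gfB) *+ 2 + (gfB * gfB) *+ 2) n.
Proof.
apply/andP; split.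
  apply: sumr_ge0 => i _; apply: sumr_ge0 => p _; apply: sumr_ge0 => q _.
  by case: ifP => // _; rewrite mulrn_wge0 // mulr_ge0 // (proj2 (weight_ge0 _ _)).
have -> : (gfA * gfB * gfB * gfB) *+ 2 + (gfB * gfB) *+ 2 =
   psum (fun p => PW p *+ plen p) * gfB + gfB * psum (fun p => PW p *+ plen p) + (gfB * gfB) *+ 2.
  by rewrite psum_plen; ring.
rewrite !coefpsD mulr2n coefpsD -!conv_sum -!big_split /=.
apply: ler_sum => i _; rewrite -!big_split /=.
apply: ler_sum => p _; rewrite -!big_split /=.
apply: ler_sum => q _.
have ww : 0 <= PW p * PW q by rewrite mulr_ge0 // (proj2 (weight_ge0 _ _)).
have -> : PW p *+ plen p * PW q + PW p * (PW q *+ plen q) + (PW p * PW q + PW p * PW q)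
  = (PW p * PW q) *+ (plen p + plen q + 2)%N.
  by rewrite !mulrnDr mulrnAl mulrnAr mulr2n.
case: ifP => _; first by rewrite mulrn_wge0.
apply: ler_wpMn2l => //; rewrite /gall_len; case: b => /=; lia.
Qed.

End ShapeSums.

Section Fill.
Variables (V L L' : Type) (x0 : L).

Fixpoint fill (T : tm V L') (s : seq L) : tm V L :=
  match T with
  | Lf v _ => Lf v (head x0 s)
  | Nd v l r => Nd v (fill l (take (size (labels l)) s)) (fill r (drop (size (labels l)) s))
  | Gl v c y _ p q =>
      Gl v c y (head x0 s) (pfill p (take (size (plabels p)) (behead s)))
         (pfill q (drop (size (plabels p)) (behead s)))
  end
with pfill (p : pt V L') (s : seq L) : pt V L :=
  if p is Pc v t p' then
    Pc v (fill t (take (size (labels t)) s)) (pfill p' (drop (size (labels t)) s))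
  else Pn.

Lemma labels_fill :
  (forall T s, size s = size (labels T) -> labels (fill T s) = s) /\
  (forall p s, size s = size (plabels p) -> plabels (pfill p s) = s).
Proof.
apply: tm_pt_ind => /=.
- by move=> v x [|y []].
- move=> v l IHl r IHr s; rewrite size_cat => E.
  by rewrite IHl ?IHr ?cat_take_drop // ?size_drop ?size_takel ?E ?addKn // leq_addr.
- move=> v c y x p IHp q IHq [|x' s] //= [] /eqP; rewrite size_cat => /eqP E.
  by rewrite IHp ?IHq ?cat_take_drop // ?size_drop ?size_takel ?E ?addKn // leq_addr.
- by case.
- move=> v t IHt p IHp s; rewrite size_cat => E.
  by rewrite IHt ?IHp ?cat_take_drop // ?size_drop ?size_takel ?E ?addKn // leq_addr.
Qed.

Lemma shape_fill :
  (forall T s, shape (fill T s) = shape T :> tm unit unit) /\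
  (forall p s, pshape (pfill p s) = pshape p :> pt unit unit).
Proof.
by apply: tm_pt_ind => //= [v l IHl r IHr s|v c y x p IHp q IHq s|v t IHt p IHp s];
  rewrite ?IHl ?IHr ?IHp ?IHq ?IHt.
Qed.

End Fill.

Lemma fill_shape (L : Type) (x0 : L) :
  (forall t : tm unit L, fill x0 (shape t) (labels t) = t) /\
  (forall p : pt unit L, pfill x0 (pshape p) (plabels p) = p).
Proof.
have sz (t : tm unit L) : size (labels (shape t)) = size (labels t).
  by rewrite (proj1 (labels_tmap _ _)) size_map.
have psz (t : pt unit L) : size (plabels (pshape t)) = size (plabels t).
  by rewrite (proj2 (labels_tmap _ _)) size_map.
apply: tm_pt_ind => //=.
- by case.
- by move=> [] l IHl r IHr; rewrite sz take_size_cat // drop_size_cat // IHl IHr.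
- by move=> [] [] [] x p IHp q IHq; rewrite psz take_size_cat // drop_size_cat // IHp IHq.
- by move=> [] t IHt p IHp; rewrite sz take_size_cat // drop_size_cat // IHt IHp.
Qed.

Lemma weight_tmap (R : numFieldType) V V' L L' (f : V -> V') (g : L -> L') :
  (forall T : tm V L, weight R (tmap f g T) = weight R T) /\
  (forall p : pt V L, pweight R (ptmap f g p) = pweight R p).
Proof.
by apply: tm_pt_ind => //= [v l -> r ->|v c y x p -> q ->|v t -> p ->].
Qed.

Lemma hsum_tmap b V V' L L' (f : V -> V') (g : L -> L') (T : tm V L) :
  hsum b (tmap f g T) = hsum b T.
Proof. by rewrite /hsum (proj1 (heights_tmap _ _)) big_map. Qed.

Section Expectation.
Local Open Scope ring_scope.

Lemma shape_id (t : tm unit unit) : shape t = t.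
Proof.
suff: (forall t : tm unit unit, shape t = t) /\ (forall p : pt unit unit, pshape p = p) by case.
apply: tm_pt_ind => //= [[] []//|[] l -> r ->//|[] [] [] [] p -> q ->//|[] s -> p ->//].
Qed.

Lemma class_sum_shapes (R : numFieldType) (n : nat) (G : netT n (Kn n) -> R)
    (F : tm unit unit -> R) : (1 < n)%N ->
  (forall N t, is_network N -> has_term N t -> G N = F (shape t)) ->
  \sum_(B in SGT_classes n) G (rep B) = n`!%:R * tsum (fun t => weight R t * F t) n.
Proof.
case: n G => // n G n1 GF.
have perms (l : seq 'I_n.+1) : l \in permutations (enum 'I_n.+1) -> size l = n.+1.
  by rewrite mem_permutations => /perm_size ->; rewrite size_enum_ord.
have szs (s : tm unit unit) : s \in shapes n.+1 -> size (labels s) = n.+1.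
  by rewrite mem_shapes => /andP[_ /eqP].
pose terms := [seq fill ord0 s l | s <- shapes n.+1, l <- permutations (enum 'I_n.+1)].
rewrite (@class_sum R n.+1 G (fun t => F (shape t)) terms) //.
- rewrite big_allpairs_dep /tsum mulr_sumr; apply: eq_bigr => s _.
  under eq_bigr => l _ do rewrite -(proj1 (weight_tmap R (fun=> tt) (fun=> tt)))
    (proj1 (@shape_fill _ _ _ _)) shape_id.
  by rewrite big_const_seq count_predT size_permutations ?enum_uniq // size_enum_ord iter_addr_0 mulr_natl.
- apply: allpairs_uniq; rewrite ?shapes_uniq ?permutations_uniq // => -[s l] [s' l'] /=.
  move=> /allpairsP[[s1 l1] /= [h1 h2 [E1 E2]]] /allpairsP[[s2 l2] /= [h3 h4 [E3 E4]]] E; subst.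
  have := congr1 (fun t : tm unit 'I_n.+1 => (shape t : tm unit unit)) E.
  have := congr1 (@labels _ _) E.
  rewrite !(proj1 (@labels_fill _ _ _ _)) ?(perms _ h2) ?(perms _ h4) ?szs // => ->.
  by rewrite !(proj1 (@shape_fill _ _ _ _)) !shape_id => ->.
- move=> t; apply/idP/idP.
    case/allpairsP => -[s l] /= [hs hl ->].
    rewrite (proj1 (@labels_fill _ _ _ _)) ?(perms _ hl) ?szs // -mem_permutations hl andbT.
    rewrite -(proj1 (wf_tmap (fun=> tt) (fun=> tt))) (proj1 (@shape_fill _ _ _ _)) shape_id.
    by move: hs; rewrite mem_shapes => /andP[].
  case/andP => wt lt; rewrite -(proj1 (fill_shape ord0) t); apply: allpairs_f.
    rewrite mem_shapes (proj1 (wf_tmap _ _)) wt (proj1 (labels_tmap _ _)) size_map.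
    by rewrite (perm_size lt) size_enum_ord /=.
  by rewrite mem_permutations.
Qed.

Lemma expectation_shapes (R : numFieldType) b (n : nat) : (1 < n)%N ->
  (\sum_(B in SGT_classes n) (if b then Splus (rep B) else Sminus (rep B))%:R)
    / #|SGT_classes n|%:R = gfP R b n / gfA R n.
Proof.
move=> n1.
have -> : #|SGT_classes n|%:R = n`!%:R * gfA R n.
  rewrite -sum1_card natr_sum.
  apply: etrans (@class_sum_shapes R n (fun=> 1) (fun=> 1) n1 _) _ => //.
  by congr (_ * _); apply: eq_bigr => t _; rewrite mulr1.
rewrite (class_sum_shapes (G := fun N => (if b then Splus N else Sminus N)%:R)
  (F := fun t => (hsum b t)%:R)) //; last first.
  move=> N t netN /(Splus_Sminus_term netN)[-> ->]; rewrite hsum_tmap.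
  by congr _%:R; rewrite /hsum; case: b.
have -> : tsum (fun t => weight R t * (hsum b t)%:R) = gfP R b.
  by apply/boolp.funext => m; apply: eq_bigr => t _; rewrite mulr_natr.
by rewrite invfM mulrACA mulfV ?mul1r // pnatr_eq0 -lt0n fact_gt0.
Qed.

End Expectation.

From mathcomp Require Import all_classical all_reals all_analysis.
Import numFieldNormedType.Exports.
Local Open Scope classical_set_scope.
Local Open Scope ring_scope.

(** * Wallis' product *)

Lemma cvgn_shiftS (R : realType) (u : nat -> R) (l : R) :
  (fun n => u n.+1) @ \oo --> l <-> u @ \oo --> l.
Proof.
split=> /cvgrPdist_lt h; apply/cvgrPdist_lt => e /h[N _ H].
  by exists N.+1 => // -[//|n] Nn; apply: H.
by exists N => // n Nn; apply: H; apply: leqW.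
Qed.

Section Wallis.
Variable R : realType.

(* The primitive of cos ^+ n vanishing at 0, given by its reduction formula. *)
Fixpoint cos_primitive (n : nat) : R -> R :=
  match n with
  | 0 => id
  | 1 => sin
  | k.+2 => (k.+2%:R^-1 : R) *:
      ((sin : R -> R) * (cos : R -> R) ^+ k.+1 + (k.+1%:R : R) *: cos_primitive k)
  end.

Lemma cos_primitiveSS k x : cos_primitive k.+2 x =
  (sin x * cos x ^+ k.+1 + k.+1%:R * cos_primitive k x) / k.+2%:R.
Proof.
have Ex j : ((cos : R -> R) ^+ j) x = cos x ^+ j.
  by elim: j => // j IHj; rewrite !exprS -IHj.
by rewrite -Ex mulrC.
Qed.

Lemma is_derive_cos_primitive (n : nat) (x : R) : is_derive x 1 (cos_primitive n) (cos x ^+ n).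
Proof.
suff: is_derive x 1 (cos_primitive n) (cos x ^+ n) /\
      is_derive x 1 (cos_primitive n.+1) (cos x ^+ n.+1) by case.
elim: n => [|n [IH1 IH2]]; first by rewrite expr0 expr1; split; exact: _.
split=> //=; apply: is_derive_eq.
have s2 : sin x ^+ 2 = 1 - cos x ^+ 2 by rewrite -(cos2Dsin2 x); ring.
have Ex k : ((cos : R -> R) ^+ k) x = cos x ^+ k.
  by elim: k => // k IHk; rewrite !exprS -IHk.
rewrite /= /GRing.scale /= Ex !exprS.
have n0 : (n.+2%:R : R) != 0 by rewrite pnatr_eq0.
apply: (mulfI n0); rewrite mulVKf //.
rewrite -[n.+2]addn2 -[n.+1 in LHS]addn1 !natrD.
transitivity (cos x * cos x * cos x ^+ n - (n%:R + 1) * sin x ^+ 2 * cos x ^+ n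
  + (n%:R + 1) * cos x ^+ n); first ring.
by rewrite s2; ring.
Qed.

Lemma cos_primitive0 n : cos_primitive n 0 = 0.
Proof.
suff: cos_primitive n 0 = 0 /\ cos_primitive n.+1 0 = 0 by case.
elim: n => [|n [IH1 IH2]]; first by rewrite /= sin0.
by split=> //; rewrite cos_primitiveSS IH1 sin0 mul0r mulr0 addr0 mul0r.
Qed.

Definition wallis n : R := cos_primitive n (pi / 2).

Lemma wallis_rec n : wallis n.+2 = n.+1%:R / n.+2%:R * wallis n.
Proof.
by rewrite /wallis cos_primitiveSS cos_pihalf exprS mul0r mulr0 add0r mulrAC.
Qed.

Lemma wallis_decr n : wallis n.+1 <= wallis n.
Proof.
have pi2 : 0 <= pi / 2 :> R by rewrite divr_ge0 // pi_ge0.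
pose h : R -> R := cos_primitive n - cos_primitive n.+1.
pose dh := fun x : R => cos x ^+ n - cos x ^+ n.+1.
have hd (x : R) : is_derive x 1 h (dh x).
  by apply: is_deriveB; exact: is_derive_cos_primitive.
have [|c] := @MVT_segment R h dh 0 (pi / 2) pi2 (fun x _ => hd x).
  by apply: derivable_within_continuous => x _; case: (hd x).
rewrite in_itv /= => /andP[c0 cpi]; rewrite subr0.
have -> : h (pi / 2) = wallis n - wallis n.+1 by [].
have -> : h 0 = cos_primitive n 0 - cos_primitive n.+1 0 by [].
rewrite !cos_primitive0 subrr.
rewrite subr0 => E; rewrite -subr_ge0 E mulr_ge0 //.
have cc : 0 <= cos c by apply: cos_ge0_pihalf; rewrite cpi andbT (le_trans _ c0) // oppr_le0.
rewrite /dh exprS subr_ge0 ler_piMl ?exprn_ge0 //.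
Qed.

Lemma wallis_mul n : n.+1%:R * (wallis n * wallis n.+1) = pi / 2.
Proof.
elim: n => [|n IH]; first by rewrite mul1r /wallis /= sin_pihalf mulr1.
rewrite -IH wallis_rec.
have h : (n.+2%:R : R) != 0 by rewrite pnatr_eq0.
by field.
Qed.

Lemma wallis_gt0 n : 0 < wallis n.
Proof.
suff: 0 < wallis n /\ 0 < wallis n.+1 by case.
elim: n => [|n [IH1 IH2]].
  by rewrite /wallis /= sin_pihalf divr_gt0 ?pi_gt0.
by split=> //; rewrite wallis_rec mulr_gt0 // divr_gt0 ?ltr0n.
Qed.

(* The coefficients of the square root of 1 - x. *)
Fixpoint sqc (m : nat) : R :=
  if m is k.+1 then sqc k * ((k.*2%:R - 1) / k.*2.+2%:R) else 1.

Lemma wallis_sqc m : wallis m.*2 = pi / 2 * (sqc m * (1 - m.*2%:R)).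
Proof.
elim: m => [|m IH]; first by rewrite /wallis /= subr0 !mulr1.
rewrite doubleS wallis_rec IH /=.
have h : (m.*2.+2%:R : R) != 0 by rewrite pnatr_eq0.
have e2 : m.*2.+2%:R = m.*2%:R + 2 :> R by rewrite -addn2 natrD.
have e1 : m.*2.+1%:R = m.*2%:R + 1 :> R by rewrite -addn1 natrD.
by rewrite e1; rewrite e2 in h *; field.
Qed.

Lemma sqc_lt0 m : sqc m.+1 < 0.
Proof.
have := wallis_gt0 m.+1.*2; rewrite wallis_sqc pmulr_rgt0 ?divr_gt0 ?pi_gt0 //.
have h : 1 - m.+1.*2%:R < 0 :> R by rewrite subr_lt0 ltr1n doubleS.
by rewrite nmulr_lgt0.
Qed.

Lemma sqc_norm_le1 m : `|sqc m| <= 1.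
Proof.
elim: m => [|m IH]; first by rewrite normr1.
rewrite /= normrM mulr_ile1 // normrM normfV (ger0_norm (ler0n _ _)).
rewrite ler_pdivrMr ?ltr0n // mul1r ler_norml -addn2 natrD.
have := ler0n R m.*2; set a := _%:R => ha.
by apply/andP; split; lra.
Qed.

Lemma sqc_sq_bounds m : (0 < m)%N ->
  2 / pi / (m.*2.+1%:R * (m.*2%:R - 1) ^+ 2) <= sqc m ^+ 2
  <= 2 / pi / (m.*2%:R * (m.*2%:R - 1) ^+ 2).
Proof.
case: m => // m _; rewrite doubleS; set k := m.*2.+1.
have pi0 : 0 < pi :> R := pi_gt0 _.
have k0 : 0 < k%:R :> R by rewrite ltr0n.
have k1 : k.+1%:R = k%:R + 1 :> R by rewrite -addn1 natrD.
have k2 : k.+2%:R = k%:R + 2 :> R by rewrite -addn2 natrD.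
have E : sqc m.+1 ^+ 2 = (2 / pi) ^+ 2 * wallis k.+1 ^+ 2 / k%:R ^+ 2.
  have := wallis_sqc m.+1; rewrite doubleS -/k k1 => ->.
  have p0 : pi != 0 :> R by rewrite gt_eqF.
  have k00 : k%:R != 0 :> R by rewrite gt_eqF.
  by move: (@pi R) p0 => P p0; field; rewrite k00 p0.
have kk : k.+1%:R - 1 = k%:R :> R by rewrite k1 addrK.
rewrite E kk.
have up : wallis k.+1 ^+ 2 <= pi / 2 / k.+1%:R.
  rewrite -(wallis_mul k) [X in _ <= X]mulrAC mulfV ?pnatr_eq0 // mul1r expr2.
  by rewrite ler_wpM2r ?wallis_decr // ltW // wallis_gt0.
have lo : pi / 2 / k.+2%:R <= wallis k.+1 ^+ 2.
  rewrite -(wallis_mul k.+1) [X in X <= _]mulrAC mulfV ?pnatr_eq0 // mul1r expr2.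
  by rewrite ler_wpM2l ?wallis_decr // ltW // wallis_gt0.
have F (c : R) : 0 < c -> 2 / pi / (c * k%:R ^+ 2) = (2 / pi) ^+ 2 * (pi / 2 / c) / k%:R ^+ 2.
  by move: (@pi R) pi0 => P P0 c0; field; rewrite !gt_eqF.
rewrite !F ?ltr0n //; apply/andP; split; rewrite ler_wpM2r ?invr_ge0 ?exprn_ge0 ?ler0n //;
  by rewrite ler_wpM2l // exprn_ge0 // divr_ge0 // ltW.
Qed.

Definition omega (m : nat) : R := Num.sqrt (m.+1%:R ^+ 3).

Lemma sqc_omega_cvg : (fun m => sqc m * omega m) @ \oo --> - Num.sqrt (4 * pi)^-1.
Proof.
pose h (m : nat) : R := harmonic m.
have ch : h @ \oo --> (0 : R) by exact: cvg_harmonic.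
have pi0 : 0 < pi :> R := pi_gt0 _.
have L a : (fun m => 2 / pi / ((2 - a * h m) * (2 - 3 * h m) ^+ 2)) @ \oo --> (4 * pi)^-1.
  have -> : (4 * pi)^-1 = 2 / pi / ((2 - a * 0) * (2 - 3 * 0) ^+ 2) :> R.
    by rewrite !mulr0 !subr0; move: (@pi R) pi0 => P P0; field; rewrite gt_eqF.
  have cl (b : R) : (fun m => 2 - b * h m) @ \oo --> 2 - b * 0.
    by apply: cvgB; [exact: cvg_cst|apply: cvgM; [exact: cvg_cst|exact: ch]].
  apply: cvgM; first exact: cvg_cst.
  apply: cvgV; first by rewrite !mulr0 !subr0 mulf_neq0 ?expf_neq0 // pnatr_eq0.
  by apply: cvgM; [exact: cl|apply: cvgM; exact: cl].
have sqc_cvg : (fun m => sqc m ^+ 2 * m.+1%:R ^+ 3) @ \oo --> (4 * pi)^-1.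
  apply: (@squeeze_cvgr _ _ _ _ (fun m => 2 / pi / ((2 - 1 * h m) * (2 - 3 * h m) ^+ 2))
     (fun m => 2 / pi / ((2 - 2 * h m) * (2 - 3 * h m) ^+ 2))); [|exact: L|exact: L].
  near=> m.
  have m0 : (0 < m)%N by near: m; exists 1%N.
  have /andP[lo up] := sqc_sq_bounds m0.
  have E2 : m.*2%:R = 2 * m.+1%:R - 2 :> R by rewrite -muln2 natrM -addn1 natrD; ring.
  have E1 : m.*2.+1%:R = 2 * m.+1%:R - 1 :> R by rewrite -[m.*2.+1]addn1 natrD E2; ring.
  have M0 : 0 < m.+1%:R :> R by rewrite ltr0n.
  have M2 : 2 <= m.+1%:R :> R by rewrite ler_nat.
  rewrite E1 E2 in lo; rewrite E2 in up.
  have T (b : R) : b < 4 -> 2 / pi / ((2 - b * h m) * (2 - 3 * h m) ^+ 2) =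
      2 / pi / ((2 * m.+1%:R - b) * (2 * m.+1%:R - 2 - 1) ^+ 2) * m.+1%:R ^+ 3.
    move=> b4; rewrite /h /harmonic /=; move: (@pi R) pi0 => P P0; field.
    by rewrite !gt_eqF //=; lra.
  have b1 : 1 < 4 :> R by lra.
  have b2 : 2 < 4 :> R by lra.
  rewrite (T _ b1) (T _ b2); have M3 : 0 <= m.+1%:R ^+ 3 :> R by rewrite exprn_ge0.
  by apply/andP; split; apply: ler_wpM2r.
apply/cvgn_shiftS.
have -> : (fun m => sqc m.+1 * omega m.+1) = (fun m => - Num.sqrt (sqc m.+1 ^+ 2 * m.+2%:R ^+ 3)).
  apply/funext => m; rewrite sqrtrM ?sqr_ge0 // sqrtr_sqr ltr0_norm ?sqc_lt0 //.
  by rewrite mulNr opprK.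
apply: cvgN; apply: continuous_cvg; first exact: sqrt_continuous.
exact: (proj2 (cvgn_shiftS (fun m => sqc m ^+ 2 * m.+1%:R ^+ 3) _) sqc_cvg).
Unshelve. all: by end_near. Qed.

End Wallis.

(** * Absolutely summable series *)

Section AbsoluteSums.
Variable R : realType.
Implicit Types (f g : fps R) (u : nat -> R).

Definition prt u (N : nat) : R := \sum_(i < N) u i.

Lemma prtS u N : prt u N.+1 = prt u N + u N. Proof. exact: big_ord_recr. Qed.

Lemma prt_ge0 u N : (forall i, 0 <= u i) -> 0 <= prt u N.
Proof. by move=> u0; apply: sumr_ge0. Qed.

Lemma prt_nondecr u m n : (forall i, 0 <= u i) -> (m <= n)%N -> prt u m <= prt u n.
Proof.
move=> u0; elim: n => [|n IH]; first by rewrite leqn0 => /eqP->.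
by rewrite leq_eqVlt => /orP[/eqP->//|/IH h]; rewrite prtS (le_trans h) // lerDl.
Qed.

Lemma cvg_prt_bounded u C : (forall i, 0 <= u i) -> (forall N, prt u N <= C) ->
  exists2 l, prt u @ \oo --> l & forall N, prt u N <= l.
Proof.
move=> u0 uC.
have nd : nondecreasing_seq (prt u) by move=> m n; apply: prt_nondecr.
have cv : cvgn (prt u).
  by apply: nondecreasing_is_cvgn => //; exists C => _ [N _ <-].
by exists (limn (prt u)) => // N; apply: nondecreasing_cvgn_le.
Qed.

Lemma cvg_prt_sum (a : nat -> nat -> R) (l : nat -> R) N :
  (forall k, (fun m => a m k) @ \oo --> l k) -> (fun m => prt (a m) N) @ \oo --> prt l N.
Proof.
move=> al; elim: N => [|N IH].
  by rewrite /prt big_ord0; under eq_fun do rewrite big_ord0; exact: cvg_cst.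
rewrite prtS; under eq_fun do rewrite prtS.
by apply: cvgD.
Qed.

Lemma tannery (a : nat -> nat -> R) (M l : nat -> R) (C v : R) :
  (forall m k, (k < m)%N -> `|a m k| <= M k) -> (forall k, 0 <= M k) ->
  (forall N, prt M N <= C) -> (forall k, (fun m => a m k) @ \oo --> l k) ->
  prt l @ \oo --> v -> (fun m => prt (a m) m) @ \oo --> v.
Proof.
move=> aM M0 MC al lv; have [mu Mmu Mle] := cvg_prt_bounded M0 MC.
apply/cvgrPdist_lt => e e0; have e4 : 0 < e / 4 by rewrite divr_gt0.
have /cvgrPdist_lt/(_ _ e4)[N1 _ H1] := Mmu.
have /cvgrPdist_lt/(_ _ e4)[N2 _ H2] := lv.
pose N := maxn N1 N2.
have tail : mu - prt M N < e / 4.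
  by apply: le_lt_trans (H1 N (leq_maxl _ _)); apply: ler_norm.
have vN : `|v - prt l N| < e / 4 by apply: H2; exact: leq_maxr.
have /cvgrPdist_lt/(_ _ e4)[N3 _ H3] := @cvg_prt_sum a l N al.
exists (maxn N N3) => // m; rewrite /= geq_max => /andP[Nm N3m].
have tl : `|prt (a m) m - prt (a m) N| <= prt M m - prt M N.
  have: forall j, (j <= m)%N -> (N <= j)%N -> `|prt (a m) j - prt (a m) N| <= prt M j - prt M N.
    elim=> [|j IH] jm Nj.
      by move: Nj; rewrite leqn0 => /eqP->; rewrite !subrr normr0.
    move: Nj; rewrite leq_eqVlt => /orP[/eqP<-|Nj]; first by rewrite !subrr normr0.
    rewrite !prtS !(addrAC _ _ (- _)); apply: le_trans (ler_normD _ _) _.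
    by apply: lerD; [apply: IH => //; exact: ltnW|exact: aM].
  by apply.
have m3 := H3 m N3m; have Mm := Mle m.
have -> : v - prt (a m) m = (v - prt l N) + (prt l N - prt (a m) N)
    - (prt (a m) m - prt (a m) N) by ring.
apply: le_lt_trans (ler_normB _ _) _.
have := ler_normD (v - prt l N) (prt l N - prt (a m) N) => h.
have : `|prt l N - prt (a m) N| < e / 4 by [].
by lra.
Qed.

Definition asum f (v : R) :=
  (exists C, forall N, prt (fun i => `|f i|) N <= C) /\ prt f @ \oo --> v.

Lemma asum_exists f C : (forall N, prt (fun i => `|f i|) N <= C) -> exists v, asum f v.
Proof.
move=> fC.
have cv : cvgn (series f).
  apply: normed_cvg.
  have [||l h _] := @cvg_prt_bounded (fun i => `|f i|) C => //.
  apply/cvg_ex; exists l => /=.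
  have -> : [normed series f] = prt (fun i => `|f i|).
    by apply/funext => N; rewrite /normed_series_of /series /= big_mkord.
  exact: h.
exists (limn (series f)); split; first by exists C.
have <- : series f = prt f by apply/funext => N; rewrite /series /= big_mkord.
exact: cv.
Qed.

Lemma asum_ge0_exists f C : (forall n, 0 <= f n) -> (forall N, prt f N <= C) ->
  exists2 v, asum f v & v <= C.
Proof.
move=> f0 fC; have [|v av] := @asum_exists f C.
  by move=> N; under [prt _ N]eq_bigr do rewrite ger0_norm //; exact: fC.
exists v => //; apply: (ler_cvg_to av.2 (cvg_cst C)).
by near=> N; apply: fC.
Unshelve. all: by end_near. Qed.

Lemma asum_uniq f v w : asum f v -> asum f w -> v = w.
Proof. by move=> [_ fv] [_ fw]; apply: (cvg_unique _ fv fw). Qed.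

Lemma asumD f g v w : asum f v -> asum g w -> asum (f + g) (v + w).
Proof.
move=> [[C fC] fv] [[D gD] gw]; split.
  exists (C + D) => N; apply: le_trans (lerD (fC N) (gD N)); rewrite /prt -big_split /=.
  by apply: ler_sum => i _; apply: ler_normD.
have -> : prt (f + g) = prt f + prt g.
  by apply/funext => N; rewrite /prt -[RHS]big_split.
exact: cvgD.
Qed.

Lemma asumN f v : asum f v -> asum (- f) (- v).
Proof.
move=> [[C fC] fv]; split.
  by exists C => N; apply: le_trans (fC N); apply: ler_sum => i _; rewrite coefpsN normrN.
have -> : prt (- f) = - prt f.
  by apply/funext => N; rewrite /prt -[RHS]sumrN.
exact: cvgN.
Qed.

Lemma asumB f g v w : asum f v -> asum g w -> asum (f - g) (v - w).
Proof. by move=> fv gw; apply: asumD => //; apply: asumN. Qed.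

Lemma asumMn f v k : asum f v -> asum (f *+ k.+1) (v *+ k.+1).
Proof. by move=> fv; elim: k => // k IH; rewrite !(mulrS _ k.+1); apply: asumD. Qed.

Lemma prt_C c N : prt (fpsC c) N.+1 = c.
Proof. by rewrite /prt big_ord_recl big1 ?addr0. Qed.

Lemma asumC c : asum (fpsC c) c.
Proof.
split.
  exists `|c| => -[|N]; first by rewrite /prt big_ord0.
  by rewrite /prt big_ord_recl big1 ?addr0 // => i _; rewrite normr0.
apply/cvgn_shiftS; under eq_fun do rewrite prt_C; exact: cvg_cst.
Qed.

Lemma asum1 : asum 1 1.
Proof. by rewrite -(fpsC1 R); apply: asumC. Qed.

Lemma asumX : asum fpsX 1.
Proof.
have E N : prt (fpsX : fps R) N.+2 = 1.
  by rewrite /prt 2!big_ord_recl /= add0r big1 ?addr0.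
split.
  exists 1 => N; apply: le_trans (_ : prt (fpsX : fps R) N.+2 <= 1); last by rewrite E.
  apply: le_trans (_ : prt (fpsX : fps R) N <= _).
    by apply: ler_sum => i _; rewrite ger0_norm // ler0n.
  by apply: prt_nondecr => [i|]; [exact: ler0n|lia].
apply/cvgn_shiftS/(cvgn_shiftS (fun n => prt fpsX n.+1)).
by under eq_fun do rewrite E; exact: cvg_cst.
Qed.

Lemma prt_mul f g N : prt (f * g) N = prt (fun i => f i * prt g (N - i)) N.
Proof.
elim: N => [|N IH]; first by rewrite /prt !big_ord0.
have e1 : prt g 1 = g 0%N by rewrite /prt big_ord1.
rewrite prtS IH [RHS]prtS subSnn e1 coefpsM big_ord_recr /= subnn addrA.
congr (_ + _); transitivity (\sum_(i < N) (f i * prt g (N - i) + f i * g (N - i)%N)).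
  by rewrite big_split.
by apply: eq_bigr => i _; rewrite subSn ?(ltnW (ltn_ord i)) // prtS mulrDr.
Qed.

Lemma prt_mul_le f g N : (forall i, 0 <= f i) -> (forall i, 0 <= g i) ->
  prt (f * g) N <= prt f N * prt g N.
Proof.
move=> f0 g0; rewrite prt_mul mulr_suml; apply: ler_sum => i _.
by apply: ler_wpM2l => //; apply: prt_nondecr => //; apply: leq_subr.
Qed.

Lemma cvgn_sub u (l : R) k : u @ \oo --> l -> (fun m => u (m - k)%N) @ \oo --> l.
Proof.
move=> /cvgrPdist_lt h; apply/cvgrPdist_lt => e /h[N _ H].
by exists (N + k)%N => // m /= Nm; apply: H => /=; rewrite leq_subRL; lia.
Qed.

(* The error terms [f i * (w - prt g (m - i))] tend to 0 and are dominated by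
   multiples of [`|f i|], so Tannery's theorem applies. *)
Lemma asumM f g v w : asum f v -> asum g w -> asum (f * g) (v * w).
Proof.
move=> [[C fC] fv] [[D gD] gw]; split.
  exists (C * D) => N.
  have C0 : 0 <= C by apply: le_trans (fC 0%N); rewrite /prt big_ord0.
  pose af : fps R := fun i => `|f i|; pose ag : fps R := fun i => `|g i|.
  apply: (@le_trans _ _ (prt (af * ag) N)).
    apply: ler_sum => i _; rewrite !coefpsM; apply: le_trans (ler_norm_sum _ _ _) _.
    by apply: ler_sum => j _; rewrite normrM.
  have af0 i : 0 <= af i by exact: normr_ge0.
  have ag0 i : 0 <= ag i by exact: normr_ge0.
  apply: le_trans (prt_mul_le N af0 ag0) _.
  by apply: ler_pM; [exact: prt_ge0|exact: prt_ge0|exact: fC|exact: gD].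
have gB N : `|prt g N| <= D by apply: le_trans (ler_norm_sum _ _ _) (gD N).
have wD : `|w| <= D.
  apply: (ler_cvg_to (cvg_norm gw) (cvg_cst D)); by near=> N; apply: gB.
have D0 : 0 <= D by apply: le_trans wD.
have h0 : (fun m => prt (fun i => f i * (w - prt g (m - i))) m) @ \oo --> (0 : R).
  apply: (@tannery _ (fun i => `|f i| * (D + D)) (fun=> 0) (C * (D + D))).
  - move=> m k _; rewrite normrM ler_wpM2l //; apply: le_trans (ler_normB _ _) _.
    by apply: lerD.
  - by move=> k; rewrite mulr_ge0 // addr_ge0.
  - by move=> N; rewrite /prt -mulr_suml ler_wpM2r ?addr_ge0 //; apply: fC.
  - move=> k; rewrite -[X in _ --> X](mulr0 (f k)); apply: cvgM; first exact: cvg_cst.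
    rewrite -[X in _ --> X](subrr w); apply: cvgB; first exact: cvg_cst.
    exact: cvgn_sub.
  - rewrite /prt; under eq_fun do rewrite big1 //; exact: cvg_cst.
have -> : prt (f * g) = (fun m => prt f m * w - prt (fun i => f i * (w - prt g (m - i))) m).
  apply/funext => m; rewrite prt_mul /prt mulr_suml -sumrB; apply: eq_bigr => i _.
  by rewrite -mulrBr subKr.
rewrite -[v * w]subr0; apply: cvgB h0; apply: cvgM => //; exact: cvg_cst.
Unshelve. all: by end_near. Qed.

Definition geom (c : R) : fps R := fun n => c ^+ n.

Lemma geomE c : geom c = 1 + fpsC c * (fpsX * geom c).
Proof.
apply/funext => n; rewrite coefpsD coefps1 coefpsCM coefpsXM /geom.
by case: n => [|n]; rewrite ?expr0 ?mulr0 ?addr0 // add0r exprS.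
Qed.

Lemma asum_geom c : 0 <= c < 1 -> asum (geom c) (1 - c)^-1.
Proof.
move=> /andP[c0 c1]; have d0 : 0 < 1 - c by rewrite subr_gt0.
have [|N|v av _] := @asum_ge0_exists (geom c) (1 - c)^-1.
- by move=> n; rewrite exprn_ge0.
- suff -> : prt (geom c) N = (1 - c ^+ N) / (1 - c).
    by rewrite ler_pdivrMr // mulVf ?gt_eqF // lerBlDr lerDl exprn_ge0.
  elim: N => [|N IH]; first by rewrite /prt big_ord0 expr0 subrr mul0r.
  by rewrite prtS IH /geom exprS; field; rewrite gt_eqF.
have : asum (geom c) (1 + c * (1 * v)).
  by rewrite geomE; apply: asumD asum1 _; apply: asumM (asumC c) _; apply: asumM asumX av.
move/(asum_uniq av) => E; rewrite (_ : (1 - c)^-1 = v) //.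
apply: (mulfI (lt0r_neq0 d0)); rewrite mulfV ?gt_eqF //.
by rewrite mulrBl mul1r {1}E mul1r addrK.
Qed.

Lemma asum_dominated f g C : (forall n, 0 <= f n <= g n) ->
  (forall N, prt g N <= C) -> exists v, asum f v.
Proof.
move=> fg gC; apply: (@asum_exists f C) => N; apply: le_trans (gC N).
by apply: ler_sum => i _; have /andP[h1 h2] := fg i; rewrite ger0_norm.
Qed.

Lemma asum_ge0_le f v N : (forall n, 0 <= f n) -> asum f v -> prt f N <= v.
Proof.
move=> f0 [_ fv]; apply: (ler_cvg_to (cvg_cst (prt f N)) fv).
by near=> m; apply: prt_nondecr => //; near: m; exists N.
Unshelve. all: by end_near. Qed.

End AbsoluteSums.

(** * Asymptotics *)

Section PartialSums.
Variable R : realType.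
Implicit Types f g : fps R.

Lemma prtD f g N : prt (f + g) N = prt f N + prt g N.
Proof. by rewrite /prt -big_split. Qed.

Lemma prtCM c f N : prt (fpsC c * f) N = c * prt f N.
Proof. by rewrite /prt mulr_sumr; apply: eq_bigr => i _; rewrite coefpsCM. Qed.

Lemma prtXM f N : prt (fpsX * f) N.+1 = prt f N.
Proof.
rewrite /prt big_ord_recl coefpsXM add0r; apply: eq_bigr => i _.
by rewrite coefpsXM.
Qed.

Lemma prt1_le N : prt (1 : fps R) N <= 1.
Proof.
case: N => [|N]; first by rewrite /prt big_ord0.
by rewrite -(fpsC1 R) prt_C.
Qed.

Lemma prtX_le N : prt (fpsX : fps R) N <= 1.
Proof.
case: N => [|N]; first by rewrite /prt big_ord0.
by rewrite -[fpsX]mulr1 prtXM prt1_le.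
Qed.

Lemma prt_telescope f N : prt (f * (1 - fpsX)) N.+1 = f N.
Proof.
have -> : f * (1 - fpsX) = f - fpsX * f by ring.
have E n : (f - fpsX * f) n = f n - (if n is k.+1 then f k else 0).
  by rewrite coefpsB coefpsXM.
elim: N => [|N IH]; first by rewrite prtS {1}/prt big_ord0 add0r E subr0.
by rewrite prtS IH E addrC subrK.
Qed.

Lemma fpsSN c f : fpsS c (- f) = - fpsS c f.
Proof. by apply/funext => n; rewrite /fpsS !coefpsN mulNr. Qed.

Lemma fpsSMn c f k : fpsS c (f *+ k) = fpsS c f *+ k.
Proof. by apply/funext => n; rewrite /fpsS !coefpsMn mulrnAl. Qed.

End PartialSums.

Lemma cvgn_cube (R : realType) (u : nat -> R) (l : R) :
  u @ \oo --> l -> (fun n => u n ^+ 3) @ \oo --> l ^+ 3.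
Proof.
have cube (x : R) : x ^+ 3 = x * (x * x) by rewrite !exprS expr0 mulr1.
move=> c; rewrite cube; have -> : (fun n => u n ^+ 3) = (fun n => u n * (u n * u n)).
  by apply/funext => n; rewrite cube.
exact: cvgM c (cvgM c c).
Qed.

Lemma insert_factors (F : fieldType) (p a c t r o : F) : r != 0 -> o != 0 ->
  p / a / (c * t) = p * r / (a * r * o) * (o / t / c).
Proof.
move=> r0 o0; rewrite !invfM.
transitivity (p / a * (c^-1 / t) * (r / r) * (o / o)); last by ring.
by rewrite !mulfV // !mulr1.
Qed.

Section Asymptotics.
Variable R : realType.

Definition tau : R := Num.sqrt 2 - 1.
Definition rho : R := tau ^+ 2.
Definition sigma : R := Num.sqrt tau.

Let r2 : Num.sqrt 2 ^+ 2 = 2 :> R. Proof. by rewrite sqr_sqrtr. Qed.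
Let r2_ge0 : 0 <= Num.sqrt 2 :> R. Proof. exact: sqrtr_ge0. Qed.
Let r2_gt : 7 / 5 < Num.sqrt 2 :> R.
Proof. by have := r2; have := r2_ge0; set x := Num.sqrt 2 => *; nra. Qed.
Let r2_lt : Num.sqrt 2 < 3 / 2 :> R.
Proof. by have := r2; have := r2_ge0; set x := Num.sqrt 2 => *; nra. Qed.

Let tau_gt0 : 0 < tau. Proof. by rewrite /tau; have := r2_gt; lra. Qed.
Let tau_lt1 : tau < 1 / 2. Proof. by rewrite /tau; have := r2_lt; lra. Qed.
Let tauE : tau ^+ 2 + 2 * tau = 1.
Proof. by rewrite /tau; have := r2; set x := Num.sqrt 2 => h; nra. Qed.
Let rhoE : rho = 1 - 2 * tau. Proof. by rewrite /rho; have := tauE; lra. Qed.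
Let rho_gt0 : 0 < rho. Proof. by rewrite exprn_gt0. Qed.
Let rho_lt : 3 * rho < 1.
Proof. by rewrite rhoE /tau; have := r2_gt; lra. Qed.
Let sigma_gt0 : 0 < sigma. Proof. by rewrite sqrtr_gt0. Qed.
Let sigma2 : sigma ^+ 2 = tau. Proof. by rewrite sqr_sqrtr // ltW. Qed.

Local Notation A := (gfA R).
Local Notation B := (gfB R).
Local Notation A' := (fpsS rho A).
Local Notation B' := (fpsS rho B).
Local Notation X := (fpsX : fps R).
Local Notation cX := (fpsC rho * X).

Let A'_rec : A' *+ 2 = cX + A' * A' + cX * (B' * B').
Proof.
have := congr1 (fpsS rho) (gfA_rec R).
by rewrite fpsSMn !fpsSD !fpsSM fpsSX.
Qed.

Let B'_rec : B' = 1 + A' * B'.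
Proof. by rewrite {1}gfB_rec fpsSD fpsSM fpsS1. Qed.

Let A'_ge0 n : 0 <= A' n.
Proof. by rewrite /fpsS mulr_ge0 ?gfA_ge0 // exprn_ge0 // ltW. Qed.
Let B'_ge0 n : 0 <= B' n.
Proof. by rewrite /fpsS mulr_ge0 ?gfB_ge0 // exprn_ge0 // ltW. Qed.
Let A'0 : A' 0%N = 0. Proof. by rewrite /fpsS gfA0 mul0r. Qed.

Let B'_bound N : prt A' N <= 1 - sigma -> prt B' N <= sigma^-1.
Proof.
move=> hA; have b0 := prt_ge0 N B'_ge0.
have : prt B' N <= 1 + prt A' N * prt B' N.
  rewrite {1}B'_rec prtD; apply: lerD; first exact: prt1_le.
  exact: prt_mul_le.
move: b0 hA; set b := prt B' N; set a := prt A' N => b0 hA h.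
rewrite -[_^-1]mul1r ler_pdivlMr //.
have : a * b <= (1 - sigma) * b by apply: ler_wpM2r.
by lra.
Qed.

Let A'_bound N : prt A' N <= 1 - sigma.
Proof.
elim: N => [|N IH].
  rewrite /prt big_ord0 subr_ge0; have := sigma2; have := tau_lt1; have := sigma_gt0; nra.
have hB := B'_bound IH; have a0 := prt_ge0 N A'_ge0; have x0 := prt_ge0 N.+1 A'_ge0.
have b0 := prt_ge0 N B'_ge0.
have sq : prt (A' * A') N.+1 <= prt A' N.+1 * prt A' N.
  rewrite prt_mul /prt mulr_suml; apply: ler_sum => -[[|i] Hi] _ /=.
    by rewrite A'0 !mul0r.
  by apply: ler_wpM2l => //; apply: prt_nondecr => //; rewrite subSS leq_subr.
have bb : prt (B' * B') N <= sigma^-1 * sigma^-1.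
  by apply: le_trans (prt_mul_le _ _ _) _ => //; apply: ler_pM.
have E : prt A' N.+1 + prt A' N.+1
    = rho * prt X N.+1 + prt (A' * A') N.+1 + rho * prt (B' * B') N.
  by rewrite -prtD -mulr2n A'_rec -[cX * (B' * B')]mulrA !prtD !prtCM prtXM.
have X1 := @prtX_le R N.+1.
have ts : rho * (sigma^-1 * sigma^-1) = tau.
  rewrite /rho -sigma2; field; exact: lt0r_neq0.
move: E sq bb X1 ts x0 IH; rewrite -?mulr2n.
set x := prt A' N.+1; set a := prt A' N; set y := prt (A' * A') _; set d := prt (B' * B') _.
set p := prt X _; set s1 := sigma^-1 => E sq bb X1 ts x0 IH.
have h1 : rho * p <= rho by rewrite ler_piMr // ltW.
have h2 : rho * d <= tau by rewrite -ts ler_wpM2l // ltW.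
have h3 : x * a <= x * (1 - sigma) by apply: ler_wpM2l.
have h4 : x * (1 + sigma) <= (1 - sigma) * (1 + sigma).
  have -> : (1 - sigma) * (1 + sigma) = 1 - tau by rewrite -sigma2; ring.
  have := rhoE; nra.
by rewrite -(@ler_pM2r _ (1 + sigma)) // addr_gt0.
Qed.

Let asumA : asum A' (1 - sigma) /\ asum B' sigma^-1.
Proof.
have [a ha ale] := asum_ge0_exists A'_ge0 A'_bound.
have [b hb ble] := asum_ge0_exists B'_ge0 (fun N => B'_bound (A'_bound N)).
have E1 : b = 1 + a * b.
  by apply: (asum_uniq hb); rewrite B'_rec; apply: asumD (asum1 R) _; apply: asumM.
have E2 : a *+ 2 = rho * 1 + a * a + rho * 1 * (b * b).
  apply: (asum_uniq (asumMn 1 ha)); rewrite A'_rec.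
  have hX := asumM (asumC rho) (asumX R).
  by apply: asumD; [apply: asumD => //; apply: asumM|apply: asumM => //; apply: asumM].
have wb : (1 - a) * b = 1 by rewrite mulrBl mul1r {1}E1 addrK.
have u2 : (1 - a) ^+ 2 * (b * b) = 1 by rewrite expr2 mulrACA wb mulr1.
have E : ((1 - a) ^+ 2 - tau) ^+ 2 = 0.
  have h : (1 - a) ^+ 2 * (1 - (1 - a) ^+ 2) = rho * ((1 - a) ^+ 2 + 1).
    have -> : 1 - (1 - a) ^+ 2 = rho * (1 + b * b) by rewrite -mulr_natr in E2; lra.
    by rewrite mulrCA mulrDr mulr1 u2.
  have := rhoE; have := tauE; rewrite /rho => t1 t2.
  have r : rho = tau ^+ 2 by [].
  move: h; rewrite r; set U := (1 - a) ^+ 2 => h.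
  have -> : (U - tau) ^+ 2 = tau ^+ 2 * (U + 1) - U * (1 - U) + U * (1 - 2 * tau - tau ^+ 2) by ring.
  by rewrite -h subrr add0r -t2 subrr mulr0.
have wE : 1 - a = sigma.
  have /eqP : (1 - a) ^+ 2 = sigma ^+ 2.
    by rewrite sigma2; apply/eqP; rewrite -subr_eq0 -sqrf_eq0 E.
  rewrite eqf_sqr => /orP[/eqP//|/eqP h].
  by have := sigma_gt0; move: ale; lra.
have aE : a = 1 - sigma by rewrite -wE subKr.
have bE : b = sigma^-1.
  apply: (mulfI (lt0r_neq0 sigma_gt0)).
  by rewrite mulfV ?lt0r_neq0 // -{1}wE.
by rewrite -aE -bE.
Qed.

Let asumG b : exists v, asum (fpsS rho (gfG R b)) v.
Proof.
have [ha hb] := asumA.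
pose H := (A * B * B * B) *+ 2 + (B * B) *+ 2.
have hH : asum (fpsS rho H) (((1 - sigma) * sigma^-1 * sigma^-1 * sigma^-1) *+ 2 + (sigma^-1 * sigma^-1) *+ 2).
  rewrite /H fpsSD !fpsSMn !fpsSM; apply: asumD; apply: asumMn; do ?apply: asumM => //.
have b0 n : 0 <= gfG R b n <= H n := gfG_bounds R b n.
have H0 n : 0 <= H n by have /andP[h1 h2] := b0 n; apply: le_trans h2.
apply: (@asum_dominated R _ (fpsS rho H)).
  move=> n; have /andP[h1 h2] := b0 n; have r0 : 0 <= rho ^+ n by rewrite exprn_ge0 // ltW.
  by rewrite /fpsS mulr_ge0 //= ler_wpM2r.
by move=> N; apply: (asum_ge0_le N _ hH) => n; rewrite /fpsS mulr_ge0 // exprn_ge0 // ltW.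
Qed.

Lemma gfP_cvg b : (fun n => gfP R b n * rho ^+ n) @ \oo --> (4^-1 : R).
Proof.
have [ha hb] := asumA; have [g hg] := asumG b.
set P' := fpsS rho (gfP R b); set G' := fpsS rho (gfG R b) in hg.
have := congr1 (fpsS rho) (P_Delta (gfA_rec R) (gfB_rec R) (gfPB_rec R b) (gfP_rec R b)).
rewrite !(fpsSM, fpsSMn, fpsSD, fpsSN, fpsS1, fpsSX) -/P' -/G'.
set K := (X in _ = X -> _) => EK.
have hX := asumM (asumC rho) (asumX R).
have hw : asum (1 - A') (1 - (1 - sigma)) := asumB (asum1 R) ha.
have hK : asum K (rho * 1 * ((1 - (1 - sigma)) * (1 - (1 - sigma)) + 1)
    * (1 - sigma + rho * 1 * (sigma^-1 * sigma^-1 * sigma^-1 * sigma^-1)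
       + rho * 1 * (sigma^-1 * sigma^-1 * sigma^-1))
    + rho * 1 * ((1 - (1 - sigma)) *
       ((((1 - (1 - sigma)) * (1 - (1 - sigma))) *+ 2 - 1 + rho * 1) * g))).
  rewrite /K; have h1 := asum1 R.
  apply: asumD.
    apply: asumM; first exact: (asumM hX (asumD (asumM hw hw) h1)).
    have b3 := asumM (asumM hb hb) hb; have b4 := asumM b3 hb.
    exact: (asumD (asumD ha (asumM hX b4)) (asumM hX b3)).
  have hY := asumD (asumB (asumMn 1 (asumM hw hw)) h1) hX.
  exact: (asumM hX (asumM hw (asumM hY hg))).
have {hK} hK : asum K (2 * Num.sqrt 2 * rho).
  congr (asum K _) : hK; rewrite subKr !mulr1 -expr2 sigma2.
  have -> : tau *+ 2 - 1 + rho = 0 by rewrite rhoE -mulr_natr; ring.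
  rewrite mul0r !mulr0 addr0.
  have -> : rho * (sigma^-1 * sigma^-1 * sigma^-1 * sigma^-1) = 1.
    by rewrite /rho -sigma2; field; exact: lt0r_neq0.
  have -> : rho * (sigma^-1 * sigma^-1 * sigma^-1) = sigma.
    by rewrite /rho -sigma2; field; exact: lt0r_neq0.
  by rewrite /tau; ring.
pose c := fpsC rho : fps R.
have c6 : 1 + c * c = c *+ 6.
  rewrite /c fpsCM -(fpsC1 R) fpsCD; apply/funext => -[|n]; rewrite coefpsMn /= ?mul0rn //.
  by rewrite -mulr_natr rhoE; have := tauE; nra.
have geo : (1 - c * c * X) * geom (rho ^+ 2) = 1.
  by rewrite mulrBl mul1r {1}geomE expr2 -fpsCM -/c; ring.
pose Q := (P' * (1 - X)) *+ 2.
have EQ : Q = K * geom (rho ^+ 2).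
  transitivity (Q * ((1 - c * c * X) * geom (rho ^+ 2))); first by rewrite geo mulr1.
  rewrite mulrA -EK; congr (_ * _); rewrite /Q.
  by apply: (eq_by_cofactor (k := - (P' * X) *+ 2) c6); rewrite /c; ring.
have rr : 0 <= rho ^+ 2 < 1.
  rewrite exprn_ge0 ?ltW //= expr_lt1 ?ltW //; by have := rho_lt; have := rho_gt0; lra.
have [_ hQ] := asumM hK (asum_geom rr); rewrite -EQ in hQ.
have E n : gfP R b n * rho ^+ n = prt Q n.+1 / 2.
  have half (x : R) : (x + x) / 2 = x by field.
  by rewrite /Q mulr2n prtD prt_telescope half.
under eq_fun do rewrite E.
have -> : 4^-1 = 2 * Num.sqrt 2 * rho * (1 - rho ^+ 2)^-1 / 2 :> R.
  have d0 : 1 - rho ^+ 2 != 0 by rewrite subr_eq0 eq_sym lt_eqF //; case/andP: rr.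
  have e : 1 - rho ^+ 2 = 4 * Num.sqrt 2 * rho.
    have e1 : 1 - rho ^+ 2 = (2 * tau) * (2 - 2 * tau) by rewrite rhoE; ring.
    have h : 1 - tau = Num.sqrt 2 * tau by rewrite /tau mulrBr mulr1 -expr2 r2; ring.
    rewrite e1 /rho; have -> : 2 * tau * (2 - 2 * tau) = 4 * tau * (1 - tau) by ring.
    by rewrite h; ring.
  rewrite -[4^-1](mulfK d0) e; field.
  by rewrite e in d0; move: d0; rewrite !mulf_eq0 !negb_or => /andP[/andP[_ ->] ->].
apply: cvgM; last exact: cvg_cst.
exact/(cvgn_shiftS (prt Q)).
Qed.

Local Notation s := (sqc R : fps R).
Definition gcoef : fps R := fpsS (- rho) s.
Definition fcoef : fps R := gcoef * s.

Lemma sqc_sq : s * s = 1 - X.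
Proof.
have E1 : (fpsD s * (1 - X)) *+ 2 = - (X * s).
  apply/funext => n; rewrite coefpsMn mulrBr mulr1 coefpsB (mulrC _ X) coefpsN !coefpsXM.
  case: n => [|n]; rewrite /fpsD; first by rewrite mulr0n subr0 mul0rn oppr0.
  rewrite [s n.+1]/= -[_ *+ n.+1]mulr_natr -[s n *+ n]mulr_natr -[LHS]mulr_natr.
  have h : (n.*2.+2%:R : R) != 0 by rewrite pnatr_eq0.
  have e2 : n.*2.+2%:R = n%:R * 2 + 2 :> R by rewrite -addn2 natrD -muln2 natrM.
  have e0 : n.*2%:R = n%:R * 2 :> R by rewrite -muln2 natrM.
  have e1 : n.+1%:R = n%:R + 1 :> R by rewrite -addn1 natrD.
  by rewrite e1 e0; rewrite e2 in h *; field.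
set y := s * s.
have E2 : fpsD y * (1 - X) = - (X * y).
  rewrite /y fpsDM; have -> : (fpsD s * s + s * fpsD s) * (1 - X)
    = s * ((fpsD s * (1 - X)) *+ 2) by ring.
  by rewrite E1; ring.
have rec n : y n.+1 *+ n.+1 = y n *+ n - y n.
  have := congr1 (fun f : fps R => f n.+1) E2.
  rewrite mulrBr mulr1 coefpsB (mulrC _ X) coefpsN !coefpsXM /fpsD => h.
  by rewrite -[LHS](subrK (y n *+ n)) h addrC.
have y0 : y 0%N = 1 by rewrite /y coefpsM big_ord1 mulr1.
have y1 : y 1%N = -1 by have := rec 0%N; rewrite mulr1n mulr0n sub0r y0.
have y2 n : y n.+2 = 0.
  elim: n => [|n IH].
    by have /eqP := rec 1%N; rewrite mulr1n subrr mulrn_eq0 => /eqP.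
  by have /eqP := rec n.+2; rewrite IH mul0rn subrr mulrn_eq0 => /eqP.
apply/funext => -[|[|n]]; rewrite coefpsB coefps1 /fpsX /=.
- by rewrite y0 subr0.
- by rewrite y1 sub0r.
- by rewrite y2 subr0.
Qed.

Lemma even_odd_sq (f : fps R) :
  let e : fps R := fun n => f n.*2 in let o : fps R := fun n => f n.*2.+1 in
  (forall n, (f * f) n.*2 = (e * e + X * (o * o)) n) /\
  (forall n, (f * f) n.*2.+1 = ((e * o) *+ 2) n).
Proof.
move=> e o.
have split2 (F : nat -> R) n : \sum_(i < n.*2) F i = \sum_(j < n) (F j.*2 + F j.*2.+1).
  by elim: n => [|n IH]; rewrite ?big_ord0 // doubleS 2!big_ord_recr /= IH big_ord_recr /= addrA.
split=> n.
  have -> : (f * f) n.*2 = \sum_(i < n.*2) f i * f (n.*2 - i)%N + f n.*2 * f 0%N.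
    by rewrite coefpsM big_ord_recr /= subnn.
  rewrite (split2 (fun k => f k * f (n.*2 - k)%N)) big_split coefpsD coefpsXM.
  rewrite [(e * e) n]coefpsM big_ord_recr /= subnn -!addrA; congr (_ + _).
    by apply: eq_bigr => j _; rewrite /e doubleB.
  rewrite addrC; congr (_ + _).
  case: n => [|n]; first by rewrite big_ord0.
  rewrite coefpsM; apply: eq_bigr => j _; rewrite /o; congr (_ * f _).
  by have := ltn_ord j; lia.
have -> : (f * f) n.*2.+1 = \sum_(i < n.+1.*2) f i * f (n.*2.+1 - i)%N.
  by rewrite coefpsM doubleS.
rewrite (split2 (fun k => f k * f (n.*2.+1 - k)%N)) big_split coefpsMn mulr2n /=.
rewrite coefpsM; congr (_ + _).
  by apply: eq_bigr => j _; rewrite /e /o; congr (_ * f _); have := ltn_ord j; lia.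
rewrite [RHS](reindex_inj rev_ord_inj) /=; apply: eq_bigr => j _; rewrite mulrC /e /o.
by have := ltn_ord j => hj; congr (f _ * f _); lia.
Qed.

Lemma gfA_fcoef n : (0 < n)%N -> gfA R n * rho ^+ n = - fcoef n.*2.
Proof.
set f := fcoef; have [Ee Eo] := even_odd_sq f.
pose e : fps R := fun n => f n.*2; pose o : fps R := fun n => f n.*2.+1.
have ff : f * f = (1 + cX) * (1 - X).
  have -> : f * f = fpsS (- rho) (s * s) * (s * s).
    by rewrite /f /fcoef fpsSM -/gcoef; ring.
  rewrite sqc_sq fpsSB fpsS1 fpsSX; congr (_ * _).
  by apply/funext => k; rewrite coefpsB coefpsD !coefpsCM mulNr opprK.
have coefff k : (f * f) k = (k == 0)%:R - (1 - rho) * (k == 1)%:R - rho * (k == 2)%:R.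
  have -> : f * f = 1 - X + cX - fpsC rho * (X * X) by rewrite ff; ring.
  rewrite !(coefpsB, coefpsD) !coefpsCM coefpsXM coefps1 /fpsX.
  by case: k => [|[|[|k]]] /=; ring.
have E1 : e * e + X * (o * o) = 1 - cX.
  apply/funext => k; rewrite -Ee coefff coefpsB coefps1 coefpsCM /fpsX.
  by case: k => [|[|k]] /=; ring.
have E2 : e * o = fpsC (- tau).
  have E2' : (e * o) *+ 2 = fpsC (- tau) *+ 2.
    apply/funext => k; rewrite -Eo coefff coefpsMn rhoE.
    by case: k => [|[|k]] /=; ring.
  apply/funext => k; have := congr1 (fun h : fps R => h k) E2'; rewrite !coefpsMn => /eqP.
  by rewrite eqrMn2r => /eqP.
have eo2 : (e * o) * (e * o) = fpsC rho by rewrite E2 fpsCM mulrNN -expr2.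
have Ue : (e * e) * (e * e) + (cX - 1) * (e * e) + cX = 0.
  have h : (e * e) * (e * e + X * (o * o)) = (e * e) * (1 - cX) by rewrite E1.
  have h2 : (e * e) * (e * e) + X * fpsC rho = (e * e) * (1 - cX) by rewrite -h -eo2; ring.
  by apply: (eq_by_cofactor (k := 1) h2); ring.
pose w : fps R := 1 - A'.
have Uw : (w * w) * (w * w) + (cX - 1) * (w * w) + cX = 0.
  have := congr1 (fpsS rho) (u_equation (gfA_rec R) (gfB_rec R)).
  rewrite !(fpsSM, fpsSMn, fpsSD, fpsSN, fpsS1, fpsSX) -/w => ->.
  by apply/funext => k; rewrite /fpsS mul0r.
have e0 : e 0%N = 1.
  by rewrite /e /f /fcoef coefpsM big_ord1 /gcoef /fpsS /= !mulr1.
have w0 : w 0%N = 1 by rewrite /w coefpsB A'0 subr0.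
have sq0 (h : fps R) : (h * h) 0%N = h 0%N * h 0%N by rewrite coefpsM big_ord1.
have D1 : e * e - w * w = 0.
  apply: (@fps_mul_eq0 _ _ (e * e + w * w + (cX - 1))).
    rewrite !coefpsD coefpsN !sq0 coefpsCM e0 w0 coefps1 /fpsX /=.
    by rewrite !mulr1 mulr0 add0r addrK oner_eq0.
  apply: (eq_by_cofactor (k := 1) (etrans Ue (esym Uw))); ring.
have D2 : e - w = 0.
  apply: (@fps_mul_eq0 _ _ (e + w)).
    by rewrite coefpsD e0 w0 -mulr2n pnatr_eq0.
  by rewrite -D1; ring.
move=> n0; have := congr1 (fun h : fps R => h n) (subr0_eq D2).
rewrite /e -/f => ->; rewrite /w coefpsB coefps1 opprB /fpsS.
by case: (n) n0 => // k _; rewrite /= subr0.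
Qed.

Let gcoef_bound k : `|gcoef k| <= rho ^+ k.
Proof.
rewrite /gcoef /fpsS normrM normrX normrN (ger0_norm (ltW rho_gt0)).
by rewrite ler_piMl ?sqc_norm_le1 // exprn_ge0 // ltW.
Qed.

Let asum_gcoef : exists2 v, asum gcoef v & v ^+ 2 = 1 + rho.
Proof.
have rr : 0 <= rho < 1 by rewrite ltW //=; have := rho_lt; have := rho_gt0; lra.
have [v hv] : exists v, asum gcoef v.
  apply: (@asum_exists R gcoef (1 - rho)^-1) => N.
  apply: le_trans (asum_ge0_le N _ (asum_geom rr)).
    by apply: ler_sum => i _; apply: gcoef_bound.
  by move=> n; rewrite exprn_ge0 // ltW.
exists v => //; apply: (asum_uniq (asumM hv hv)).
rewrite /gcoef -fpsSM sqc_sq fpsSB fpsS1 fpsSX.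
have -> : 1 + rho = 1 - (- rho) * 1 by rewrite mulr1 opprK.
by apply: asumB (asum1 R) _; apply: asumM (asumC _) (asumX R).
Qed.

Let kappa : R := - Num.sqrt (4 * pi)^-1.

Let omega_shift k : (fun j => sqc R j * omega R (j + k)) @ \oo --> kappa.
Proof.
have E j : sqc R j * omega R (j + k) = sqc R j * omega R j * Num.sqrt ((1 + k%:R * harmonic j) ^+ 3).
  rewrite /omega -mulrA -sqrtrM ?exprn_ge0 // -exprMn; congr (_ * Num.sqrt (_ ^+ _)).
  have j0 : j.+1%:R != 0 :> R by rewrite pnatr_eq0.
  by rewrite /harmonic /= -[(j + k).+1]addSn natrD; move: (j.+1%:R : R) j0 => J j0; field.
under eq_fun do rewrite E; rewrite -[kappa]mulr1; apply: cvgM; first exact: sqc_omega_cvg.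
rewrite -[X in _ --> X](@sqrtr1 R); apply: continuous_cvg; first exact: sqrt_continuous.
have c : (fun j => 1 + k%:R * harmonic j) @ \oo --> 1 + k%:R * (0 : R).
  by apply: cvgD; [exact: cvg_cst|apply: cvgM; [exact: cvg_cst|exact: cvg_harmonic]].
by have := cvgn_cube c; rewrite mulr0 addr0 expr1n.
Qed.

Let omega_ge0 k : 0 <= omega R k. Proof. exact: sqrtr_ge0. Qed.

Let omega_mul j k : omega R (j + k) <= omega R j * omega R k.
Proof.
rewrite /omega -sqrtrM ?exprn_ge0 // ler_wsqrtr // -exprMn lerXn2r ?nnegrE //.
by rewrite -natrM ler_nat; nia.
Qed.

Let omega_le k : omega R k <= 3 ^+ k.
Proof.
have e : (3 ^+ k : R) = Num.sqrt ((3 ^+ k) ^+ 2) by rewrite sqrtr_sqr ger0_norm // exprn_ge0.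
rewrite e /omega ler_wsqrtr // -exprM mulnC exprM -!natrX ler_nat.
elim: k {e} => // k IH.
have h : (k.+2 ^ 3 <= 8 * k.+1 ^ 3)%N by rewrite -[8%N]/(2 ^ 3)%N -expnMn leq_exp2r //; lia.
by apply: leq_trans h _; rewrite [X in (_ <= X)%N]expnS leq_mul.
Qed.

Lemma fcoef_cvg v : asum gcoef v -> (fun m => fcoef m * omega R m) @ \oo --> v * kappa.
Proof.
move=> hv.
pose a m k := gcoef k * (sqc R (m - k.+1) * omega R (m - k.+1 + k)).
have [C hC] : exists C, forall j, `|sqc R j * omega R j| <= C.
  have /cvg_seq_bounded/bounded_fun_has_ubound[C hC] : cvgn (fun j => `|sqc R j * omega R j|).
    by apply: cvgP; apply: cvg_norm; exact: sqc_omega_cvg.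
  by exists C => j; apply: hC; exists j.
have C0 : 0 <= C by apply: le_trans (hC 0%N).
have rr : 0 <= 3 * rho < 1 by rewrite rho_lt mulr_ge0 // ltW.
have key : (fun m => prt (a m) m) @ \oo --> v * kappa.
  apply: (@tannery R _ (fun k => C * geom (3 * rho) k) (fun k => gcoef k * kappa) (C * (1 - 3 * rho)^-1)).
  - move=> m k km; rewrite /a normrM.
    have -> : C * geom (3 * rho) k = rho ^+ k * (C * 3 ^+ k) by rewrite /geom exprMn; ring.
    apply: ler_pM; [exact: normr_ge0|exact: normr_ge0|exact: gcoef_bound|].
    rewrite normrM (ger0_norm (omega_ge0 _)).
    apply: (@le_trans _ _ (`|sqc R (m - k.+1)| * (omega R (m - k.+1) * omega R k))).
      by apply: ler_wpM2l.
    rewrite mulrA; apply: ler_pM => //; first by rewrite mulr_ge0.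
    by have := hC (m - k.+1)%N; rewrite normrM (ger0_norm (omega_ge0 _)).
  - by move=> k; rewrite mulr_ge0 // /geom exprn_ge0 // mulr_ge0 // ltW.
  - move=> N; rewrite /prt -mulr_sumr ler_wpM2l //; apply: (asum_ge0_le N _ (asum_geom rr)) => n.
    by rewrite /geom exprn_ge0 // mulr_ge0 // ltW.
  - move=> k; apply: cvgM; first exact: cvg_cst.
    exact: (cvgn_sub k.+1 (omega_shift k)).
  - have -> : prt (fun k => gcoef k * kappa) = (fun N => prt gcoef N * kappa).
      by apply/funext => N; rewrite /prt mulr_suml.
    by apply: cvgM; [case: hv|exact: cvg_cst].
have -> : (fun m => fcoef m * omega R m) = (fun m => prt (a m.+1) m.+1).
  apply/funext => m; rewrite /fcoef coefpsM mulr_suml; apply: eq_bigr => i _.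
  by rewrite /a subSS subnK ?mulrA // -ltnS ltn_ord.
exact/(cvgn_shiftS (fun m => prt (a m) m)).
Qed.

Lemma gfA_cvg :
  (fun n => gfA R n * rho ^+ n * omega R n.*2) @ \oo --> Num.sqrt (1 + rho) * Num.sqrt (4 * pi)^-1.
Proof.
have [v hv v2] := asum_gcoef.
have c : (fun n => - (fcoef n.*2 * omega R n.*2)) @ \oo --> v * Num.sqrt (4 * pi)^-1.
  have -> : v * Num.sqrt (4 * pi)^-1 = - (v * kappa) by rewrite /kappa mulrN opprK.
  apply: cvgN; have /cvgrPdist_lt h := fcoef_cvg hv.
  apply/cvgrPdist_lt => e /h[N _ H]; exists N => // n /= Nn; apply: H => /=; lia.
have c2 : (fun n => gfA R n * rho ^+ n * omega R n.*2) @ \oo --> v * Num.sqrt (4 * pi)^-1.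
  apply/cvgn_shiftS.
  have -> : (fun n => gfA R n.+1 * rho ^+ n.+1 * omega R n.+1.*2)
      = (fun n => - (fcoef n.+1.*2 * omega R n.+1.*2)).
    by apply/funext => n; rewrite gfA_fcoef // mulNr.
  exact: (proj2 (cvgn_shiftS (fun n => - (fcoef n.*2 * omega R n.*2)) _) c).
have v0 : 0 <= v.
  have : 0 <= v * Num.sqrt (4 * pi)^-1.
    apply: (ler_cvg_to (cvg_cst 0) c2); near=> n.
    by rewrite mulr_ge0 // mulr_ge0 ?gfA_ge0 // exprn_ge0 // ltW.
  rewrite pmulr_lge0 // sqrtr_gt0 invr_gt0 mulr_gt0 // pi_gt0 //.
by rewrite -v2 sqrtr_sqr ger0_norm.
Unshelve. all: by end_near. Qed.

Lemma powR_three_half (x : R) : 0 <= x -> x `^ (3 / 2) = Num.sqrt (x ^+ 3).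
Proof.
by move=> x0; rewrite powRrM powR_mulrn // powR12_sqrt // exprn_ge0.
Qed.

Lemma ratio_cvg b :
  let c : R := Num.sqrt ((2 + Num.sqrt 2) / 2) * Num.sqrt pi in
  (fun n => gfP R b n / gfA R n / (c * (n%:R `^ (3 / 2)))) @ \oo --> (1 : R).
Proof.
move=> c; have pi0 : 0 < pi :> R := pi_gt0 _.
have c0 : 0 < c by rewrite mulr_gt0 // sqrtr_gt0 ?divr_gt0 // addr_gt0 // sqrtr_gt0.
pose L := Num.sqrt (1 + rho) * Num.sqrt (4 * pi)^-1.
have L0 : 0 < L.
  by rewrite mulr_gt0 // sqrtr_gt0 ?invr_gt0 ?mulr_gt0 // addr_gt0.
have cw : (fun n => omega R n.+1.*2 / n.+1%:R `^ (3 / 2)) @ \oo --> Num.sqrt (8 : R).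
  have E n : omega R n.+1.*2 / n.+1%:R `^ (3 / 2) = Num.sqrt ((2 + harmonic n) ^+ 3).
    rewrite powR_three_half // /omega -sqrtrV ?exprn_ge0 // -sqrtrM ?exprn_ge0 //.
    rewrite -exprVn -exprMn; congr (Num.sqrt (_ ^+ _)); rewrite /harmonic /=.
    have n0 : n.+1%:R != 0 :> R by rewrite pnatr_eq0.
    by rewrite -[n.+1.*2.+1]addn1 -muln2 natrD natrM; move: (n.+1%:R : R) n0 => J n0; field.
  under eq_fun do rewrite E; apply: continuous_cvg; first exact: sqrt_continuous.
  have d : (fun j => 2 + harmonic j) @ \oo --> (2 + 0 : R).
    by apply: cvgD; [exact: cvg_cst|exact: cvg_harmonic].
  have e8 : 2 ^+ 3 = 8 :> R by ring.
  by have := cvgn_cube d; rewrite addr0 e8.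
have lim1 : 1 = 4^-1 / L * (Num.sqrt 8 / c).
  have e : L * c = Num.sqrt 2^-1.
    have p1 : 0 <= 1 + rho by rewrite addr_ge0 // ltW.
    have p2 : 0 <= (2 + Num.sqrt 2) / 2 :> R by rewrite divr_ge0 // addr_ge0.
    have p3 : 0 <= (1 + rho) * (4 * pi)^-1 by rewrite mulr_ge0 // invr_ge0 mulr_ge0 // ltW.
    rewrite /L /c -(sqrtrM _ p1) -(sqrtrM _ p2) -(sqrtrM _ p3).
    congr Num.sqrt; rewrite rhoE /tau; move: (@pi R) pi0 => P P0.
    have := r2; set x := Num.sqrt 2 => h.
    have -> : (1 + (1 - 2 * (x - 1))) * (4 * P)^-1 * ((2 + x) / 2 * P) = (4 - x ^+ 2) / 4.
      by field; rewrite gt_eqF.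
    by rewrite h; field.
  have e8 : Num.sqrt 8 = 4 * Num.sqrt 2^-1 :> R.
    have {1}-> : 8 = 4 ^+ 2 * 2^-1 :> R by field.
    by rewrite sqrtrM ?sqr_ge0 // sqrtr_sqr ger0_norm.
  have h0 : Num.sqrt 2^-1 != 0 :> R by rewrite gt_eqF // sqrtr_gt0 invr_gt0.
  apply/esym; transitivity (4^-1 * Num.sqrt 8 / (L * c)).
    by rewrite (invfM L c) mulrACA -mulrA.
  by rewrite e e8 mulrA mulVf // mul1r mulfV.
apply/cvgn_shiftS; rewrite [X in _ --> X]lim1.
have E n : gfP R b n.+1 / gfA R n.+1 / (c * (n.+1%:R `^ (3 / 2)))
  = gfP R b n.+1 * rho ^+ n.+1 / (gfA R n.+1 * rho ^+ n.+1 * omega R n.+1.*2)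
    * (omega R n.+1.*2 / n.+1%:R `^ (3 / 2) / c).
  have w0 : omega R n.+1.*2 != 0 by rewrite gt_eqF // sqrtr_gt0 exprn_gt0.
  have r0 : rho ^+ n.+1 != 0 by rewrite expf_neq0 // gt_eqF.
  exact: insert_factors.
under eq_fun do rewrite E.
apply: cvgM; last first.
  by apply: cvgM; [exact: cw|exact: cvg_cst].
apply: cvgM; first exact: (proj2 (cvgn_shiftS _ _) (gfP_cvg b)).
apply: cvgV; first by rewrite gt_eqF.
exact: (proj2 (cvgn_shiftS _ _) gfA_cvg).
Qed.

End Asymptotics.

Theorem theorem1p1 (R : realType) :
  let c : R := Num.sqrt ((2 + Num.sqrt 2) / 2) * Num.sqrt pi in
  (fun n : nat => E_Smax R n / (c * (n%:R `^ (3 / 2)))) @ \oo --> (1 : R) /\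
  (fun n : nat => E_Smin R n / (c * (n%:R `^ (3 / 2)))) @ \oo --> (1 : R).
Proof.
move=> c.
have lim b (u : nat -> R) :
    (forall n, (1 < n)%N -> u n = gfP R b n / gfA R n / (c * (n%:R `^ (3 / 2)))) ->
    u @ \oo --> (1 : R).
  move=> uE; have /cvgrPdist_lt h := @ratio_cvg R b.
  apply/cvgrPdist_lt => e /h[N _ H]; exists (maxn N 2) => // n /=.
  by rewrite geq_max => /andP[Nn n2]; rewrite uE //; apply: H.
split; [apply: (lim true)|apply: (lim false)] => n n1; congr (_ / _).
  exact: (expectation_shapes R true n1).
exact: (expectation_shapes R false n1).
Qed.
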